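(* Let $\mathbf{\Phi}$ be a geometrically ergodic Markov chain on $\mathsf{X}$ with Lyapunov function $V$ and invariant probability $\pi$, let $m:\mathsf{X}\to\mathbb{R}^{k\times k}$ be bounded, let $M_t=m(\Phi_t)$, and let $\overline{M}:=\int m(x)\,\pi(dx)$. Suppose that the eigenvalues $\{\lambda_i(\overline{M})\}$ of $\overline{M}$ are real and distinct. Then the maximal eigenvalue $\lambda_\alpha=\xi_\alpha$ of $\mathcal{L}_\alpha$ satisfies: (i) $\frac{d}{d\alpha}\lambda_\alpha\big|_{\alpha=0}=-\lambda_{\min}(\overline{M})$. (ii) The second derivative is given by $$\frac{d^2}{d\alpha^2}\lambda_\alpha\Big|_{\alpha=0}=2\sum_{l=0}^\infty v_0^T\,\mathsf{E}_\pi\bigl[(M_0-\overline{M})(M_{l+1}-\overline{M})\bigr]\,r_0,$$ where $r_0$ is a right eigenvector of $\overline{M}$ corresponding to $\lambda_{\min}(\overline{M})$, and $v_0$ is the left eigenvector, normalized so that $v_0^Tr_0=1$. (iii) Suppose that $m(x)=m(x)^T$ for $x\in\mathsf{X}$. Then we may take $v_0=r_0$ in (ii), and the second derivative may be expressed as $$\frac{d^2}{d\alpha^2}\lambda_\alpha\Big|_{\alpha=0}=\operatorname{trace}(\Gamma-\Sigma),$$ where $\Gamma$ is the Central Limit Theorem covariance for the stationary vector-valued stochastic process $F_k=[M_k-\overline{M}]v_0$, and $\Sigma=\mathsf{E}_\pi[F_kF_k^T]$ is its variance.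
   Context: Assumptions on the Markov chain. $\mathbf{\Phi}=\{\Phi_t\}$ is a Markov chain on a general state space $\mathsf{X}$ with transition kernel $P$, and it is geometrically ergodic, meaning: (a) (irreducibility and aperiodicity) there is a $\sigma$-finite measure $\psi$ on $\mathsf{X}$ such that for every $x\in\mathsf{X}$ and measurable $A\subset\mathsf{X}$ with $\psi(A)>0$, $P^t(x,A)=\mathsf{P}\{\Phi_t\in A\mid\Phi_0=x\}>0$ for all sufficiently large $t$; (b) (geometric drift) there are a Lyapunov function $V:\mathsf{X}\to[1,\infty)$, constants $\gamma<1$, $b<\infty$, $t_0\ge 1$, a measurable (''small'') set $C$ and a nontrivial (''small'') measure $\nu$ on $\mathsf{X}$ with $PV(x)\le\gamma V(x)+b\mathbb{I}_C(x)$ for all $x\in\mathsf{X}$ and $P^{t_0}(x,\cdot)\ge\nu(\cdot)$ for all $x\in C$. The chain then has a unique invariant probability $\pi$, and it is assumed (without loss of generality) that $\pi(V^2)<\infty$. $\mathsf{E}_x$ denotes expectation given $\Phi_0=x$, and $\mathsf{E}_\pi$ denotes expectation for the stationary chain, $\Phi_0\sim\pi$. $\|\cdot\|$ is the Euclidean norm on $\mathbb{C}^k$. $L_\infty^V$ is the space of measurable $g:\mathsf{X}\to\mathbb{C}^k$ with $\|g\|_V:=\sup_x\|g(x)\|/V(x)<\infty$. For a linear operator $\mathcal{L}$ on $L_\infty^V$, the induced norm is $|||\mathcal{L}|||_V:=\sup_{f\ne 0}\|\mathcal{L}f\|_V/\|f\|_V$ and its spectral radius is $\lim_{t\to\infty}|||\mathcal{L}^t|||_V^{1/t}$.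 For $\alpha\in\mathbb{R}$, $\mathcal{L}_\alpha f(x):=\mathsf{E}_x[(I-\alpha\,m(\Phi_1))^T f(\Phi_1)]$ for $f\in L_\infty^V$, where $I$ is the $k\times k$ identity matrix, and $\xi_\alpha$ is the spectral radius of $\mathcal{L}_\alpha$. When the eigenvalues of $\overline{M}$ are real and distinct, for all sufficiently small $\alpha>0$ the spectral radius $\xi_\alpha$ is itself an eigenvalue of $\mathcal{L}_\alpha$, the maximal one, denoted $\lambda_\alpha$; $\lambda_0=1$. $\lambda_{\min}(\overline{M})$ is the smallest eigenvalue of $\overline{M}$. The Central Limit Theorem covariance of the stationary zero-mean process $F_k$ (where here $k\in\mathbb{Z}$ is the time index) is $\Gamma=\sum_{k=-\infty}^{\infty}\mathsf{E}_\pi[F_0F_k^T]$.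
   Formalization: In (ii) the two factors are exchanged, to E_π[(M_{l+1}−M̄)(M_0−M̄)], since the printed order fails for non-symmetric m with this L_α; derivatives at 0 are right derivatives (λ_α is defined for α≥0), and ψ is taken nonzero. *)

(* Defs.v *)
From HB Require Import structures.
From mathcomp Require Export all_boot all_order all_algebra.
From mathcomp Require Export all_classical all_reals all_analysis.
From mathcomp Require Export complex.
Set Implicit Arguments.
Unset Strict Implicit.
Unset Printing Implicit Defensive.
Export Order.TTheory GRing.Theory Num.Theory.
Export numFieldNormedType.Exports.

Local Open Scope classical_set_scope.
Local Open Scope ring_scope.

Section Chain.
Context {R : realType} {d : measure_display} {X : measurableType d}.
Implicit Types (P : R.-pker X ~> X) (V : X -> R) (pi : probability X R).

Fixpoint kernel_iter P (t : nat) (x : X) (A : set X) : \bar R :=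
  if t is t'.+1 then (\int[P x]_y kernel_iter P t' y A)%E else \d_x A.

(* The irreducibility measure must be nonzero, since otherwise the condition
   is void and periodic chains would be admitted. *)
Definition irreducible_aperiodic P : Prop :=
  exists psi : {measure set X -> \bar R},
    [/\ sigma_finite setT psi,
        psi setT != 0%E
      & forall (x : X) (A : set X), measurable A -> (0 < psi A)%E ->
          \forall t \near \oo, (0 < kernel_iter P t x A)%E].

Definition geometric_drift P V : Prop :=
  [/\ measurable_fun setT V, forall x, 1 <= V x
    & exists (gamma b : R) (t0 : nat) (C : set X)
             (nu : {measure set X -> \bar R}),
      [/\ gamma < 1, (1 <= t0)%N, measurable C, nu setT != 0%E
        & (forall x, (\int[P x]_y (V y)%:E <=
                       (gamma * V x + b * \1_C x)%:E)%E) /\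
          (forall x A, C x -> measurable A ->
             (nu A <= kernel_iter P t0 x A)%E)]].

Definition geometrically_ergodic P V : Prop :=
  irreducible_aperiodic P /\ geometric_drift P V.

Definition invariant P pi : Prop :=
  forall A : set X, measurable A -> (\int[pi]_x P x A)%E = pi A.

Section Process.
Context {d' : measure_display} {Omega : measurableType d'}.
Implicit Types (Pr : probability Omega R) (Phi : nat -> Omega -> X).

(* The sigma-algebra generated by Phi_0, ..., Phi_t. *)
Definition history Phi (t : nat) : set (set Omega) :=
  <<s [set E | exists s A, [/\ (s <= t)%N, measurable A
                             & E = Phi s @^-1` A]] >>.

Definition markov_chain Pr pi P Phi : Prop :=
  [/\ forall t, measurable_fun setT (Phi t),
      forall A, measurable A -> Pr (Phi 0%N @^-1` A) = pi A
    & forall t E A, history Phi t E -> measurable A ->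
        Pr (E `&` (Phi t.+1 @^-1` A)) = (\int[Pr]_(w in E) P (Phi t w) A)%E].

Definition expectation_mx Pr (p q : nat) (Y : Omega -> 'M[R]_(p, q)) :
    'M[R]_(p, q) :=
  \matrix_(i, j) fine ('E_Pr[fun w => Y w i j])%E.

(* E[F_0 F_n^T] at every lag n of Z, for a stationary process F given at
   nonnegative times only: at the negative lag n = - (l + 1), shifting time by
   l + 1 turns E[F_0 F_n^T] into E[F_(l+1) F_0^T]. *)
Definition autocov Pr (k : nat) (F : nat -> Omega -> 'cV[R]_k) (n : int) :
    'M[R]_k :=
  match n with
  | Posz l => expectation_mx Pr (fun w => F 0%N w *m (F l w)^T)
  | Negz l => expectation_mx Pr (fun w => F l.+1 w *m (F 0%N w)^T)
  end.

(* Sums over Z: the two halves, n >= 0 and n < 0, converge separately. *)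
Definition is_cvg_sumZ (u : int -> R) : Prop :=
  cvgn (series (fun l : nat => u (Posz l))) /\
  cvgn (series (fun l : nat => u (Negz l))).

Definition sumZ (u : int -> R) : R :=
  limn (series (fun l : nat => u (Posz l))) +
  limn (series (fun l : nat => u (Negz l))).

Definition clt_covariance Pr (k : nat) (F : nat -> Omega -> 'cV[R]_k) :
    'M[R]_k :=
  \matrix_(i, j) sumZ (fun n => autocov Pr F n i j).

Definition centered (k : nat) (m : X -> 'M[R]_k) (Mbar : 'M[R]_k) Phi
    (t : nat) (w : Omega) : 'M[R]_k :=
  m (Phi t w) - Mbar.

End Process.

Definition mean_mx pi (k : nat) (m : X -> 'M[R]_k) : 'M[R]_k :=
  \matrix_(i, j) \int[pi]_x m x i j.

Definition bounded_measurable_mx (k : nat) (m : X -> 'M[R]_k) : Prop :=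
  (forall i j, measurable_fun setT (fun x => m x i j)) /\
  (exists B : R, forall x i j, `|m x i j| <= B).

Section Operators.
Context {k : nat}.
Implicit Types (f g : X -> 'cV[R[i]]_k).
Implicit Types (L : (X -> 'cV[R[i]]_k) -> (X -> 'cV[R[i]]_k)).

Definition enorm (z : 'cV[R[i]]_k) : R :=
  Num.sqrt (\sum_i (complex.Re (z i ord0) ^+ 2 + complex.Im (z i ord0) ^+ 2)).

Definition Vnorm V g : \bar R := ereal_sup (range (fun x => (enorm (g x) / V x)%:E)).

Definition LinfV V : set (X -> 'cV[R[i]]_k) :=
  [set g : X -> 'cV[R[i]]_k | (forall i, measurable_fun setT (fun x => complex.Re (g x i ord0)) /\
                      measurable_fun setT (fun x => complex.Im (g x i ord0))) /\
           (Vnorm V g < +oo)%E].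

(* Vnorm V f is finite and nonzero on the set over which the supremum is taken. *)
Definition opnorm V L : \bar R :=
  ereal_sup [set (Vnorm V (L f) * ((fine (Vnorm V f))^-1)%:E)%E
            | f in LinfV V `\ (fun=> 0)].

Definition spectral_radius V L : R :=
  fine (limn (fun t : nat => (opnorm V (iter t L) `^ (t%:R^-1))%E)).

Definition is_eigenvalue V L (mu : R[i]) : Prop :=
  exists2 f, (LinfV V `\ (fun=> 0)) f & forall x, L f x = mu *: f x.

Definition is_maximal_eigenvalue V L (lambda : R) : Prop :=
  is_eigenvalue V L (lambda%:C)%C /\
  forall mu : R[i], is_eigenvalue V L mu -> `|mu| <= (lambda%:C)%C.

Definition cintegral (mu : {measure set X -> \bar R}) (h : X -> R[i]) : R[i] :=
  Complex (\int[mu]_y complex.Re (h y)) (\int[mu]_y complex.Im (h y)).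

(* Iterating composes the factors with later times on the left:
   L_alpha^2 f x = E_x[((I - alpha m(Phi_2)) (I - alpha m(Phi_1)))^T f(Phi_2)]. *)
Definition Lop P (m : X -> 'M[R]_k) (alpha : R) f : X -> 'cV[R[i]]_k :=
  fun x => \col_i cintegral (P x)
    (fun y => (map_mx (real_complex R) (1%:M - alpha *: m y)^T *m f y) i ord0).

End Operators.

End Chain.

Section RealMatrices.
Context {R : realType} {k : nat}.
Implicit Types (A : 'M[R]_k).

(* Eigenvalues are counted with algebraic multiplicity, as the roots of the
   characteristic polynomial. *)
Definition real_distinct_eigenvalues A : Prop :=
  exists2 s : seq R, uniq s & char_poly A = \prod_(a <- s) ('X - a%:P).

Definition is_min_eigenvalue A (l : R) : Prop :=
  eigenvalue A l /\ forall a : R, eigenvalue A a -> l <= a.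

End RealMatrices.

Section RightDerivatives.
Context {R : realType}.

(* The spectral radius is the eigenvalue branch of interest for alpha >= 0
   only, hence derivatives at 0 are from the right: to the left of 0 the
   spectral radius follows the largest eigenvalue of the mean matrix, and its
   two-sided derivative at 0 does not exist in general. *)
Definition right_derivative (f : R -> R) (x l : R) : Prop :=
  (fun h : R => h^-1 * (f (x + h) - f x)) @ 0^'+ --> l.

Definition right_derivative2 (f : R -> R) (x l : R) : Prop :=
  exists f' : R -> R,
    [/\ right_derivative f x (f' x),
        \forall y \near x^'+, is_derive (y : R) (1 : R) f (f' y)
      & right_derivative f' x l].

End RightDerivatives.

(* Main.v *)
(** L_alpha acts separately on real and imaginary parts, there as P - alpha N
    with N f = P (m^T f), on the Banach space of functions bounded by a multiple
    of V.  The drift and minorization conditions make P^n contract a weighted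
    oscillation seminorm (Hairer and Mattingly), so P^n f converges
    geometrically to pi(f): the eigenvalue 1 of P is isolated, its eigenspace is
    that of the constant vectors, and there N compresses to the transpose of the
    mean matrix.  Since the eigenvalues of that matrix are distinct, the one with
    eigenvector e_0 and the smallest eigenvalue mu continues to an eigenvector
    e_0 + alpha g_alpha of P - alpha N, found as the fixed point of a
    contraction; its eigenvalue is
    1 - alpha mu - alpha^2 nu(g_alpha) with nu(g_0) = - c_0 N Z N e_0, where Z is
    the sum of P^n over n >= 0 on functions of mean zero.  Modulo this eigenvector
    the norm grows at a strictly smaller rate, so the eigenvalue is the spectral
    radius, and the dual eigenvector which this yields makes the branch
    differentiable.  Expanding Z by its series and using the Markov property turns
    c_0 N Z N e_0 into the sum of the correlations of the theorem. *)
Require Import Defs.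
From HB Require Import structures.
From mathcomp Require Import measurable_realfun ring lra zify.
Set Implicit Arguments.
Unset Strict Implicit.
Unset Printing Implicit Defensive.
Local Open Scope classical_set_scope.
Local Open Scope ring_scope.

(** * Perturbation of an isolated semisimple eigenvalue *)

(** The obstacle is that all [k] eigenvalue branches leave the same eigenvalue 1 of P: for small
    alpha > 0 they are only a multiple of alpha apart, so the isolation of 1 does not single one of
    them out. This is why the constants are given a basis diagonalizing the compression of N, why
    the solvability conditions are divided by differences of its eigenvalues, and why the norm
    weighs the constant coordinates against their complement: a gap of order alpha has to survive a
    coupling of order alpha. The fixed point comes with Lipschitz bounds only, so the corrector is
    not known to be differentiable in alpha. The derivative of the eigenvalue is therefore obtained
    by duality, and its expansion with error alpha^2 is proved separately: an expansion of the
    eigenvalue with error alpha^3 says nothing about the derivative of its derivative. Complex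
    scalars enter only at the end, through pairs of real functions. The constant factors lost in
    this passage, and in replacing the Euclidean norm, disappear under n-th roots. *)

Ltac nonneg := repeat first [assumption | exact: normr_ge0 | exact: ler01
  | exact: ler0n | apply: addr_ge0 | apply: mulr_ge0 | apply: exprn_ge0
  | rewrite invr_ge0 | done].

(** * Norm estimates, geometric series and a criterion of differentiability *)

Section NormBounds.
Context {R : realType} {V : normedModType R}.

Lemma normD_le (x y : V) (a b : R) : `|x| <= a -> `|y| <= b -> `|x + y| <= a + b.
Proof. by move=> xa yb; rewrite (le_trans (ler_normD _ _))// lerD. Qed.

Lemma normB_le (x y : V) (a b : R) : `|x| <= a -> `|y| <= b -> `|x - y| <= a + b.
Proof. by move=> xa yb; rewrite (le_trans (ler_normB _ _))// lerD. Qed.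

Lemma normZ_le (s : R) (x : V) (a b : R) :
  `|s| <= a -> `|x| <= b -> `|s *: x| <= a * b.
Proof. by move=> sa xb; rewrite normrZ ler_pM. Qed.

End NormBounds.

Lemma normM_le (R : realType) (x y a b : R) :
  `|x| <= a -> `|y| <= b -> `|x * y| <= a * b.
Proof. by move=> xa yb; rewrite normrM ler_pM. Qed.

Section BoundedLinear.
Context {R : realType} {V W : normedModType R}.

Lemma bounded_linear_cvg (T : {linear V -> W}) (K : R) (u : nat -> V) (l : V) :
  (forall f, `|T f| <= K * `|f|) -> u @ \oo --> l -> T \o u @ \oo --> T l.
Proof.
move=> TK ul; apply: continuous_cvg => //.
apply: bounded_linear_continuous; apply/linear_boundedP.
near=> r => x; apply: le_trans (TK x) _.
by apply: ler_wpM2r => //; near: r; apply: nbhs_pinfty_ge; exact: num_real.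
Unshelve. all: by end_near. Qed.

End BoundedLinear.

Lemma le_geometric_sum (R : realType) (a z : R) (n : nat) : 0 <= a -> 0 <= z < 1 ->
  \sum_(0 <= i < n) a * z ^+ i <= a / (1 - z).
Proof.
move=> a0 /andP[z0 z1]; have [->|zn0] := eqVneq z 0.
  rewrite subr0 divr1; case: n => [|n]; first by rewrite big_geq.
  rewrite big_nat_recl// expr0 mulr1 big1 ?addr0// => i _.
  by rewrite expr0n/= mulr0.
have := @geometric_le_lim R n a z a0; rewrite lt_def zn0 z0 => /(_ isT).
by rewrite ger0_norm// z1 => /(_ isT).
Qed.

Section GeometricSeries.
Context {R : realType} {E : completeNormedModType R}.
Variables (u : nat -> E) (a z : R).
Hypotheses (z01 : 0 <= z < 1) (uz : forall n, `|u n| <= a * z ^+ n).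

Lemma is_cvg_geometric_bounded : cvgn (series u).
Proof.
apply: normed_cvg; apply: (@series_le_cvg _ _ (geometric a z)) => [n|n|n|].
- exact: normr_ge0.
- exact: le_trans (normr_ge0 _) (uz n).
- exact: uz.
- by apply: is_cvg_geometric_series; case/andP: z01 => z0 z1; rewrite ger0_norm.
Qed.

Lemma norm_lim_geometric_bounded : `|limn (series u)| <= a / (1 - z).
Proof.
have a0 : 0 <= a.
  by have := uz 0; rewrite expr0 mulr1 => /(le_trans (normr_ge0 _)).
have cu := is_cvg_geometric_bounded.
have : (fun n => `|series u n|) @ \oo --> `|limn (series u)| by exact: cvg_norm.
move/cvg_lim => <- //; apply: limr_le; first exact: is_cvg_norm.
near=> n; apply: le_trans (ler_norm_sum _ _ _) _.
by apply: le_trans (le_geometric_sum n a0 z01); apply: ler_sum => i _; exact: uz.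
Unshelve. all: by end_near. Qed.

End GeometricSeries.

(** A quadratic remainder at a single point is all that the pairing with a dual eigenvector
    provides, since nothing is known about differentiability of the eigenvector itself. *)
Lemma is_derive_quadratic (R : realType) (f : R -> R) (a d C eps : R) : 0 < eps ->
  (forall b, `|b - a| < eps -> `|f b - f a - (b - a) * d| <= C * `|b - a| ^+ 2) ->
  is_derive a (1 : R) f d.
Proof.
move=> eps0 H.
have lim : h^-1 *: (f (h *: 1 + a) - f a) @[h --> 0^'] --> d.
  apply/cvgrPdist_le => e e0; near=> h.
  have h0 : h != 0 by near: h; exact: nbhs_dnbhs_neq.
  have hn : 0 < `|h| by rewrite normr_gt0.
  have heps : `|h| < eps.
    near: h; apply: nbhs_dnbhs; apply/nbhs_ballP; exists eps => //= x.
    by rewrite /ball/= sub0r normrN.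
  have hC : `|h| * (`|C| + 1) <= e.
    rewrite -ler_pdivlMr ?ltr_wpDl//; near: h; apply: nbhs_dnbhs; apply/nbhs_ballP.
    exists (e / (`|C| + 1)) => /=; first by rewrite divr_gt0// ltr_wpDl.
    by move=> x; rewrite /ball/= sub0r normrN => /ltW.
  rewrite [h *: 1]mulr1; have := H (h + a); rewrite addrK => /(_ heps) b.
  rewrite distrC /GRing.scale/=.
  have -> : h^-1 * (f (h + a) - f a) - d = h^-1 * (f (h + a) - f a - h * d).
    by field.
  rewrite normrM normfV ler_pdivrMl//; apply: le_trans b _.
  rewrite expr2 mulrCA ler_wpM2l//; apply: le_trans hC; rewrite mulrC ler_wpM2l//.
  by rewrite (le_trans (ler_norm C))// lerDl.
apply: DeriveDef; first by apply/cvg_ex; exists d.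
exact: cvg_lim.
Unshelve. all: by end_near. Qed.

(** * Reduced resolvent and construction of the perturbed eigenvector *)

Section ReducedResolvent.
Context {R : realType} {E : completeNormedModType R} {I : finType}.
Variables (P : {linear E -> E}) (c : I -> {linear E -> R^o}) (e : I -> E).
Variables (K rho : R).
Hypotheses (PK : forall f, `|P f| <= K * `|f|).
Hypotheses (cK : forall i f, `|c i f| <= K * `|f|).
Hypotheses (Pe : forall i, P (e i) = e i) (cP : forall i f, c i (P f) = c i f).
Hypotheses (ce : forall i j, c i (e j) = (i == j)%:R).

(** The spectral projection of [P] at the eigenvalue 1; for the chain it sends [f] to the constant
    function with value the mean of [f]. *)
Definition proj (f : E) : E := \sum_i c i f *: e i.
Definition coproj (f : E) : E := f - proj f.

Lemma proj_linear : linear proj.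
Proof.
move=> a f g; rewrite /proj scaler_sumr -big_split/=; apply: eq_bigr => i _.
by rewrite linearP scalerDl scalerA.
Qed.
HB.instance Definition _ := GRing.isLinear.Build R E E _ proj proj_linear.

Lemma coproj_linear : linear coproj.
Proof. by move=> a f g; rewrite /coproj linearP opprD addrACA -scalerBr. Qed.
HB.instance Definition _ := GRing.isLinear.Build R E E _ coproj coproj_linear.

Lemma c_proj i f : c i (proj f) = c i f.
Proof.
rewrite /proj linear_sum (bigD1 i)//= linearZ/= ce eqxx big1 ?addr0.
  by rewrite [_ *: _]mulr1.
by move=> j ji; rewrite linearZ/= ce eq_sym (negbTE ji) [_ *: _]mulr0.
Qed.

Lemma c_coproj i f : c i (coproj f) = 0.
Proof. by rewrite /coproj linearB c_proj subrr. Qed.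

Lemma coproj_id f : (forall i, c i f = 0) -> coproj f = f.
Proof.
by move=> cf0; rewrite /coproj /proj big1 ?subr0// => i _; rewrite cf0 scale0r.
Qed.

Lemma P_proj f : P (proj f) = proj f.
Proof.
by rewrite /proj linear_sum; apply: eq_bigr => i _; rewrite linearZ/= Pe.
Qed.

Lemma proj_P f : proj (P f) = proj f.
Proof. by apply: eq_bigr => i _; rewrite cP. Qed.

Lemma coproj_P f : coproj (P f) = P (coproj f).
Proof. by rewrite /coproj linearB proj_P P_proj. Qed.

Lemma coproj_e i : coproj (e i) = 0.
Proof.
rewrite /coproj /proj (bigD1 i)//= ce eqxx scale1r big1 ?addr0 ?subrr// => j ji.
by rewrite ce (negbTE ji) scale0r.
Qed.

Hypotheses (rho01 : 0 <= rho < 1).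
Hypothesis erg : forall n f, `|iter n P (coproj f)| <= K * rho ^+ n * `|f|.

Definition resolvent_term (f : E) (n : nat) : E := iter n P (coproj f).
(** The reduced resolvent of [P] at 1: it vanishes on the span of the [e i] and inverts [id - P] on
    the common kernel of the [c i]. *)
Definition resolvent (f : E) : E := limn (series (resolvent_term f)).

Lemma resolvent_termE f n : `|resolvent_term f n| <= K * `|f| * rho ^+ n.
Proof. by rewrite mulrAC; exact: erg. Qed.

Lemma resolvent_cvg f : series (resolvent_term f) @ \oo --> resolvent f.
Proof. exact: (is_cvg_geometric_bounded rho01 (resolvent_termE f)). Qed.

Lemma resolvent_bounded f : `|resolvent f| <= K / (1 - rho) * `|f|.
Proof. by rewrite mulrAC; exact: (norm_lim_geometric_bounded rho01 (resolvent_termE f)). Qed.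

Lemma iter_linear (T : {linear E -> E}) n a f g :
  iter n T (a *: f + g) = a *: iter n T f + iter n T g.
Proof. by elim: n => //= n ->; rewrite linearP. Qed.

Lemma resolvent_linear : linear resolvent.
Proof.
move=> a f g; apply/cvg_lim => //=.
rewrite (_ : series _ =
  (fun n => a *: series (resolvent_term f) n + series (resolvent_term g) n)).
  by apply: cvgD; [apply: cvgZr|]; exact: resolvent_cvg.
apply/funext => n; rewrite /series/= scaler_sumr -big_split/=.
by apply: eq_bigr => i _; rewrite /resolvent_term linearP iter_linear.
Qed.
HB.instance Definition _ := GRing.isLinear.Build R E E _ resolvent resolvent_linear.

Lemma series_linear (W : normedModType R) (T : {linear E -> W}) (u : nat -> E) :
  series (T \o u) = T \o series u.
Proof. by apply/funext => n; rewrite /series/= linear_sum. Qed.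

(** Besides giving [c_resolvent], this is what later writes the second-order coefficient as a sum of
    correlations, one for each term of the Neumann series. *)
Lemma resolvent_functional (T : {linear E -> R^o}) (M : R) f :
  (forall g, `|T g| <= M * `|g|) ->
  series (fun n => T (resolvent_term f n)) @ \oo --> T (resolvent f).
Proof.
move=> TM; rewrite [series _](series_linear T).
by apply: (bounded_linear_cvg (W := R^o) TM); exact: resolvent_cvg.
Qed.

Lemma c_resolvent i f : c i (resolvent f) = 0.
Proof.
have := @resolvent_functional (c i) K f (cK i) => /(@cvg_lim _ (@norm_hausdorff _ _)) <-.
rewrite (_ : (fun n => _) = (fun=> 0)).
  by rewrite (_ : series _ = cst 0) ?lim_cst//; apply/funext => n; rewrite /series/= big1.
apply/funext => n; rewrite /resolvent_term.
by elim: n => [|n IHn] /=; [rewrite c_coproj|rewrite cP].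
Qed.

Lemma resolventE f : resolvent f - P (resolvent f) = coproj f.
Proof.
have h1 : series (resolvent_term f) @ \oo --> resolvent f by exact: resolvent_cvg.
have h2 := bounded_linear_cvg PK h1.
have h3 : (fun n => series (resolvent_term f) n - P (series (resolvent_term f) n))
    @ \oo --> resolvent f - P (resolvent f) by exact: cvgB.
apply: (cvg_unique _ h3) => //.
(* The difference telescopes; what is left over is the general term of a convergent series, hence
   tends to 0. *)
rewrite (_ : (fun n => _) = (fun n => coproj f - resolvent_term f n)).
  have t0 : resolvent_term f @ \oo --> 0.
    by apply: cvg_series_cvg_0; apply/cvg_ex; eexists; exact: h1.
  by have := cvgB (cvg_cst (coproj f)) t0; rewrite subr0; apply.
apply/funext => n; rewrite /series/= linear_sum.
elim: n => [|n IHn]; first by rewrite !big_geq// subr0 /resolvent_term/= subrr.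
rewrite !big_nat_recr//= opprD addrACA IHn addrA subrK.
by rewrite /resolvent_term/=.
Qed.

Variables (N : {linear E -> E}) (mu : I -> R) (i0 : I).
Hypotheses (K1 : 1 <= K) (NK : forall f, `|N f| <= K * `|f|).
Hypotheses (eK : forall i, `|e i| <= K).
Hypothesis cNe : forall i j, c i (N (e j)) = (i == j)%:R * mu j.
Hypothesis mu_min : forall j, j != i0 -> mu i0 < mu j.

(* With [h = e i0 + al *: f], [c i0 f = 0] and eigenvalue
   [1 - al * (mu i0 + al * nu_of f)], the equation [perturbed al h = _ *: h] reads
   [f - P f = source al f + (mu i0 + al * nu_of f) *: e i0].  Inverting [id - P]
   by [resolvent] determines [f] up to its coordinates [c j f], and these are
   fixed by the solvability conditions [c j (source al f) = 0] for [j != i0],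
   divided by [mu j - mu i0]. *)
Definition nu_of (f : E) : R := c i0 (N f).

Definition source (al : R) (f : E) : E :=
  (al * (mu i0 + al * nu_of f)) *: f - N (e i0 + al *: f).

Definition corrector_coef (al : R) (f : E) (j : I) : R :=
  (al * nu_of f * c j f - c j (N (resolvent (source al f)))) / (mu j - mu i0).

Definition corrector_map (al : R) (f : E) : E :=
  resolvent (source al f) + \sum_(j | j != i0) corrector_coef al f j *: e j.

Definition perturbed (al : R) (f : E) : E := P f - al *: N f.

Lemma c_corrector al f j : c j (corrector_map al f) =
  if j == i0 then 0 else corrector_coef al f j.
Proof.
rewrite linearD c_resolvent add0r linear_sum/=.
under eq_bigr do rewrite linearZ/= ce.
case: eqVneq => [->|ji0].
  rewrite big1// => i ii0; rewrite eq_sym (negbTE ii0); exact: mulr0.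
rewrite (bigD1 j)//= eqxx big1 ?addr0; first exact: mulr1.
by move=> i /andP[_ ij]; rewrite eq_sym (negbTE ij); exact: mulr0.
Qed.

Section FixedPoint.
Variables (al : R) (f : E).
Hypothesis ffix : f = corrector_map al f.

Lemma c_fixed : c i0 f = 0.
Proof. by rewrite ffix c_corrector eqxx. Qed.

(** The formula for [corrector_coef], multiplied by [mu i - mu i0], is exactly the vanishing of the
    coordinate [i != i0]. The coordinate at [i0] is the one that the term in [e i0] of the
    eigenvector equation cancels. *)
Lemma c_source i : c i (source al f) =
  if i == i0 then - (mu i0 + al * nu_of f) else 0.
Proof.
have cNf j : j != i0 -> c j (N f) = c j (N (resolvent (source al f))) + mu j * c j f.
  move=> ji0.
  have -> : c j f = corrector_coef al f j by rewrite {1}ffix c_corrector (negbTE ji0).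
  rewrite {1}ffix /corrector_map linearD [c j (_ + _)]linearD; congr (_ + _).
  rewrite !linear_sum/= (bigD1 j)//= !linearZ/= cNe eqxx mul1r big1.
    by rewrite addr0 mulrC.
  move=> l /andP[_ lj]; rewrite !linearZ/= cNe eq_sym (negbTE lj) mul0r.
  exact: mulr0.
rewrite /source linearB linearZ/= !linearD/= !linearZ/= cNe.
case: eqVneq => [->|ii0].
  rewrite c_fixed mul1r /nu_of /GRing.scale/=; ring.
have nz : mu i - mu i0 != 0 by rewrite subr_eq0 gt_eqF ?mu_min.
have /(congr1 ( *%R^~ (mu i - mu i0))) : c i f = corrector_coef al f i.
  by rewrite {1}ffix c_corrector (negbTE ii0).
rewrite divfK// cNf// /GRing.scale/= => h.
have -> : c i (N (resolvent (source al f))) =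
   al * nu_of f * c i f - c i f * (mu i - mu i0) by rewrite h; ring.
ring.
Qed.

Lemma fixed_eigenvector :
  perturbed al (e i0 + al *: f) =
  (1 - al * (mu i0 + al * nu_of f)) *: (e i0 + al *: f).
Proof.
set m := mu i0 + al * nu_of f.
(* The [e j] are fixed by [P], so only the resolvent contributes, with [coproj (source al f)]; by
   [c_source] the projection removed there is a multiple of [e i0] alone. *)
have fPf : f - P f = source al f + m *: e i0.
  have aux w s : f = resolvent w + s -> P s = s -> f - P f = coproj w.
    by move=> -> Ps; rewrite linearD Ps opprD addrACA subrr addr0 resolventE.
  rewrite (aux _ _ ffix).
    rewrite /coproj /proj (bigD1 i0)//= c_source eqxx big1 ?addr0.
      by rewrite scaleNr opprK.
    by move=> j ji0; rewrite c_source (negbTE ji0) scale0r.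
  by rewrite linear_sum; apply: eq_bigr => j _; rewrite linearZ/= Pe.
have Pf : P f = f - (al * m) *: f + N (e i0 + al *: f) - m *: e i0.
  rewrite -[LHS](subKr f) fPf /source -/m; rewrite !opprD !opprK !addrA.
  by [].
rewrite /perturbed linearD linearZ/= Pe Pf.
set h := e i0 + al *: f.
rewrite !scalerDr !scalerN -addrA -addrA -addrA.
rewrite [X in _ + (_ + X)]addrC subrK [in RHS]scalerBl [in RHS]scalerBl !scale1r.
rewrite !scalerA [al * (al * m)]mulrC.
by rewrite [X in _ + X = _]addrC addrA.
Qed.

End FixedPoint.

Lemma nu_of_bound f : `|nu_of f| <= K ^+ 2 * `|f|.
Proof.
rewrite (le_trans (cK _ _))// expr2 -mulrA ler_wpM2l//.
exact: le_trans ler01 K1.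
Qed.

Lemma nu_ofB f g : nu_of (f - g) = nu_of f - nu_of g.
Proof. by rewrite /nu_of !linearB. Qed.

(** In [source], every occurrence of [f] carries a factor [al]. The factor [|al|] before [|f - g|]
    will give a contraction for small [al], and the term [|al - be|] the Lipschitz dependence of the
    fixed point on the parameter. *)
Lemma source_lipschitz (r : R) : 0 <= r -> exists2 C, 0 <= C &
  forall al be f g, `|al| <= 1 -> `|be| <= 1 -> `|f| <= r -> `|g| <= r ->
  `|source al f - source be g| <= C * (`|al| * `|f - g| + `|al - be|).
Proof.
move=> r0; have K0 : 0 <= K by exact: le_trans ler01 K1.
pose m := `|mu i0| + 2 * K ^+ 2 * r.
have K20 : 0 <= K ^+ 2 by exact: exprn_ge0.
have m0 : 0 <= m by rewrite /m; nonneg.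
exists (m + r * m + r * K ^+ 2 + K + K * r).
  by nonneg.
move=> al be f g al1 be1 fr gr.
set s := al * (mu i0 + al * nu_of f); set t := be * (mu i0 + be * nu_of g).
have nug : `|nu_of g| <= K ^+ 2 * r.
  by rewrite (le_trans (nu_of_bound _))// ler_wpM2l.
have nuf : `|nu_of f| <= K ^+ 2 * r.
  by rewrite (le_trans (nu_of_bound _))// ler_wpM2l.
have sb : `|s| <= `|al| * m.
  apply: normM_le => //.
  apply: le_trans (normD_le (lexx _) (normM_le al1 nuf)) _.
  rewrite /m mul1r lerD2l -mulrA ler_peMl// ?mulr_ge0// ler1n//.
have stb : `|s - t| <= `|al - be| * m + `|al| * (K ^+ 2 * `|f - g|).
  have -> : s - t = (al - be) * (mu i0 + (al + be) * nu_of g) +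
     al * (al * nu_of (f - g)) by rewrite /s /t nu_ofB; ring.
  apply: normD_le; apply: normM_le => //.
    apply: normD_le => //; rewrite -mulrA; apply: normM_le => //.
    by apply: le_trans (normD_le al1 be1) _.
  by rewrite -[leRHS]mul1r; apply: normM_le => //; exact: nu_of_bound.
have -> : source al f - source be g = (s *: (f - g) + (s - t) *: g) -
    N (al *: (f - g) + (al - be) *: g).
  have sub4 (a b x y : E) : a - b - (x - y) = (a - x) - (b - y).
    by rewrite opprB [y - x]addrC addrACA opprB [- b + y]addrC.
  rewrite /source -/s -/t sub4 -linearB/=; congr (_ - N _).
    by rewrite scalerBr scalerBl addrA subrK.
  by rewrite opprD addrACA subrr add0r scalerBr scalerBl addrA subrK.
have D0 : 0 <= `|f - g| by [].
have A0 : 0 <= `|al| by [].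
have B0 : 0 <= `|al - be| by [].
have b1 := normD_le (normZ_le sb (lexx `|f - g|)) (normZ_le stb gr).
have b2 := normD_le (normZ_le (lexx `|al|) (lexx `|f - g|)) (normZ_le (lexx `|al - be|) gr).
have b3 := le_trans (NK _) (ler_wpM2l K0 b2).
apply: le_trans (normB_le b1 b3) _.
move: D0 A0 B0; move: `|f - g| `|al| `|al - be| => D A B D0 A0 B0.
rewrite -subr_ge0 (_ : _ - _ =
  A * D * (r * m + K * r) + B * (m + r * K ^+ 2 + K)); last by ring.
by nonneg.
Qed.

Lemma corrector_lipschitz (r : R) : 0 <= r -> exists2 C, 0 <= C &
  forall al be f g, `|al| <= 1 -> `|be| <= 1 -> `|f| <= r -> `|g| <= r ->
  `|corrector_map al f - corrector_map be g| <= C * (`|al| * `|f - g| + `|al - be|).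
Proof.
move=> r0; have K0 : 0 <= K by exact: le_trans ler01 K1.
have [C1 C10 HC1] := source_lipschitz r0.
pose S := K / (1 - rho).
have S0 : 0 <= S.
  by rewrite divr_ge0// subr_ge0; case/andP: rho01 => _ /ltW.
pose Z := 2 * K ^+ 3 * r + K ^+ 3 * r ^+ 2 + K ^+ 2 * (S * C1).
have Z0 : 0 <= Z by rewrite /Z; nonneg.
pose G := \sum_(j | j != i0) (Z / (mu j - mu i0) * K).
have G0 : 0 <= G.
  apply: sumr_ge0 => j ji0; rewrite mulr_ge0// divr_ge0// subr_ge0 ltW//.
  exact: mu_min.
exists (S * C1 + G); first by rewrite addr_ge0// mulr_ge0.
move=> al be f g al1 be1 fr gr.
set L := `|al| * `|f - g| + `|al - be|.
have L0 : 0 <= L by rewrite addr_ge0// mulr_ge0.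
have qb : `|resolvent (source al f) - resolvent (source be g)| <= S * C1 * L.
  rewrite -linearB (le_trans (resolvent_bounded _))// -/S -mulrA.
  by rewrite ler_wpM2l//; exact: HC1.
rewrite /corrector_map opprD addrACA mulrDl; apply: normD_le => //.
rewrite -sumrB /G mulr_suml; apply: le_trans (ler_norm_sum _ _ _) _.
apply: ler_sum => j ji0; have mj : 0 < mu j - mu i0 by rewrite subr_gt0 mu_min.
rewrite -scalerBl mulrAC; apply: normZ_le => //.
rewrite /corrector_coef -mulrBl [Z / _ * L]mulrAC normrM ler_pM//; last first.
  by rewrite normfV gtr0_norm.
have -> : al * nu_of f * c j f - c j (N (resolvent (source al f))) -
   (be * nu_of g * c j g - c j (N (resolvent (source be g)))) =
   (al * (nu_of (f - g) * c j f + nu_of g * c j (f - g)) +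
   (al - be) * (nu_of g * c j g)) -
   c j (N (resolvent (source al f) - resolvent (source be g))).
  rewrite nu_ofB !linearB/=; ring.
have cf : `|c j f| <= K * r by rewrite (le_trans (cK _ _))// ler_wpM2l.
have cg : `|c j g| <= K * r by rewrite (le_trans (cK _ _))// ler_wpM2l.
have nug : `|nu_of g| <= K ^+ 2 * r.
  by rewrite (le_trans (nu_of_bound _))// ler_wpM2l// exprn_ge0.
have b1 := normD_le (normM_le (nu_of_bound (f - g)) cf) (normM_le nug (cK j (f - g))).
have b2 := normD_le (normM_le (lexx `|al|) b1) (normM_le (lexx `|al - be|) (normM_le nug cg)).
have b3 := le_trans (cK j _) (ler_wpM2l K0 (le_trans (NK _) (ler_wpM2l K0 qb))).
apply: le_trans (normB_le b2 b3) _.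
have D0 : 0 <= `|f - g| by [].
have A0 : 0 <= `|al| by [].
have B0 : 0 <= `|al - be| by [].
rewrite /Z /L; move: D0 A0 B0.
move: `|f - g| `|al| `|al - be| => D A B D0 A0 B0.
rewrite -subr_ge0 (_ : _ - _ =
  A * D * (K ^+ 3 * r ^+ 2) + B * (2 * K ^+ 3 * r)); last by ring.
by nonneg.
Qed.

(** Banach's fixed point theorem on the ball of radius [r] about 0. The map at [al = 0] is constant
    on it, with value of norm [r - 1], so for small [al] the ball is mapped into itself. *)
Lemma corrector_family : exists (a0 r C : R) (g : R -> E),
  [/\ 0 < a0 <= 1, 0 <= r, 0 <= C
   & forall al, `|al| <= a0 ->
     [/\ g al = corrector_map al (g al), `|g al| <= r
      & forall be, `|be| <= a0 -> `|g al - g be| <= C * `|al - be|]].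
Proof.
pose r := `|corrector_map 0 0| + 1.
have r1 : 1 <= r by rewrite lerDr.
have r0 : 0 <= r by exact: le_trans ler01 r1.
have [C C0 HC] := corrector_lipschitz r0.
(* Chosen so that both the contraction factor [a0 * C] and the displacement [a0 * C * (r + 1)] from
   the value at parameter 0 are at most one half. *)
pose a0 := (1 + 2 * C * (r + 1))^-1.
have den0 : 0 < 1 + 2 * C * (r + 1) by rewrite ltr_pwDl//; nonneg.
have a0_gt0 : 0 < a0 by rewrite invr_gt0.
have a01 : a0 <= 1 by rewrite invf_le1// lerDl; nonneg.
have a0C : a0 * C * (r + 1) <= 2^-1.
  have : a0 * (1 + 2 * C * (r + 1)) = 1 by rewrite mulVf// gt_eqF.
  lra.
have a0C' : a0 * C <= 2^-1.
  apply: le_trans a0C; rewrite ler_peMr//; last by rewrite lerDr.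
  by rewrite mulr_ge0// ltW.
have fixed al : exists f, `|al| <= a0 -> f = corrector_map al f /\ `|f| <= r.
  have [ala|] := boolP (`|al| <= a0); last by exists 0.
  pose U := [set f : E | `|f| <= r].
  have aC : `|al| * C <= 2^-1 by apply: le_trans a0C'; rewrite ler_wpM2r.
  have homU : {homo corrector_map al : f / U f >-> U f}.
    move=> f Uf; rewrite /U/= -[corrector_map al f](subrK (corrector_map 0 0)).
    apply: le_trans (ler_normD _ _) _; rewrite addrC /r lerD2l.
    apply: le_trans (HC _ _ _ _ _ _ _ _) _ => //; rewrite ?normr0//.
      exact: le_trans ala a01.
    rewrite !subr0; have h : `|al| * `|f| + `|al| <= a0 * (r + 1).
      by rewrite mulrDr mulr1 lerD// ler_pM.
    apply: le_trans (ler_wpM2l C0 h) _; rewrite mulrA [C * a0]mulrC.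
    by apply: le_trans a0C _; lra.
  have [|||p Up pE] := @banach_fixed_point R E U (mkfun_fun homU).
  - exists (2^-1)%:nng; split => /=; first lra.
    move=> [x y] /= [Ux Uy]; apply: le_trans (HC _ _ _ _ _ _ _ _) _ => //.
    - exact: le_trans ala a01.
    - exact: le_trans ala a01.
    rewrite subrr normr0 addr0 mulrA ler_wpM2r// mulrC.
    exact: aC.
  - rewrite (_ : U = (fun x : E => `|x|) @^-1` [set y | y <= r])//.
    by apply: closed_comp => [x _|]; [exact: norm_continuous|exact: closed_le].
  - by exists 0; rewrite /U/= normr0.
  by exists p.
have [g gP] := choice fixed.
(* In the Lipschitz estimate, the contraction contributes half of [|g al - g be|]; absorbing it on
   the left doubles the constant. *)
exists a0, r, (2 * C), g; split => //; first by rewrite a0_gt0.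
  by rewrite mulr_ge0.
move=> al ala; have [gE gr] := gP _ ala; split => // be bea.
have [gE' gr'] := gP _ bea.
have := HC al be (g al) (g be) (le_trans ala a01) (le_trans bea a01) gr gr'.
rewrite -gE -gE' => h.
have : C * (`|al| * `|g al - g be|) <= 2^-1 * `|g al - g be|.
  rewrite mulrA ler_wpM2r//; apply: le_trans a0C'.
  by rewrite mulrC ler_wpM2r.
move: h; rewrite mulrDr; lra.
Qed.

(** Because of the constant [K] in [erg], one application of [P] need not contract in the given
    norm. The usual equivalent norm, a weighted sum along finitely many iterates, makes it contract
    in a single step, as is needed to perturb it. *)
Lemma adapted_norm : exists (rho1 C : R) (s : E -> R),
  [/\ 0 <= rho1 < 1, 0 <= C,
    (forall f g, s (f + g) <= s f + s g) /\ (forall a f, s (a *: f) = `|a| * s f),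
    forall f, `|f| <= s f <= C * `|f|
    & forall f, s (P (coproj f)) <= rho1 * s (coproj f)].
Proof.
have [rho_ge0 rho_lt1] := andP rho01.
have K0 : 0 <= K by exact: le_trans ler01 K1.
pose rho1 := (1 + rho) / 2.
have rho1_gt0 : 0 < rho1 by rewrite divr_gt0// ltr_pwDl.
have rho1_lt1 : rho1 < 1 by rewrite /rho1; lra.
have rr : `|rho / rho1| < 1.
  rewrite ger0_norm; last by rewrite divr_ge0// ltW.
  by rewrite ltr_pdivrMr// mul1r /rho1; lra.
(* [rho1] lies strictly between [rho] and 1, so enough iterates beat the constant [K]. *)
have [M MP] : exists M, K * (rho / rho1) ^+ M.+1 <= 1.
  have /cvgr_lt : geometric K (rho / rho1) @ \oo --> 0 by exact: cvg_geometric.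
  by move=> /(_ 1 ltr01)[M _ /(_ M.+1 (leqnSn M)) /ltW]; exists M.
have iterD n f g : iter n P (f + g) = iter n P f + iter n P g.
  by have := iter_linear P n 1 f g; rewrite !scale1r.
have iterZ n a f : iter n P (a *: f) = a *: iter n P f.
  by elim: n => //= n ->; rewrite linearZ.
have iterK n f : `|iter n P f| <= K ^+ n * `|f|.
  elim: n => [|n IHn]; first by rewrite expr0 mul1r.
  rewrite exprS -mulrA; apply: le_trans (PK _) _.
  by rewrite ler_wpM2l.
pose s (f : E) := \sum_(0 <= n < M.+1) rho1 ^- n * `|iter n P f|.
have w0 n : 0 <= rho1 ^- n by rewrite invr_ge0 exprn_ge0// ltW.
exists rho1, (\sum_(0 <= n < M.+1) rho1 ^- n * K ^+ n), s; split.
- by rewrite ltW.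
- by apply: sumr_ge0 => i _; rewrite mulr_ge0 ?exprn_ge0.
- split=> [f g|a f].
    rewrite /s -big_split/=; apply: ler_sum => n _.
    by rewrite iterD -mulrDr ler_wpM2l ?ler_normD.
  rewrite /s mulr_sumr; apply: eq_bigr => n _.
  by rewrite iterZ normrZ mulrCA.
- move=> f; apply/andP; split.
    rewrite /s big_nat_recl// expr0 invr1 mul1r lerDl; apply: sumr_ge0 => n _.
    by rewrite mulr_ge0.
  rewrite mulr_suml; apply: ler_sum => n _.
  by rewrite -mulrA ler_wpM2l.
- move=> f; set q := coproj f.
  have qE : coproj q = q by apply: coproj_id => i; rewrite c_coproj.
  (* Applying [P] shifts the sum: it gains the term [M.+1] and loses the term 0. The choice of [M]
     makes the gained term at most the lost one. *)
  have -> : s (P q) = rho1 * (s q + rho1 ^- M.+1 * `|iter M.+1 P q| - `|q|).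
    pose F n := rho1 ^- n * `|iter n P q|.
    have -> : s q + rho1 ^- M.+1 * `|iter M.+1 P q| = `|q| + \sum_(0 <= n < M.+1) F n.+1.
      rewrite /s -[LHS](big_nat_recr M.+1 0 F)// big_nat_recl//.
      by rewrite /F expr0 invr1 mul1r.
    rewrite [`|q| + _]addrC addrK /s mulr_sumr; apply: eq_bigr => n _.
    rewrite /F -iterSr mulrA; congr (_ * _).
    by rewrite exprS invfM mulVKf// gt_eqF.
  apply: ler_wpM2l; first exact: ltW.
  rewrite -addrA gerDl subr_le0.
  have := erg M.+1 q; rewrite qE => /(ler_wpM2l (w0 M.+1))/le_trans; apply.
  rewrite !mulrA ler_piMl//; move: MP; rewrite expr_div_n.
  by rewrite mulrA mulrC mulrA.
Qed.

(** The start value 1 of the minimum covers the case without other eigenvalues. The gap is cut into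
    four: [rest_contraction] spends one [d] on the coupling, and the branch itself later moves by
    less than one [d] from [mu i0]. *)
Lemma spectral_gap : exists2 d, 0 < d & forall j, j != i0 -> mu i0 + 4 * d <= mu j.
Proof.
pose d := \big[Num.min/1]_(j | j != i0) (mu j - mu i0).
have d0 : 0 < d by apply: lt_bigmin => // j ji0; rewrite subr_gt0 mu_min.
exists (d / 4) => [|j ji0]; first by rewrite divr_gt0.
have : d <= mu j - mu i0 by exact: bigmin_le_cond.
by lra.
Qed.

(** * Growth modulo the perturbed eigenvector *)

Section Remainder.
Variables (al : R) (h : E).

(* On the kernel of [c i0], this is the map induced by [perturbed al] on the
   quotient by its eigenvector [h]. *)
Definition rest_op (u : E) : E := perturbed al u + (al * c i0 (N u)) *: h.

Lemma c_rest_op (u : E) j : c j (rest_op u) =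
  c j u - al * c j (N u) + al * c i0 (N u) * c j h.
Proof. by rewrite /rest_op /perturbed linearD linearB/= !linearZ/= cP. Qed.

End Remainder.

(** As [N] compresses to a diagonal matrix, the coordinates influence one another only through
    [coproj u]. *)
Lemma cN_split (u : E) j : c j (N u) = mu j * c j u + c j (N (coproj u)).
Proof.
rewrite /coproj linearB linearB/= addrC -[LHS]addr0 -[X in _ = X]addrA; congr (_ + _).
rewrite /proj !linear_sum/= (bigD1 j)//= !linearZ/= cNe eqxx mul1r big1.
  by rewrite addr0 /GRing.scale/=; ring.
by move=> i ij; rewrite !linearZ/= cNe eq_sym (negbTE ij) /GRing.scale/=; ring.
Qed.

(** The norm is [A + th * B], with [A] the coordinates other than [i0] and [B] the adapted norm of
    the complement. [A] contracts at the rate [1 - al * (mu i0 + 4 * d)] and [B] at the fixed rate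
    [rho1]; each feeds into the other with a coefficient of order [al]. *)
Lemma rest_contraction (r : R) : 0 <= r ->
  exists (d C a1 : R) (n : E -> R),
  [/\ 0 < d, 0 <= C, 0 < a1,
    (forall f, 0 <= n f <= C * `|f|) /\
    (forall f, c i0 f = 0 -> `|f| <= C * n f)
    & forall al f, 0 < al <= a1 -> c i0 f = 0 -> `|f| <= r ->
      forall u, c i0 u = 0 ->
      n (rest_op al (e i0 + al *: f) u) <= (1 - al * (mu i0 + 3 * d)) * n u].
Proof.
move=> r0; have K0 : 0 <= K by exact: le_trans ler01 K1.
have [d d0 dmu] := spectral_gap.
have [rho1 [Cs [s [/andP[rho10 rho11] Cs0 [sD sZ] sf sP]]]] := adapted_norm.
pose J : R := #|I|%:R.
have J0 : 0 <= J by [].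
pose A (u : E) := \sum_(j | j != i0) `|c j u|.
pose B u := s (coproj u).
have A0 u : 0 <= A u by exact: sumr_ge0.
have B0 u : 0 <= B u.
  by have /andP[+ _] := sf (coproj u); apply: le_trans.
have coK u : `|coproj u| <= (1 + J * K ^+ 2) * `|u|.
  rewrite mulrDl mul1r; apply: normB_le => //.
  rewrite /proj; apply: le_trans (ler_norm_sum _ _ _) _.
  apply: (@le_trans _ _ (\sum_(i : I) K ^+ 2 * `|u|)).
    apply: ler_sum => i _; rewrite expr2 mulrAC; apply: normZ_le => //.
  by rewrite sumr_const -mulr_natl -/J mulrA.
pose G := (1 + J * K ^+ 2).
have G1 : 1 <= G by rewrite lerDl; nonneg.
have G0 : 0 <= G by exact: le_trans ler01 G1.
have uAB u : c i0 u = 0 -> `|u| <= K * (A u + B u).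
  move=> cu0; rewrite -[u in `|u|](subrK (proj u)) addrC mulrDr; apply: normD_le.
    rewrite /proj (bigD1 i0)//= cu0 scale0r add0r mulr_sumr.
    apply: le_trans (ler_norm_sum _ _ _) _; apply: ler_sum => j _.
    by rewrite mulrC; apply: normZ_le.
  have /andP[+ _] := sf (coproj u) => /le_trans; apply.
  by rewrite -/(B u) ler_peMl.
have cNq j u : `|c j (N (coproj u))| <= K ^+ 2 * B u.
  rewrite (le_trans (cK _ _))// expr2 -mulrA ler_wpM2l//.
  rewrite (le_trans (NK _))// ler_wpM2l//.
  by have /andP[] := sf (coproj u).
have BC v : B v <= Cs * G * `|v|.
  have /andP[_ +] := sf (coproj v) => /le_trans; apply.
  by rewrite -mulrA ler_wpM2l.
pose H := J * K ^+ 2 * (1 + K * r) + 1.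
pose L := Cs * G * (K ^+ 2 + K ^+ 2 * r) + 1.
have H1 : 0 < H by rewrite ltr_wpDl//; nonneg.
have L1 : 0 < L by rewrite ltr_wpDl//; nonneg.
(* The complement receives [al * L * A] from the coordinates. Weighted by [th] this is [al * d * A],
   so that it costs exactly one of the four [d]. *)
pose th := d / L.
have th0 : 0 < th by rewrite divr_gt0.
have sN x : s (- x) = s x by rewrite -scaleN1r sZ normrN1 mul1r.
have key al f u : 0 < al <= 1 -> (forall j, al * mu j <= 1) ->
   c i0 f = 0 -> `|f| <= r -> c i0 u = 0 ->
   A (rest_op al (e i0 + al *: f) u) <=
     (1 - al * (mu i0 + 4 * d)) * A u + al * H * B u /\
   B (rest_op al (e i0 + al *: f) u) <= rho1 * B u + al * L * (A u + B u).
  move=> /andP[al0 al1] almu cf0 fr cu0; split.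
    rewrite mulr_sumr.
    have -> : al * H * B u = al * B u + \sum_(j : I) al * (K ^+ 2 * (1 + K * r) * B u).
      by rewrite sumr_const -mulr_natl -/J /H; ring.
    apply: (@le_trans _ _ (\sum_(j | j != i0) ((1 - al * (mu i0 + 4 * d)) * `|c j u| +
        al * (K ^+ 2 * (1 + K * r) * B u)))).
      apply: ler_sum => j ji0; rewrite c_rest_op.
      rewrite linearD linearZ/= ce (negbTE ji0) add0r cN_split [c i0 (N u)]cN_split cu0.
      rewrite mulr0 add0r.
      set lhs := (X in `|X| <= _).
      have -> : lhs = (1 - al * mu j) * c j u + (- al * (c j (N (coproj u)) -
         (al * c i0 (N (coproj u))) * c j f)) by rewrite /lhs linearZ/= /GRing.scale/=; ring.
      apply: normD_le.
        rewrite normrM ler_wpM2r// ger0_norm ?subr_ge0// lerD2l lerN2 ler_wpM2l//.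
          exact: ltW.
        exact: dmu.
      apply: normM_le; first by rewrite normrN gtr0_norm.
      rewrite [K ^+ 2 * (1 + _)]mulrDr mulr1 mulrDl; apply: normB_le => //.
      rewrite [leRHS]mulrAC; apply: normM_le.
        by rewrite -[leRHS]mul1r; apply: normM_le => //; rewrite gtr0_norm.
      by rewrite (le_trans (cK _ _))// ler_wpM2l.
    rewrite big_split/= lerD2l; apply: (@le_trans _ _
       (\sum_(j : I) al * (K ^+ 2 * (1 + K * r) * B u))).
      rewrite [leRHS](bigID (fun j => j != i0))/= lerDl sumr_ge0// => i _.
      have al0' := ltW al0; have := B0 u => Bu; nonneg.
    by rewrite lerDr mulr_ge0// ltW.
  have coD f1 f2 : coproj (f1 + f2) = coproj f1 + coproj f2 by exact: linearD.
  have coN f1 : coproj (- f1) = - coproj f1 by exact: linearN.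
  have coZ a f1 : coproj (a *: f1) = a *: coproj f1 by exact: linearZ.
  rewrite /B /rest_op /perturbed !coD coN !coZ coD coZ coproj_e add0r.
  rewrite coproj_P -addrA; apply: le_trans (sD _ _) _; apply: lerD; first exact: sP.
  apply: le_trans (sD _ _) _.
  rewrite sN !sZ (gtr0_norm al0) normrM (gtr0_norm al0).
  have Nu : s (coproj (N u)) <= Cs * G * K ^+ 2 * (A u + B u).
    apply: le_trans (BC _) _; rewrite -[leRHS]mulrA; apply: ler_wpM2l; first by nonneg.
    by rewrite (le_trans (NK _))// expr2 -mulrA ler_wpM2l// uAB.
  have sfr : s (coproj f) <= Cs * G * r.
    by apply: le_trans (BC _) _; apply: ler_wpM2l => //; nonneg.
  have c0Nu : `|c i0 (N u)| <= K ^+ 2 * (A u + B u).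
    rewrite cN_split cu0 mulr0 add0r (le_trans (cNq _ _))// ler_wpM2l ?lerDr//.
    nonneg.
  have s0 x : 0 <= s x by have /andP[+ _] := sf x; apply: le_trans.
  have : `|c i0 (N u)| * (al * s (coproj f)) <= (K ^+ 2 * (A u + B u)) * (1 * (Cs * G * r)).
    apply: ler_pM => //; first by rewrite mulr_ge0// ltW.
    by apply: ler_pM => //; rewrite ltW.
  move=> h; rewrite -/(B u) -[al * `|_| * _]mulrA -mulrDr -[al * L * _]mulrA.
  apply: ler_wpM2l; first exact: ltW.
  rewrite /L; have := addr_ge0 (A0 u) (B0 u); move: h Nu.
  by lra.
pose Sm := \sum_j `|mu j|.
have Sm0 : 0 <= Sm by exact: sumr_ge0.
pose D := H / th + L + `|mu i0| + 3 * d.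
have Hth0 : 0 < H / th by exact: divr_gt0.
have D0 : 0 < D by rewrite /D; have := normr_ge0 (mu i0); clearbody H L; lra.
(* The first bound keeps every [1 - al * mu j] nonnegative, so that no absolute value spoils the
   rate. The second lets the margin [1 - rho1] absorb all couplings of order [al] into the
   complement. *)
pose a1 := Num.min (1 + Sm)^-1 ((1 - rho1) / D).
have a1_gt0 : 0 < a1.
  by rewrite lt_min invr_gt0 ltr_pwDl// divr_gt0// subr_gt0.
pose n u := A u + th * B u.
exists d, (J * K + th * (Cs * G) + K * (1 + th^-1)), a1, n; split => //.
- by have th0' := ltW th0; nonneg.
- have th0' := ltW th0; split=> [f|f cf0].
    apply/andP; split; first by rewrite /n; have Af := A0 f; have Bf := B0 f; nonneg.
    rewrite mulrDl ler_wpDr//; first by nonneg.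
    rewrite /n mulrDl; apply: lerD; last first.
      by rewrite -[leRHS]mulrA; apply: ler_wpM2l => //; exact: BC.
    apply: (@le_trans _ _ (\sum_(j : I) K * `|f|)).
      rewrite [leRHS](bigID (fun j => j != i0))/=; rewrite ler_wpDr//.
        by apply: sumr_ge0 => i _; nonneg.
      by apply: ler_sum.
    by rewrite sumr_const -mulr_natl mulrA.
  apply: le_trans (uAB _ cf0) _; rewrite mulrDl ler_wpDl//.
    by rewrite /n; have Af := A0 f; have Bf := B0 f; nonneg.
  rewrite -mulrA ler_wpM2l// mulrDl mul1r /n mulrDr mulKf ?gt_eqF//.
  have : 0 <= th * B f by have Bf := B0 f; nonneg.
  have : 0 <= th^-1 * A f by have Af := A0 f; nonneg.
  by lra.
move=> al f /andP[al0]; rewrite le_min => /andP[al1 al2] cf0 fr u cu0.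
have alSm : al * (1 + Sm) <= 1 by rewrite -ler_pdivlMr ?div1r// ltr_pwDl.
have al_le1 : al <= 1.
  by apply: le_trans alSm; rewrite ler_peMr ?(ltW al0)// lerDl.
have almu j : al * mu j <= 1.
  apply: le_trans alSm; rewrite ler_wpM2l ?(ltW al0)//.
  apply: le_trans (ler_norm _) _; rewrite /Sm (bigD1 j)//= addrCA lerDl.
  by rewrite addr_ge0// sumr_ge0.
have [|kA kB] := key al f u _ almu cf0 fr cu0; first by rewrite al0.
have thB := ler_wpM2l (ltW th0) kB.
apply: le_trans (lerD kA thB) _.
have thL : th * L = d by rewrite /th divfK// gt_eqF.
have Hth : H = th * (H / th) by rewrite mulrC divfK// gt_eqF.
rewrite /n; move: al2; rewrite ler_pdivlMr// /D => al2.
have m1 := ler_norm (mu i0).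
have mB : al * mu i0 <= al * `|mu i0| by rewrite ler_wpM2l// ltW.
have coef : al * (H / th) + al * L + rho1 <= 1 - al * (mu i0 + 3 * d) by lra.
have := ler_wpM2r (B0 u) coef => /(ler_wpM2l (ltW th0)).
have -> : al * H * B u = th * (al * (H / th) * B u) by rewrite {1}Hth; ring.
have -> : th * (rho1 * B u + al * L * (A u + B u)) =
  th * (rho1 * B u) + al * d * A u + th * (al * L * B u) by rewrite -thL; ring.
by move=> h; rewrite -subr_ge0 in h *; lra.
Qed.
Lemma perturbed_linear al : linear (perturbed al).
Proof.
move=> a f g; rewrite /perturbed [P _]linearP [N _]linearP.
by rewrite [al *: (_ + _)]scalerDr opprD addrACA scalerBr !scalerA mulrC.
Qed.
HB.instance Definition _ al :=
  GRing.isLinear.Build R E E _ (perturbed al) (perturbed_linear al).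

Lemma c_perturbed al i f : c i (perturbed al f) = c i f - al * c i (N f).
Proof. by rewrite /perturbed linearB/= linearZ/= cP. Qed.

(* [eta], the left eigenvector, is the limit of [lam ^- m * c i0 (L^m f)]. *)
Lemma dominated_growth (al lam tau C : R) (h : E) (n : E -> R) :
  0 <= C -> 0 <= tau < lam -> perturbed al h = lam *: h -> c i0 h = 1 ->
  (forall f, 0 <= n f <= C * `|f|) -> (forall f, c i0 f = 0 -> `|f| <= C * n f) ->
  (forall u, c i0 u = 0 -> n (rest_op al h u) <= tau * n u) ->
  exists (D : R) (eta : {linear E -> R^o}),
  [/\ 0 <= D, forall m f, `|iter m (perturbed al) f| <= D * lam ^+ m * `|f|,
    forall f, `|eta f| <= D * `|f|,
    forall f, eta (perturbed al f) = lam * eta f & eta h = 1].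
Proof.
move=> C0 /andP[tau0 taul] Lh ch nC nC' nT.
have K0 : 0 <= K by exact: le_trans ler01 K1.
have lam0 : 0 < lam by exact: le_lt_trans tau0 taul.
(* [rest f] represents the class of [f] modulo [h] in the kernel of [c i0], where [perturbed al]
   becomes [rest_op al h]. *)
pose rest f := f - c i0 f *: h.
have c_rest f : c i0 (rest f) = 0.
  by rewrite /rest linearB/= linearZ/= ch [_ *: _]mulr1 subrr.
have LD f a : perturbed al (f + a *: h) = perturbed al f + (a * lam) *: h.
  by rewrite addrC perturbed_linear Lh scalerA addrC.
have c_step f : c i0 (perturbed al f) = lam * c i0 f - al * c i0 (N (rest f)).
  rewrite -{1}(subrK (c i0 f *: h) f) -/(rest f) LD.
  rewrite linearD linearZ/= ch c_perturbed c_rest /GRing.scale/=; ring.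
have rest_step f : rest (perturbed al f) = rest_op al h (rest f).
  rewrite {1}/rest c_step -{1}(subrK (c i0 f *: h) f) -/(rest f) LD.
  rewrite /rest_op -addrA; congr (_ + _).
  by rewrite -scalerBl; congr (_ *: _); ring.
have n_iter m f : n (rest (iter m (perturbed al) f)) <= tau ^+ m * n (rest f).
  elim: m => [|m IHm]; first by rewrite expr0 mul1r.
  rewrite iterS rest_step (le_trans (nT _ (c_rest _)))// exprS -mulrA.
  by rewrite ler_wpM2l.
have cN_rest f : `|al * c i0 (N (rest f))| <= `|al| * (K ^+ 2 * C) * n (rest f).
  rewrite normrM -mulrA ler_wpM2l// (le_trans (cK _ _))// expr2 -!mulrA ler_wpM2l//.
  by rewrite (le_trans (NK _))// ler_wpM2l// nC'.
have n0 f : 0 <= n f by have /andP[] := nC f.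
(* Chosen so that [|c i0 f| + M * n (rest f)] grows by at most [lam] per step: the slack
   [M * (lam - tau)] pays for what the rest feeds into the coordinate at [i0]. *)
pose M := `|al| * (K ^+ 2 * C) / (lam - tau) + 1.
have M1 : 1 <= M.
  by rewrite lerDr divr_ge0// ?subr_ge0 ?(ltW taul)//; nonneg.
have M0 : 0 <= M by exact: le_trans ler01 M1.
pose F f := `|c i0 f| + M * n (rest f).
have F_step f : F (perturbed al f) <= lam * F f.
  rewrite /F c_step rest_step mulrDr.
  apply: le_trans (lerD (ler_normB _ _) (ler_wpM2l M0 (nT _ (c_rest f)))) _.
  rewrite normrM (gtr0_norm lam0) -addrA lerD2l.
  apply: le_trans (lerD (cN_rest f) (lexx _)) _.
  have -> : `|al| * (K ^+ 2 * C) = (M - 1) * (lam - tau).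
    by rewrite /M addrK divfK// subr_eq0 gt_eqF.
  have : 0 <= (lam - tau) * n (rest f) by rewrite mulr_ge0// subr_ge0 ltW.
  by lra.
have F_iter m f : F (iter m (perturbed al) f) <= lam ^+ m * F f.
  elim: m => [|m IHm]; first by rewrite expr0 mul1r.
  by rewrite iterS (le_trans (F_step _))// exprS -mulrA ler_wpM2l// ltW.
pose D1 := K + M * (C * (1 + K * `|h|)).
have D10 : 0 <= D1 by rewrite /D1; nonneg.
have F_le f : F f <= D1 * `|f|.
  rewrite /F /D1 [leRHS]mulrDl; apply: lerD => //; rewrite -[leRHS]mulrA ler_wpM2l//.
  have /andP[_ +] := nC (rest f) => /le_trans; apply.
  rewrite -mulrA ler_wpM2l// mulrDl mul1r; apply: normB_le => //.
  by rewrite mulrAC; apply: normZ_le.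
have le_F f : `|f| <= (C + `|h|) * F f.
  rewrite -[f in `|f|](subrK (c i0 f *: h)) -/(rest f) mulrDl; apply: normD_le.
    rewrite (le_trans (nC' _ (c_rest f)))// ler_wpM2l// /F ler_wpDl//.
    by rewrite ler_peMl.
  rewrite mulrC; apply: normZ_le => //; rewrite /F lerDl.
  exact: mulr_ge0.
have growth m f : `|iter m (perturbed al) f| <= (C + `|h|) * D1 * lam ^+ m * `|f|.
  apply: le_trans (le_F _) _; rewrite -!mulrA; apply: ler_wpM2l; first by nonneg.
  apply: le_trans (F_iter m f) _; rewrite mulrCA; apply: ler_wpM2l => //.
  by rewrite exprn_ge0// ltW.
pose x f m : R := lam ^- m * c i0 (iter m (perturbed al) f).
have lamN0 : lam != 0 by rewrite gt_eqF.
(* The normalized coordinate changes only through the rest, which decays relative to [lam ^+ m];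
   hence the sequence is summably Cauchy. *)
have dx f m : `|x f m.+1 - x f m| <= `|al| * (K ^+ 2 * C) / lam * n (rest f) * (tau / lam) ^+ m.
  rewrite /x iterS c_step.
  have -> : lam ^- m.+1 * (lam * c i0 (iter m (perturbed al) f) -
      al * c i0 (N (rest (iter m (perturbed al) f)))) -
      lam ^- m * c i0 (iter m (perturbed al) f) =
      - (lam ^- m.+1 * (al * c i0 (N (rest (iter m (perturbed al) f))))).
    rewrite exprS; field.
    by rewrite expf_neq0.
  rewrite normrN normrM ger0_norm ?invr_ge0 ?exprn_ge0 ?(ltW lam0)//.
  have lm0 : 0 <= lam ^- m.+1 by rewrite invr_ge0 exprn_ge0// ltW.
  apply: le_trans (ler_wpM2l lm0 (cN_rest _)) _.
  have aK0 : 0 <= `|al| * (K ^+ 2 * C) by nonneg.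
  apply: le_trans (ler_wpM2l lm0 (ler_wpM2l aK0 (n_iter m f))) _.
  rewrite le_eqVlt; apply/orP; left; apply/eqP; rewrite expr_div_n exprS; field.
  by rewrite expf_neq0// lamN0.
have tl01 : 0 <= tau / lam < 1.
  by rewrite divr_ge0// ?(ltW lam0)// ltr_pdivrMr// mul1r.
have cx f : cvgn (x f : nat -> R^o).
  have h1 := @is_cvg_geometric_bounded R R^o _ _ _ tl01 (dx f).
  rewrite (_ : x f = (fun m => x f 0 + series (fun m => x f m.+1 - x f m) m)).
    by apply: is_cvgD => //; exact: is_cvg_cst.
  by apply/funext => m; rewrite /series/= telescope_sumr// addrC subrK.
pose eta f : R^o := limn (x f : nat -> R^o).
have eta_lin : linear eta.
  move=> a f g; apply: (@cvg_lim R^o) => //.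
  rewrite (_ : x _ = (fun m => a *: (x f m : R^o) + x g m)).
    by apply: cvgD; [apply: cvgZr|]; exact: cx.
  apply/funext => m; rewrite /x (iter_linear (perturbed al)) linearP/=.
  by rewrite /GRing.scale/=; ring.
have [etaL etaE] : exists etaL : {linear E -> R^o}, etaL =1 eta.
  pose etaM := GRing.isLinear.Build R E R^o _ eta eta_lin.
  pose etaL : {linear E -> R^o} := HB.pack eta etaM.
  by exists etaL.
exists ((C + `|h|) * D1 + K * ((C + `|h|) * D1)), etaL; split => //.
- by nonneg.
- move=> m f; apply: le_trans (growth m f) _.
  rewrite -subr_ge0 (_ : _ - _ = K * ((C + `|h|) * D1) * lam ^+ m * `|f|); last by ring.
  by have lam0' := ltW lam0; nonneg.
- move=> f; rewrite etaE /eta.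
  have : (fun m => `|x f m|) @ \oo --> `|limn (x f : nat -> R^o)|.
    by apply: (@cvg_norm _ R^o); exact: cx.
  move/cvg_lim => <- //; apply: limr_le.
    by apply: (@is_cvg_norm _ R^o); exact: cx.
  near=> m; rewrite /x normrM ger0_norm ?invr_ge0 ?exprn_ge0 ?(ltW lam0)//.
  rewrite ler_pdivrMl ?exprn_gt0//; apply: le_trans (cK _ _) _.
  apply: le_trans (ler_wpM2l K0 (growth m f)) _.
  rewrite -subr_ge0 (_ : _ - _ = (C + `|h|) * D1 * lam ^+ m * `|f|); last by ring.
  by have lam0' := ltW lam0; nonneg.
- move=> f; rewrite !etaE /eta; apply: (@cvg_lim R^o) => //.
  have xS : x (perturbed al f) = (fun m => lam * x f m.+1).
    apply/funext => m; rewrite /x -iterSr exprS; field.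
    by rewrite expf_neq0// lamN0.
  rewrite xS; apply: (@cvgZr _ R^o); rewrite cvg_shiftS; exact: cx.
- rewrite etaE /eta; apply: (@cvg_lim R^o) => //.
  rewrite (_ : x h = cst 1); first exact: cvg_cst.
  apply/funext => m; rewrite /x.
  have -> : iter m (perturbed al) h = lam ^+ m *: h.
    elim: m => [|m IHm]; first by rewrite expr0 scale1r.
    by rewrite iterS IHm linearZ/= Lh scalerA exprSr.
  by rewrite linearZ/= ch [_ *: _]mulr1 mulVf// expf_neq0.
Unshelve. all: by end_near. Qed.

Definition second_coef : R := - c i0 (N (resolvent (N (e i0)))).

(** At parameter 0 the source is [- N (e i0)] whatever [f] is, and the added multiples of [e j] are
    invisible to [nu_of], since [c i0 (N (e j)) = 0] for [j != i0]. *)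
Lemma nu_of_corrector0 (f : E) : nu_of (corrector_map 0 f) = second_coef.
Proof.
rewrite /nu_of /corrector_map /source mul0r !scale0r addr0 sub0r !linearD/=.
rewrite !linear_sum/= big1 ?addr0; last first.
  by move=> j ji0; rewrite !linearZ/= cNe eq_sym (negbTE ji0) mul0r; exact: mulr0.
by rewrite /second_coef !linearN.
Qed.

(** The growth constant [D] may depend on [al], since only the rate [lam al] affects the spectral
    radius. The constants of the two expansions are uniform in [al]. *)
Theorem spectral_perturbation : exists (a0 C : R) (h : R -> E) (lam dlam : R -> R),
  [/\ 0 < a0, 0 <= C & forall al, 0 < al < a0 ->
    [/\ 0 < lam al /\ perturbed al (h al) = lam al *: h al, c i0 (h al) = 1,
      exists D, forall n f, `|iter n (perturbed al) f| <= D * lam al ^+ n * `|f|,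
      is_derive al (1 : R) lam (dlam al)
    & `|lam al - (1 - al * mu i0 - al ^+ 2 * second_coef)| <= C * al ^+ 3 /\
      `|dlam al + mu i0 + 2 * al * second_coef| <= C * al ^+ 2]].
Proof.
have K0 : 0 <= K by exact: le_trans ler01 K1.
have K20 : 0 <= K ^+ 2 by exact: exprn_ge0.
have [a0 [r [C [g [/andP[a00 a01] r0 C0 gP]]]]] := corrector_family.
have [d [Cn [a1 [n [d0 Cn0 a10 [nC nC'] nT]]]]] := rest_contraction r0.
pose nu al := nu_of (g al).
have a0n : `|0 : R| <= a0 by rewrite normr0 ltW.
have nu0 : nu 0 = second_coef.
  by have [gE _ _] := gP 0 a0n; rewrite /nu gE nu_of_corrector0.
pose Cv := K ^+ 2 * C.
have Cv0 : 0 <= Cv by rewrite /Cv; nonneg.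
have nuL al be : `|al| <= a0 -> `|be| <= a0 -> `|nu al - nu be| <= Cv * `|al - be|.
  move=> ala bea; rewrite /nu -nu_ofB (le_trans (nu_of_bound _))// /Cv -mulrA ler_wpM2l//.
  by have [_ _] := gP _ ala; apply.
pose Nb := K ^+ 2 * r.
have Nb0 : 0 <= Nb by rewrite /Nb; nonneg.
have nub al : `|al| <= a0 -> `|nu al| <= Nb.
  move=> ala; rewrite (le_trans (nu_of_bound _))// ler_wpM2l//.
  by have [] := gP _ ala.
pose lam al := 1 - al * (mu i0 + al * nu al).
pose h al := e i0 + al *: g al.
have m3 : 0 < `|mu i0| + 3 * d + 1 by have := normr_ge0 (mu i0); lra.
(* The first bound gives [al * nu al < d], which puts [lam al] strictly above the rate of the rest;
   the second keeps that rate nonnegative. *)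
pose a2 := Num.min (d / (Nb + 1)) (`|mu i0| + 3 * d + 1)^-1.
pose b0 := Num.min a0 (Num.min a1 a2).
have b00 : 0 < b0 by rewrite !lt_min a00 a10 invr_gt0 m3 divr_gt0// ltr_wpDl.
have bP al : 0 < al < b0 -> [/\ 0 < al, `|al| <= a0, al <= 1, 0 < al <= a1 &
    0 <= 1 - al * (mu i0 + 3 * d) < lam al].
  move=> /andP[al0]; rewrite !lt_min => /and4P[ala ala1 ald alm].
  have al1 : al <= 1 by exact: le_trans (ltW ala) a01.
  have ala' : `|al| <= a0 by rewrite gtr0_norm// ltW.
  split => //; first by rewrite al0 ltW.
  have Nb1 : 0 < Nb + 1 by rewrite ltr_wpDl.
  rewrite ltr_pdivlMr// in ald; rewrite -[_^-1]mul1r ltr_pdivlMr// in alm.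
  have mB : al * mu i0 <= al * `|mu i0| by rewrite ler_wpM2l ?ler_norm// ltW.
  apply/andP; split; first by move: alm mB; lra.
  rewrite /lam; have := nub _ ala'; rewrite ler_norml => /andP[_ nuN].
  have : al * (al * nu al) <= al * (al * Nb) by rewrite !ler_wpM2l// ltW.
  have : al * (al * (Nb + 1)) < al * d by rewrite ltr_pM2l.
  have : 0 < al * al by rewrite mulr_gt0.
  have : 0 < al * d by rewrite mulr_gt0.
  by lra.
have fixedP al : `|al| <= a0 -> perturbed al (h al) = lam al *: h al /\ c i0 (g al) = 0.
  move=> ala; have [gE _ _] := gP _ ala; split; last by rewrite (c_fixed gE).
  exact: fixed_eigenvector gE.
have hc al : `|al| <= a0 -> c i0 (h al) = 1.
  move=> /fixedP[_ cg]; rewrite /h linearD linearZ/= cg ce eqxx [_ *: _]mulr0 addr0//.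
have growP al : 0 < al < b0 -> exists (D : R) (eta : {linear E -> R^o}),
  [/\ 0 <= D, forall m f, `|iter m (perturbed al) f| <= D * lam al ^+ m * `|f|,
    forall f, `|eta f| <= D * `|f|,
    forall f, eta (perturbed al f) = lam al * eta f & eta (h al) = 1].
  move=> alb; have [al0 ala al1 ala1 tl] := bP _ alb.
  have [Lh cg] := fixedP _ ala; have [_ gr _] := gP _ ala.
  apply: (dominated_growth Cn0 tl Lh (hc _ ala) nC nC') => u cu.
  exact: nT.
pose C1 := `|mu i0| + 2 * Nb + Cv.
have C10 : 0 <= C1 by rewrite /C1; nonneg.
have lamL al be : 0 < al < b0 -> 0 < be < b0 -> `|lam be - lam al| <= C1 * `|be - al|.
  move=> /bP[al0 ala al1 _ _] /bP[be0 bea be1 _ _].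
  have -> : lam be - lam al = (be - al) * - (mu i0 + (be + al) * nu be) +
     (- (al * al)) * (nu be - nu al) by rewrite /lam; ring.
  rewrite /C1 [leRHS]mulrDl; apply: normD_le; last first.
    rewrite -[leRHS]mul1r; apply: normM_le; last exact: nuL.
    rewrite normrN gtr0_norm ?mulr_gt0//.
    by rewrite -[leRHS]mulr1 ler_pM// ltW.
  rewrite mulrC; apply: normM_le => //; rewrite normrN; apply: normD_le => //.
  apply: normM_le; last exact: nub.
  by apply: le_trans (ler_normD _ _) _; rewrite !gtr0_norm//; lra.
have derP al : 0 < al < b0 -> exists2 dl, is_derive al (1 : R) lam dl &
    `|dl + mu i0 + 2 * al * nu al| <= Cv * al ^+ 2.
  move=> alb; have [al0 ala al1 ala1 tl] := bP _ alb.
  have [D [eta [D0 _ etaD etaL etah]]] := growP _ alb.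
  have [Lh _] := fixedP _ ala; have [gE gr gL] := gP _ ala.
  pose eps := Num.min al (b0 - al).
  have eps0 : 0 < eps by rewrite lt_min al0 subr_gt0; case/andP: alb.
  have near_al be : `|be - al| < eps -> 0 < be < b0.
    rewrite lt_min => /andP[]; rewrite !ltr_norml => /andP[h1 _] /andP[_ h2].
    by apply/andP; split; lra.
  pose Hc := r + C.
  have Hc0 : 0 <= Hc by rewrite /Hc; nonneg.
  have hL be : `|be - al| < eps -> `|h be - h al| <= Hc * `|be - al|.
    move=> /near_al/bP[be0 bea be1 _ _].
    have -> : h be - h al = (be - al) *: g be + al *: (g be - g al).
      rewrite /h opprD addrACA subrr add0r scalerBl scalerBr addrA subrK//.
    have [_ grb gLb] := gP _ bea.
    rewrite /Hc [leRHS]mulrDl; apply: normD_le; first by rewrite mulrC; apply: normZ_le.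
    rewrite -[leRHS]mul1r; apply: normZ_le; first by rewrite gtr0_norm.
    exact: gLb.
  pose Q := D * Hc * C1 + D * (K * Hc).
  have Q0 : 0 <= Q by rewrite /Q; nonneg.
  (* The first-order perturbation formula: the derivative of the operator is [- N], evaluated
     between the left and right eigenvectors. *)
  pose dl : R := - eta (N (h al)).
  have quad be : `|be - al| < eps ->
      `|lam be - lam al - (be - al) * dl| <= Q * `|be - al| ^+ 2.
    move=> bal; have beb := near_al _ bal; have [be0 bea be1 _ _] := bP _ beb.
    have [Lhb _] := fixedP _ bea.
    (* The eigenvector at [be] paired with the left eigenvector at [al] gives the
       difference quotient of [lam] exactly. *)
    have key : (lam be - lam al) * eta (h be) = - (be - al) * eta (N (h be)).
      have e1 : lam be * eta (h be) = eta (perturbed be (h be)) by rewrite Lhb linearZ.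
      have e2 f : perturbed be f - perturbed al f = (- (be - al)) *: N f.
        rewrite /perturbed opprB addrC addrA subrK -scalerBl; congr (_ *: _); ring.
      by rewrite mulrBl e1 -etaL -linearB e2 linearZ.
    have -> : lam be - lam al - (be - al) * dl =
       (lam be - lam al) * - eta (h be - h al) + (be - al) * - eta (N (h be - h al)).
      have -> : eta (h be - h al) = eta (h be) - 1 by rewrite linearB etah.
      have -> : eta (N (h be - h al)) = eta (N (h be)) + dl by rewrite !linearB.
      apply/eqP; rewrite -subr_eq0; apply/eqP.
      transitivity ((lam be - lam al) * eta (h be) + (be - al) * eta (N (h be))).
        by ring.
      by rewrite key; ring.
    rewrite /Q [leRHS]mulrDl; apply: normD_le.
      rewrite (_ : _ * _ ^+ 2 = (C1 * `|be - al|) * (D * (Hc * `|be - al|))); last by ring.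
      apply: normM_le; first exact: lamL.
      by rewrite normrN (le_trans (etaD _))// ler_wpM2l// hL.
    rewrite (_ : _ * _ ^+ 2 = `|be - al| * (D * (K * (Hc * `|be - al|)))); last by ring.
    apply: normM_le => //; rewrite normrN (le_trans (etaD _))// ler_wpM2l//.
    by rewrite (le_trans (NK _))// ler_wpM2l// hL.
  exists dl; first exact: is_derive_quadratic eps0 quad.
  pose Q2 := Q + (2 * Cv + Nb).
  have Q20 : 0 <= Q2 by rewrite /Q2; nonneg.
  (* As [nu] is only Lipschitz, [lam] cannot be differentiated through its formula. Instead [dl] is
     compared with the explicit difference quotient of [lam] between [al] and [al + t]; dividing by
     [t] leaves an error [Q2 * t], and [t] is taken so small that this is at most [z]. *)
  apply/ler_addgt0Pr => z z0.
  pose t := Num.min (eps / 2) (z / (Q2 + 1)).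
  have t0 : 0 < t by rewrite lt_min !divr_gt0// ltr_wpDl.
  have teps : t < eps by rewrite /t gt_min; apply/orP; left; lra.
  have tz : Q2 * t <= z.
    have : t <= z / (Q2 + 1) by rewrite ge_min lexx orbT.
    by rewrite ler_pdivlMr ?ltr_wpDl//; lra.
  pose be := al + t.
  have bal : be - al = t by rewrite /be addrC addKr.
  have balt : `|be - al| = t by rewrite bal gtr0_norm.
  have balE : `|be - al| < eps by rewrite balt.
  have := quad _ balE; rewrite balt bal => qd.
  have [be0 bea be1 _ _] := bP _ (near_al _ balE).
  have nubL := nuL _ _ bea ala; rewrite balt in nubL.
  have nubb := nub _ bea.
  rewrite -(ler_pM2l t0) -{1}(gtr0_norm t0) -normrM.
  have -> : t * (dl + mu i0 + 2 * al * nu al) =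
     - (lam be - lam al - t * dl) + t * (- (2 * al * (nu be - nu al)) - t * nu be) -
      al * al * (nu be - nu al).
    by rewrite /lam /be; ring.
  have b1 : `|2 * al * (nu be - nu al)| <= 2 * (Cv * t).
    apply: normM_le => //; rewrite gtr0_norm ?mulr_gt0//.
    by rewrite -[leRHS]mulr1 ler_wpM2l.
  have b2 : `|t * nu be| <= t * Nb by apply: normM_le => //; rewrite gtr0_norm.
  have b3 : `|- (2 * al * (nu be - nu al)) - t * nu be| <= 2 * (Cv * t) + t * Nb.
    by apply: normB_le => //; rewrite normrN.
  have b4 : `|t * (- (2 * al * (nu be - nu al)) - t * nu be)| <= t * (2 * (Cv * t) + t * Nb).
    by apply: normM_le => //; rewrite gtr0_norm.
  have b5 : `|al * al * (nu be - nu al)| <= al * al * (Cv * t).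
    by apply: normM_le => //; rewrite gtr0_norm// mulr_gt0.
  rewrite -normrN in qd.
  apply: le_trans (normB_le (normD_le qd b4) b5) _.
  have := ler_wpM2l (ltW t0) tz; rewrite /Q2; lra.
exists b0, (3 * Cv), h, lam, (fun al => 'D_1 lam al); split => //; first by rewrite mulr_ge0.
move=> al alb; have [al0 ala al1 ala1 tl] := bP _ alb.
have [Lh cg] := fixedP _ ala; have [D [eta [D0 LD _ _ _]]] := growP _ alb.
have [dl dlP dlb] := derP _ alb.
have nn : `|nu al - nu 0| <= Cv * al.
  by have := nuL _ _ ala a0n; rewrite subr0 (gtr0_norm al0).
split => //.
- split => //; case/andP: tl; exact: le_lt_trans.
- exact: hc.
- by exists D.
rewrite -nu0 (@derive_val _ _ _ _ _ _ _ dlP); split.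
  have -> : lam al - (1 - al * mu i0 - al ^+ 2 * nu 0) = - (al ^+ 2 * (nu al - nu 0)).
    by rewrite /lam; ring.
  rewrite normrN; have aa : `|al ^+ 2| <= al ^+ 2 by rewrite ger0_norm// exprn_ge0// ltW.
  apply: le_trans (normM_le aa nn) _.
  have : 0 <= Cv * al ^+ 3 by have al0' := ltW al0; nonneg.
  by lra.
have -> : dl + mu i0 + 2 * al * nu 0 = (dl + mu i0 + 2 * al * nu al) - 2 * al * (nu al - nu 0).
  by ring.
have aa : `|2 * al| <= 2 * al by rewrite gtr0_norm// mulr_gt0.
apply: le_trans (normB_le dlb (normM_le aa nn)) _.
by rewrite le_eqVlt; apply/orP; left; apply/eqP; ring.
Qed.

End ReducedResolvent.

(** * Geometric ergodicity in the weighted norm *)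

Section Transfer.
Import HBNNSimple.
Local Open Scope ereal_scope.
Context d1 d2 d3 (Y1 : measurableType d1) (Y2 : measurableType d2)
  (Z : measurableType d3) (R : realType).
Variables (mu1 : {measure set Y1 -> \bar R}) (mu2 : {measure set Y2 -> \bar R}).
Variables (a1 : Y1 -> R) (a2 : Y2 -> R) (phi : Y1 -> Z) (k : Y2 -> {measure set Z -> \bar R}).
Hypotheses (a10 : forall y, (0 <= a1 y)%R) (a20 : forall y, (0 <= a2 y)%R).
Hypotheses (ma1 : measurable_fun setT a1) (ma2 : measurable_fun setT a2).
Hypothesis mphi : measurable_fun setT phi.
Hypothesis mk : forall U, measurable U -> measurable_fun [set: Y2] (k ^~ U).
Hypothesis transfer_set : forall A, measurable A ->
  \int[mu1]_y ((a1 y)%:E * (\1_A (phi y))%:E) = \int[mu2]_y ((a2 y)%:E * k y A).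

Let mEa1 : measurable_fun setT (EFin \o a1). Proof. exact/measurable_EFinP. Qed.
Let mEa2 : measurable_fun setT (EFin \o a2). Proof. exact/measurable_EFinP. Qed.

Let transfer_nnsfun (f : {nnsfun Z >-> R}) :
  \int[mu1]_y ((a1 y)%:E * (f (phi y))%:E) =
  \int[mu2]_y ((a2 y)%:E * \int[k y]_z (f z)%:E).
Proof.
have E1 y : (a1 y)%:E * (f (phi y))%:E = \sum_(r \in range f)
    (r%:E * ((a1 y)%:E * (\1_(f @^-1` [set r]) (phi y))%:E)).
  rewrite fimfunE -fsumEFin// ge0_mule_fsumr; last first.
    by move=> r; rewrite lee_fin; exact: nnfun_muleindic_ge0.
  by apply: eq_fsbigr => r _; rewrite EFinM muleCA.
have E2 y : (a2 y)%:E * \int[k y]_z (f z)%:E = \sum_(r \in range f)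
    (r%:E * ((a2 y)%:E * k y (f @^-1` [set r]))).
  rewrite integralT_nnsfun sintegralE ge0_mule_fsumr; last first.
    by move=> r; exact: nnsfun_mulemu_ge0.
  by apply: eq_fsbigr => r _; rewrite muleCA.
under eq_integral do rewrite E1; under [RHS]eq_integral do rewrite E2.
have m1 A : measurable A -> measurable_fun setT (fun y => (a1 y)%:E * (\1_A (phi y))%:E).
  move=> mA; apply: emeasurable_funM => //; apply/measurable_EFinP.
  by apply: measurableT_comp => //; exact: measurable_indic.
have m2 A : measurable A -> measurable_fun setT (fun y => (a2 y)%:E * k y A).
  by move=> mA; apply: emeasurable_funM => //; exact: mk.
(* The sums are indexed by arbitrary reals; a negative [r] is not a value of [f], so that its
   preimage is empty and the term is 0. *)
have nneg (r : R) (x : \bar R) : ((r < 0)%R -> x = 0) -> 0 <= x -> 0 <= r%:E * x.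
  by move=> xr x0; have [r0|/xr ->] := leP 0%R r; rewrite ?mule0// mule_ge0// lee_fin.
rewrite !ge0_integral_fsum//.
- apply: eq_fsbigr => r /set_mem[z _ <-]; rewrite !ge0_integralZl//.
  + by rewrite transfer_set.
  + exact: m2.
  + by move=> y _; rewrite mule_ge0// lee_fin.
  + by rewrite lee_fin.
  + exact: m1.
  + by move=> y _; rewrite mule_ge0// lee_fin.
  + by rewrite lee_fin.
- by move=> r; apply: measurable_funeM; exact: m2.
- move=> r y _; apply: nneg; last by rewrite mule_ge0// lee_fin.
  by move=> r0; rewrite preimage_nnfun0// measure0 mule0.
- by move=> r; apply: measurable_funeM; exact: m1.
- move=> r y _; apply: nneg; last by rewrite mule_ge0// lee_fin.
  by move=> r0; rewrite preimage_nnfun0// indic0 mule0.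
Qed.

(** Extension from sets to simple functions by linearity, then by monotone convergence. The weights
    [a1] and [a2] carry a second factor through the argument, which the Markov property needs. *)
Lemma ge0_integral_transfer (f : Z -> \bar R) : (forall z, 0 <= f z) ->
  measurable_fun [set: Z] f ->
  \int[mu1]_y ((a1 y)%:E * f (phi y)) = \int[mu2]_y ((a2 y)%:E * \int[k y]_z f z).
Proof.
move=> f0 mf; pose f_ := nnsfun_approx measurableT mf.
have f_cvg z : (f_ n z)%:E @[n --> \oo] --> f z by exact: cvg_nnsfun_approx.
have nd z : {homo (fun n => (f_ n z)%:E) : a b / (a <= b)%N >-> a <= b}.
  by move=> a b ab; rewrite lee_fin; exact/lefP/nd_nnsfun_approx.
have kcvg (m : {measure set Z -> \bar R}) :
    \int[m]_z (f_ n z)%:E @[n --> \oo] --> \int[m]_z f z.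
  have -> : \int[m]_z f z = \int[m]_z limn (fun n => (f_ n z)%:E).
    by apply: eq_integral => z _; apply/esym/cvg_lim => //; exact: f_cvg.
  apply: cvg_monotone_convergence => //.
  - by move=> n; exact/measurable_EFinP.
  - by move=> n z _; rewrite lee_fin.
have knd y : {homo (fun n => \int[k y]_z (f_ n z)%:E) : a b / (a <= b)%N >-> a <= b}.
  move=> a b ab; apply: ge0_le_integral => //.
  + by move=> z _; rewrite lee_fin.
  + exact/measurable_EFinP.
  + exact/measurable_EFinP.
  + by move=> z _; exact: nd.
have mcv d (Y : measurableType d) (mu : {measure set Y -> \bar R}) (a : Y -> R)
    (u : nat -> Y -> \bar R) (l : Y -> \bar R) : (forall y, (0 <= a y)%R) ->
    measurable_fun setT a -> (forall n, measurable_fun setT (u n)) ->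
    (forall n y, 0 <= u n y) -> (forall y, {homo (u ^~ y) : n m / (n <= m)%N >-> n <= m}) ->
    (forall y, u n y @[n --> \oo] --> l y) ->
    \int[mu]_y ((a y)%:E * u n y) @[n --> \oo] --> \int[mu]_y ((a y)%:E * l y).
  move=> a0 ma mu_ u0 ndu ul.
  have -> : \int[mu]_y ((a y)%:E * l y) = \int[mu]_y limn (fun n => (a y)%:E * u n y).
    by apply: eq_integral => y _; apply/esym/cvg_lim => //; apply: cvgeZl.
  apply: cvg_monotone_convergence => //.
  - by move=> n; apply: emeasurable_funM => //; exact/measurable_EFinP.
  - by move=> n y _; rewrite mule_ge0// lee_fin.
  - by move=> y _ n m nm; rewrite lee_wpmul2l// ?lee_fin//; exact: ndu.
have h1 : \int[mu1]_y ((a1 y)%:E * (f_ n (phi y))%:E) @[n --> \oo] -->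
    \int[mu1]_y ((a1 y)%:E * f (phi y)).
  apply: (mcv _ _ _ _ (fun n y => (f_ n (phi y))%:E)) => //.
  - by move=> n; apply/measurable_EFinP; exact: measurableT_comp.
  - by move=> n y; rewrite lee_fin.
have h2 : \int[mu2]_y ((a2 y)%:E * \int[k y]_z (f_ n z)%:E) @[n --> \oo] -->
    \int[mu2]_y ((a2 y)%:E * \int[k y]_z f z).
  apply: (mcv _ _ _ _ (fun n y => \int[k y]_z (f_ n z)%:E)) => //.
  - move=> n; apply: measurable_fun_integral_kernel => //.
      by move=> z; rewrite lee_fin.
    exact/measurable_EFinP.
  - by move=> n y; apply: integral_ge0 => z _; rewrite lee_fin.
move: h1; under eq_fun do rewrite transfer_nnsfun.
by move=> h1; exact: cvg_unique h1 h2.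
Qed.

End Transfer.

Section Mixture.
Local Open Scope ereal_scope.
Context d1 d2 d3 (Y1 : measurableType d1) (Y2 : measurableType d2)
  (Z : measurableType d3) (R : realType).
Variables (mu1 : {measure set Y1 -> \bar R}) (mu2 : {measure set Y2 -> \bar R}).
Variables (phi : Y1 -> Z) (k : Y2 -> {measure set Z -> \bar R}).
Hypothesis mphi : measurable_fun setT phi.
Hypothesis mk : forall U, measurable U -> measurable_fun [set: Y2] (k ^~ U).
Hypothesis mixture : forall A, measurable A -> mu1 (phi @^-1` A) = \int[mu2]_y k y A.

Lemma ge0_integral_mixture (f : Z -> \bar R) : (forall z, 0 <= f z) ->
  measurable_fun [set: Z] f -> \int[mu1]_y f (phi y) = \int[mu2]_y \int[k y]_z f z.
Proof.
move=> f0 mf.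
have mul1 d (Y : measurableType d) (mu : {measure set Y -> \bar R}) (g : Y -> \bar R) :
    \int[mu]_y ((cst 1%R y)%:E * g y) = \int[mu]_y g y.
  by apply: eq_integral => y _; rewrite mul1e.
have := @ge0_integral_transfer _ _ _ _ _ _ _ mu1 mu2 (cst 1%R) (cst 1%R) phi k
  (fun=> ler01) (fun=> ler01) (measurable_cst _) (measurable_cst _) mphi mk _ f f0 mf.
rewrite !mul1; apply => A mA; rewrite !mul1 -mixture//.
rewrite -(setIT (phi @^-1` A)) -integral_indic//.
by rewrite -[X in measurable X]setTI; exact: mphi.
Qed.

End Mixture.

(** * Functions dominated by the Lyapunov function *)

Section VBounded.
Context {R : realType} {d : measure_display} {X : measurableType d}.
Variable V : X -> R.
Hypotheses (mV : measurable_fun setT V) (V1 : forall x, 1 <= V x).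

Definition vbounded (f : X -> R) (c : R) :=
  measurable_fun setT f /\ forall x, `|f x| <= c * V x.

Lemma V_ge0 x : 0 <= V x.
Proof. exact: le_trans ler01 (V1 x). Qed.

Lemma vboundedV : vbounded V 1.
Proof. by split => // x; rewrite mul1r ger0_norm// V_ge0. Qed.

Lemma vbounded_cst a : vbounded (cst a) `|a|.
Proof. by split => // x; rewrite ler_peMr. Qed.

Lemma vboundedD f g a b : vbounded f a -> vbounded g b ->
  vbounded (fun x => f x + g x) (a + b).
Proof.
move=> [mf fa] [mg gb]; split; first exact: measurable_funD.
by move=> x; rewrite mulrDl (le_trans (ler_normD _ _))// lerD.
Qed.

Lemma vboundedZ f s a : vbounded f a -> vbounded (fun x => s * f x) (`|s| * a).
Proof.
move=> [mf fa]; split; first exact: measurable_funM.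
by move=> x; rewrite normrM -mulrA ler_wpM2l.
Qed.

Lemma vboundedB f g a b : vbounded f a -> vbounded g b ->
  vbounded (fun x => f x - g x) (a + b).
Proof.
move=> [mf fa] [mg gb]; split; first exact: measurable_funB.
by move=> x; rewrite mulrDl (le_trans (ler_normB _ _))// lerD.
Qed.

Lemma vboundedM (f g : X -> R) (a b : R) : 0 <= a -> measurable_fun setT f -> (forall x, `|f x| <= a) ->
  vbounded g b -> vbounded (fun x => f x * g x) (a * b).
Proof.
move=> a0 mf fa [mg gb]; split; first exact: measurable_funM.
by move=> x; rewrite normrM -mulrA ler_pM.
Qed.

Lemma vbounded_indic A : measurable A -> vbounded (\1_A) 1.
Proof.
move=> mA; split; first exact: measurable_indic.
by move=> x; rewrite mul1r indicE ger0_norm// (le_trans _ (V1 x))// lern1; case: (_ \in _).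
Qed.

Lemma vbounded_le f a b : vbounded f a -> a <= b -> vbounded f b.
Proof.
move=> [mf fa] ab; split => // x; apply: le_trans (fa x) _.
by rewrite ler_wpM2r// V_ge0.
Qed.

Lemma vbounded_sum (I : Type) (r : seq I) (f : I -> X -> R) (a : I -> R) :
  (forall i, vbounded (f i) (a i)) ->
  vbounded (fun x => \sum_(i <- r) f i x) (\sum_(i <- r) a i).
Proof.
move=> fa; elim: r => [|i r IHr].
  under eq_fun do rewrite big_nil.
  by rewrite big_nil; have := vbounded_cst 0; rewrite normr0.
under eq_fun do rewrite big_cons.
by rewrite big_cons; exact: vboundedD.
Qed.

Section Integral.
Variable mu : {measure set X -> \bar R}.
Hypothesis muV : (\int[mu]_x (V x)%:E < +oo)%E.

Lemma integrableV : mu.-integrable setT (EFin \o V).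
Proof.
apply/integrableP; split; first exact/measurable_EFinP.
by under eq_integral => x _ do rewrite /= ger0_norm ?V_ge0//.
Qed.

Lemma vbounded_integrable f c : vbounded f c -> mu.-integrable setT (EFin \o f).
Proof.
move=> [mf fc]; apply: (@le_integrable _ _ _ _ _ measurableT _ (fun x => c%:E * (V x)%:E)%E).
- exact/measurable_EFinP.
- move=> x _ /=; rewrite lee_fin (le_trans (fc x))// ler_norm.
  by [].
- by apply: integrableZl => //; exact: integrableV.
Qed.

Lemma vintD f g a b : vbounded f a -> vbounded g b ->
  \int[mu]_x (f x + g x) = \int[mu]_x f x + \int[mu]_x g x.
Proof. by move=> fa gb; rewrite RintegralD//; [exact: vbounded_integrable fa|exact: vbounded_integrable gb]. Qed.

Lemma vintB f g a b : vbounded f a -> vbounded g b ->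
  \int[mu]_x (f x - g x) = \int[mu]_x f x - \int[mu]_x g x.
Proof. by move=> fa gb; rewrite RintegralB//; [exact: vbounded_integrable fa|exact: vbounded_integrable gb]. Qed.

Lemma vintZ f s a : vbounded f a -> \int[mu]_x (s * f x) = s * \int[mu]_x f x.
Proof. by move=> fa; rewrite RintegralZl//; exact: vbounded_integrable fa. Qed.

Lemma le_vint f g a b : vbounded f a -> vbounded g b -> (forall x, f x <= g x) ->
  \int[mu]_x f x <= \int[mu]_x g x.
Proof. by move=> fa gb fg; apply: le_Rintegral => //; [exact: vbounded_integrable fa|exact: vbounded_integrable gb]. Qed.

Lemma vint_sum (I : Type) (r : seq I) (f : I -> X -> R) (a : I -> R) :
  (forall i, vbounded (f i) (a i)) ->
  \int[mu]_x (\sum_(i <- r) f i x) = \sum_(i <- r) \int[mu]_x f i x.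
Proof.
move=> fa; elim: r => [|i r IHr].
  by under eq_Rintegral do rewrite big_nil; rewrite big_nil Rintegral_cst// mul0r.
under eq_Rintegral do rewrite big_cons.
by rewrite big_cons -IHr; apply: vintD (fa i) (vbounded_sum r fa).
Qed.

Lemma EFin_vint f c : vbounded f c -> (\int[mu]_x f x)%:E = (\int[mu]_x (f x)%:E)%E.
Proof. by move=> fc; rewrite fineK//; apply: integrable_fin_num => //; exact: vbounded_integrable fc. Qed.

Lemma norm_vint_le f c : vbounded f c -> `|\int[mu]_x f x| <= c * \int[mu]_x V x.
Proof.
move=> fc; have cV := vboundedZ c vboundedV.
rewrite ler_norml -mulNr -!(vintZ _ vboundedV); apply/andP; split.
  apply: (le_vint (vboundedZ (- c) vboundedV) fc) => x.
  by have := fc.2 x; rewrite ler_norml mulNr => /andP[].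
by apply: (le_vint fc cV) => x; have := fc.2 x; rewrite ler_norml => /andP[].
Qed.

End Integral.

End VBounded.

(** * The transition operator under the drift condition *)

Section MarkovOperator.
Context {R : realType} {d : measure_display} {X : measurableType d}.
Variables (P : R.-pker X ~> X) (V : X -> R) (gam b : R) (C : set X).
Hypotheses (mV : measurable_fun setT V) (V1 : forall x, 1 <= V x).
Hypotheses (gam01 : 0 <= gam < 1) (b0 : 0 <= b) (mC : measurable C).
Hypothesis drift : forall x, (\int[P x]_y (V y)%:E <= (gam * V x + b * \1_C x)%:E)%E.

Local Notation vbounded := (vbounded V).

Definition Pop (f : X -> R) (x : X) : R := \int[P x]_y f y.

Lemma PV_lty x : (\int[P x]_y (V y)%:E < +oo)%E.
Proof. exact: le_lt_trans (drift x) (ltry _). Qed.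

Lemma PopD f g c c' : vbounded f c -> vbounded g c' ->
  Pop (fun x => f x + g x) = (fun x => Pop f x + Pop g x).
Proof. by move=> fc gc; apply/funext => x; exact: (vintD mV V1 (PV_lty x) fc gc). Qed.

Lemma PopB f g c c' : vbounded f c -> vbounded g c' ->
  Pop (fun x => f x - g x) = (fun x => Pop f x - Pop g x).
Proof. by move=> fc gc; apply/funext => x; exact: (vintB mV V1 (PV_lty x) fc gc). Qed.

Lemma PopZ f s c : vbounded f c -> Pop (fun x => s * f x) = (fun x => s * Pop f x).
Proof. by move=> fc; apply/funext => x; exact: (vintZ mV V1 (PV_lty x) s fc). Qed.

Lemma le_Pop f g c c' : vbounded f c -> vbounded g c' -> (forall x, f x <= g x) ->
  forall x, Pop f x <= Pop g x.
Proof. by move=> fc gc fg x; exact: (le_vint mV V1 (PV_lty x) fc gc fg). Qed.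

Lemma Pop_ge0 f : (forall x, 0 <= f x) -> forall x, 0 <= Pop f x.
Proof. by move=> f0 x; apply: Rintegral_ge0 => y _; exact: f0. Qed.

Lemma Pop_cst a : Pop (fun=> a) = (fun=> a).
Proof.
apply/funext => x; rewrite /Pop Rintegral_cst// [P x setT](@prob_kernel _ _ _ _ _ P x).
by rewrite mulr1.
Qed.

Lemma EFin_Pop f c x : vbounded f c -> (Pop f x)%:E = (\int[P x]_y (f y)%:E)%E.
Proof. by move=> fc; exact: (EFin_vint mV V1 (PV_lty x) fc). Qed.

Lemma Pop_drift x : Pop V x <= gam * V x + b * \1_C x.
Proof. by rewrite -lee_fin (EFin_Pop _ (vboundedV mV V1)); exact: drift. Qed.

Lemma indic01 A (x : X) : 0 <= (\1_A x : R) <= 1.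
Proof. by rewrite indicE ler0n/= lern1; case: (_ \in _). Qed.

Lemma Pop_drift' x : Pop V x <= gam * V x + b.
Proof.
by apply: le_trans (Pop_drift x) _; rewrite lerD2l ler_piMr//; have /andP[] := indic01 C x.
Qed.

Lemma measurable_Pop f c : vbounded f c -> measurable_fun setT (Pop f).
Proof.
have pos g c' : vbounded g c' -> (forall x, 0 <= g x) -> measurable_fun setT (Pop g).
  move=> [mg gc] g0; rewrite (_ : Pop g = fine \o (fun x => \int[P x]_y (g y)%:E)%E)//.
  apply: measurableT_comp => //; apply: measurable_fun_integral_kernel.
  - by move=> U mU; exact: measurable_kernel.
  - by move=> z; rewrite lee_fin.
  - exact/measurable_EFinP.
move=> fc; have cV := vboundedZ c (vboundedV mV V1).
(* Adding [c * V] makes the integrand nonnegative, where measurability of kernel integrals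
   applies. *)
have -> : Pop f = (fun x => Pop (fun y => f y + c * V y) x - Pop (fun y => c * V y) x).
  by rewrite (PopD fc cV); apply/funext => x; rewrite addrK.
have Pop_cV : measurable_fun setT (Pop (fun y => c * V y)).
  rewrite (PopZ _ (vboundedV mV V1)); apply: measurable_funM => //.
  by apply: (pos _ _ (vboundedV mV V1)) => x; exact: V_ge0.
apply: measurable_funB => //; apply: pos; first exact: (vboundedD fc cV).
by move=> x; have := fc.2 x; rewrite ler_norml -subr_ge0 opprK => /andP[].
Qed.

Lemma Pop_bound f c : vbounded f c -> vbounded (Pop f) (`|c| * (gam + b)).
Proof.
move=> fc; split; first exact: measurable_Pop fc.
move=> x; have fc' := vbounded_le V1 fc (ler_norm c).
have := norm_vint_le mV V1 (PV_lty x) fc' => /le_trans; apply.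
rewrite -mulrA ler_wpM2l// (le_trans (Pop_drift' x))// mulrDl lerD2l.
by rewrite ler_peMr.
Qed.

Lemma iter_bound n f c : vbounded f c -> exists c', vbounded (iter n Pop f) c'.
Proof.
move=> fc; elim: n => [|n [c' IHn]]; first by exists c.
by eexists; exact: Pop_bound IHn.
Qed.

Lemma iter_PopD n f g c c' : vbounded f c -> vbounded g c' ->
  iter n Pop (fun x => f x + g x) = (fun x => iter n Pop f x + iter n Pop g x).
Proof.
move=> fc gc; elim: n => //= n ->.
have [c1 h1] := iter_bound n fc; have [c2 h2] := iter_bound n gc.
by rewrite (PopD h1 h2).
Qed.

Lemma iter_PopB n f g c c' : vbounded f c -> vbounded g c' ->
  iter n Pop (fun x => f x - g x) = (fun x => iter n Pop f x - iter n Pop g x).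
Proof.
move=> fc gc; elim: n => //= n ->.
have [c1 h1] := iter_bound n fc; have [c2 h2] := iter_bound n gc.
by rewrite (PopB h1 h2).
Qed.

Lemma iter_PopZ n f s c : vbounded f c ->
  iter n Pop (fun x => s * f x) = (fun x => s * iter n Pop f x).
Proof.
move=> fc; elim: n => //= n ->; have [c1 h1] := iter_bound n fc.
by rewrite (PopZ _ h1).
Qed.

Lemma iter_cst n a : iter n Pop (fun=> a) = (fun=> a).
Proof. by elim: n => //= n ->; exact: Pop_cst. Qed.

Lemma le_iter n f g c c' : vbounded f c -> vbounded g c' -> (forall x, f x <= g x) ->
  forall x, iter n Pop f x <= iter n Pop g x.
Proof.
move=> fc gc fg; elim: n => //= n IHn.
have [c1 h1] := iter_bound n fc; have [c2 h2] := iter_bound n gc.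
exact: (le_Pop h1 h2 IHn).
Qed.

Lemma iter_ge0 n f : (forall x, 0 <= f x) -> forall x, 0 <= iter n Pop f x.
Proof. by move=> f0; elim: n => //= n IHn; exact: Pop_ge0. Qed.

Lemma kernel_iterE n A x : measurable A ->
  kernel_iter P n x A = (iter n Pop \1_A x)%:E.
Proof.
move=> mA; elim: n x => [|n IHn] x /=; first by rewrite diracE indicE.
under eq_integral do rewrite IHn.
by have [c' h] := iter_bound n (vbounded_indic V1 mA); rewrite -(EFin_Pop x h).
Qed.

Lemma iter_V n x : iter n Pop V x <= gam ^+ n * V x + b / (1 - gam).
Proof.
have [gam0 gam1] := andP gam01.
have g1 : 0 < 1 - gam by rewrite subr_gt0.
elim: n x => [|n IHn] x; first by rewrite expr0 mul1r lerDl divr_ge0// ltW.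
have [c' h] := iter_bound n (vboundedV mV V1).
have gV := vboundedZ gam (vboundedV mV V1).
rewrite iterSr; have hb := vbounded_cst V1 b.
have := le_iter n (Pop_bound (vboundedV mV V1)) (vboundedD gV hb) Pop_drift' x.
rewrite (iter_PopD n gV hb) (iter_PopZ n _ (vboundedV mV V1)) iter_cst => /le_trans; apply.
apply: le_trans (lerD (ler_wpM2l gam0 (IHn x)) (lexx b)) _.
rewrite exprS le_eqVlt; apply/orP; left; apply/eqP; field.
by rewrite gt_eqF.
Qed.

Lemma iter_indic01 n A x : measurable A -> 0 <= iter n Pop \1_A x <= 1.
Proof.
move=> mA; rewrite iter_ge0 => [|y]; last by have /andP[] := indic01 A y.
have h1 := vbounded_cst V1 1.
have := le_iter n (vbounded_indic V1 mA) h1 _ x.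
by rewrite iter_cst; apply => y; have /andP[] := indic01 A y.
Qed.

Lemma vbounded01 (f : X -> R) : measurable_fun setT f -> (forall x, 0 <= f x <= 1) -> vbounded f 1.
Proof.
move=> mf f01; split => // x; have /andP[f0 f1] := f01 x.
by rewrite mul1r ger0_norm// (le_trans f1).
Qed.

Lemma measurable_iter n f c : vbounded f c -> measurable_fun setT (iter n Pop f).
Proof. by move=> fc; have [c' []] := iter_bound n fc. Qed.

Lemma vbounded_iter_indic n A : measurable A -> vbounded (iter n Pop \1_A) 1.
Proof.
move=> mA; apply: vbounded01 => [|x]; last exact: iter_indic01.
exact: measurable_iter (vbounded_indic V1 mA).
Qed.

(* The probability that the chain started at x is outside C at times 0, ..., n. *)
Definition avoid (n : nat) : X -> R :=
  iter n (fun g x => \1_(~` C) x * Pop g x) \1_(~` C).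

Lemma avoidS n x : avoid n.+1 x = \1_(~` C) x * Pop (avoid n) x.
Proof. by []. Qed.

Lemma indicC_in x : C x -> \1_(~` C) x = 0 :> R.
Proof. by move=> Cx; rewrite indicE memNset//=; apply. Qed.

Lemma indicC_notin x : ~ C x -> \1_(~` C) x = 1 :> R.
Proof. by move=> Cx; rewrite indicE mem_set. Qed.

Lemma vbounded_avoid n : vbounded (avoid n) 1 /\ forall x, 0 <= avoid n x <= 1.
Proof.
elim: n => [|n [IH1 IH2]].
  split=> [|x]; [exact/(vbounded_indic V1)/measurableC|exact: indic01].
have b01 x : 0 <= avoid n.+1 x <= 1.
  rewrite avoidS; have /andP[i0 i1] := indic01 (~` C) x.
  have p0 : 0 <= Pop (avoid n) x by apply: Pop_ge0 => y; have /andP[] := IH2 y.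
  have p1 : Pop (avoid n) x <= 1.
    have := le_Pop IH1 (vbounded_cst V1 1) _ x; rewrite Pop_cst; apply => y.
    by have /andP[] := IH2 y.
  by rewrite mulr_ge0//= -[leRHS]mulr1 ler_pM.
split=> //; apply: vbounded01 => //.
apply: measurable_funM; first exact/measurable_indic/measurableC.
exact: measurable_Pop IH1.
Qed.

(** Outside [C] the drift inequality has no additive term, so every step spent there gains a factor
    [gam]. *)
Lemma avoid_V n x : avoid n x <= gam ^+ n * V x.
Proof.
have [gam0 gam1] := andP gam01.
elim: n x => [|n IHn] x.
  by rewrite expr0 mul1r (le_trans _ (V1 x))//; have /andP[] := indic01 (~` C) x.
rewrite avoidS; have [Cx|Cx] := pselect (C x).
  by rewrite indicC_in// mul0r mulr_ge0 ?exprn_ge0// V_ge0.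
rewrite indicC_notin// mul1r.
have gV := vboundedZ (gam ^+ n) (vboundedV mV V1).
have := le_Pop (vbounded_avoid n).1 gV IHn x => /le_trans; apply.
rewrite (PopZ _ (vboundedV mV V1)) exprSr -mulrA ler_wpM2l ?exprn_ge0//.
by have := Pop_drift x; rewrite indicE memNset// mulr0 addr0.
Qed.

(** The union bound over the times at which [C] can be visited. *)
Lemma avoid_hit n x : 1 - avoid n x <= \sum_(j < n.+1) iter j Pop \1_C x.
Proof.
elim: n x => [|n IHn] x.
  rewrite big_ord_recl big_ord0 addr0/= /avoid/=.
  have [Cx|Cx] := pselect (C x).
    by rewrite indicC_in// subr0 indicE mem_set.
  by rewrite indicC_notin// subrr; have /andP[] := indic01 C x.
rewrite big_ord_recl avoidS /=.
have s0 : 0 <= \sum_(i < n.+1) iter (bump 0 i) Pop \1_C x.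
  by apply: sumr_ge0 => i _; have /andP[] := iter_indic01 (bump 0 i) x mC.
have [Cx|Cx] := pselect (C x).
  by rewrite indicC_in// mul0r subr0 indicE mem_set//= lerDl.
rewrite indicC_notin// mul1r indicE memNset//= add0r.
have vs : forall j, vbounded (iter j Pop \1_C) 1 by move=> j; exact: vbounded_iter_indic.
have va := vboundedB (vbounded_cst V1 1) (vbounded_avoid n).1.
have vs' := vbounded_sum V1 (index_enum 'I_n.+1) (fun j : 'I_n.+1 => vs j).
have := le_Pop va vs' IHn x.
rewrite (PopB (vbounded_cst V1 1) (vbounded_avoid n).1) Pop_cst => /le_trans; apply.
by rewrite {1}/Pop (vint_sum mV V1 (PV_lty x) _ (fun j : 'I_n.+1 => vs j)).
Qed.

(** Positivity passes between functions through their zero sets, without any lower bound: [f]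
    vanishes almost everywhere for [P x], hence so does [g]. *)
Lemma Pop_eq0 f g c c' x : vbounded f c -> vbounded g c' ->
  (forall y, 0 <= f y) -> (forall y, 0 <= g y) -> (forall y, f y = 0 -> g y = 0) ->
  Pop f x = 0 -> Pop g x = 0.
Proof.
move=> fc gc f0 g0 fg Pf0.
have absE h c1 : vbounded h c1 -> (forall y, 0 <= h y) ->
    (\int[P x]_y `|(h y)%:E|)%E = (Pop h x)%:E.
  move=> hc h0; rewrite (EFin_Pop x hc); apply: eq_integral => y _.
  by rewrite /= ger0_norm.
have mE h c1 : vbounded h c1 -> measurable_fun setT (EFin \o h).
  by move=> [mh _]; exact/measurable_EFinP.
have /(ae_eq_integral_abs (P x) measurableT (mE _ _ fc)) ae : (\int[P x]_(y in setT) `|(EFin \o f) y|)%E = 0%E.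
  by rewrite (absE _ _ fc f0) Pf0.
apply: EFin_inj; rewrite -(absE _ _ gc g0).
apply/(ae_eq_integral_abs (P x) measurableT (mE _ _ gc)).
by apply: filterS ae => y + _ => /(_ I)[fy0]; congr EFin; exact: fg.
Qed.

Lemma iter_eq0 n f g c c' x : vbounded f c -> vbounded g c' ->
  (forall y, 0 <= f y) -> (forall y, 0 <= g y) -> (forall y, f y = 0 -> g y = 0) ->
  iter n Pop f x = 0 -> iter n Pop g x = 0.
Proof.
move=> fc gc f0 g0 fg; elim: n x => [|n IHn] x /=; first exact: fg.
have [c1 h1] := iter_bound n fc; have [c2 h2] := iter_bound n gc.
by apply: (Pop_eq0 h1 h2) => //; exact: iter_ge0.
Qed.

Lemma bigcup_measure_gt0 (m : {measure set X -> \bar R}) (F : nat -> set X) :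
  (forall n, measurable (F n)) -> (0 < m (\bigcup_n F n))%E -> exists n, (0 < m (F n))%E.
Proof.
move=> mF m0; apply: contrapT => /forallNP h.
have F0 n : m.-negligible (F n).
  apply/negligibleP => //; apply/eqP; rewrite -measure_le0.
  by rewrite leNgt; apply/negP/h.
have := negligible_bigcup F0 => /measure_negligible.
move=> /(_ (bigcupT_measurable _ mF)) m00; by rewrite m00 ltxx in m0.
Qed.

(** * Small sets and the contraction of oscillations *)

Section Minorization.
Variables (t0 : nat) (nu : {measure set X -> \bar R}).
Hypotheses (t0_gt0 : (0 < t0)%N) (nu0 : nu setT != 0%E).
Hypothesis irr : irreducible_aperiodic P.
Hypothesis small : forall x A, C x -> measurable A -> (nu A <= kernel_iter P t0 x A)%E.

(** The time [n] is such that [|r| * gam ^+ n] is below one half, so it serves the whole sublevel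
    set of [V]. *)
Lemma V_hit (r : R) : exists n, forall x, V x <= r ->
  2^-1 <= \sum_(j < n.+1) iter j Pop \1_C x.
Proof.
have [gam0 gam1] := andP gam01.
have /cvgr_lt : geometric `|r| gam @ \oo --> 0 by apply: cvg_geometric; rewrite ger0_norm.
move=> /(_ 2^-1) []; first by rewrite invr_gt0.
move=> n _ /(_ n (leqnn n)) /= hn; exists n => x Vr.
apply: le_trans (avoid_hit n x); rewrite lerBrDr -lerBrDl.
apply: le_trans (avoid_V n x) _.
have : gam ^+ n * V x <= `|r| * gam ^+ n.
  rewrite mulrC ler_wpM2r ?exprn_ge0//; exact: le_trans Vr (ler_norm r).
by move: hn; lra.
Qed.

Lemma hit_pos x : exists j, 0 < iter j Pop \1_C x.
Proof.
have [n /(_ x (lexx _)) h] := V_hit (V x); apply: contrapT => /forallNP h0.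
have : \sum_(j < n.+1) iter j Pop \1_C x <= 0.
  by apply: sumr_le0 => j _; rewrite leNgt; apply/negP/h0.
by move: h; lra.
Qed.

Lemma mgt0 f c : vbounded f c -> measurable [set y | 0 < f y].
Proof.
move=> [mf _]; rewrite -[X in measurable X]setTI.
have -> : [set y | 0 < f y] = f @^-1` `]0, +oo[%classic.
  by apply/seteqP; split=> y /=; rewrite in_itv/= andbT.
exact: mf.
Qed.

(** The sets [D j] of points that reach [C] in [j] steps cover the space, so some [D j] has positive
    [psi] measure. The chain is in it with positive probability at every late time, and from there
    reaches [C] after [j] more steps. *)
Lemma aperiodic_hit x : exists N, forall n, (N <= n)%N -> 0 < iter n Pop \1_C x.
Proof.
have [psi [_ psi0 psiP]] := irr.
pose D j := [set y | 0 < iter j Pop \1_C y].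
have mD j : measurable (D j) by exact: mgt0 (vbounded_iter_indic j mC).
have [j Dj] : exists j, (0 < psi (D j))%E.
  apply: bigcup_measure_gt0 => //; rewrite (_ : \bigcup_n _ = setT).
    by rewrite lt0e psi0 measure_ge0.
  by apply/seteqP; split => // y _; have [j h] := hit_pos y; exists j.
have [N _ HN] := psiP x _ (mD j) Dj.
exists (N + j)%N => n Nn; have jn : (j <= n)%N by exact: leq_trans (leq_addl _ _) Nn.
have := HN (n - j)%N => /=; rewrite leq_subRL// addnC => /(_ Nn).
rewrite kernel_iterE// lte_fin => hp.
rewrite -(subnK jn) iterD lt_neqAle iter_ge0 ?andbT; last first.
  by move=> y; apply: iter_ge0 => z; have /andP[] := indic01 C z.
apply/negP => /eqP/esym h; move: hp; rewrite lt_neqAle => /andP[/negP].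
move=> hp _; apply: hp; apply/eqP/esym.
apply: (iter_eq0 (vbounded_iter_indic j mC) (vbounded_indic V1 (mD j)) _ _ _ h).
- by move=> y; apply: iter_ge0 => z; have /andP[] := indic01 C z.
- by move=> y; have /andP[] := indic01 (D j) y.
- by move=> y y0; rewrite indicE memNset// /D/= y0 ltxx.
Qed.

Definition nuf A : R := fine (nu A).

(** Needed to see that [nu] is finite: it is dominated by a transition probability from any point of
    [C]. *)
Lemma small_point : exists x, C x.
Proof.
have [j h] := hit_pos point; apply: contrapT => /forallNP C0.
move: h; have -> : (\1_C : X -> R) = (fun=> 0).
  by apply/funext => y; rewrite indicE memNset.
by rewrite iter_cst ltxx.
Qed.

Lemma nufE A : measurable A -> nu A = (nuf A)%:E.
Proof.
move=> mA; have [x Cx] := small_point; rewrite fineK//.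
rewrite ge0_fin_numE ?measure_ge0//; apply: le_lt_trans (small Cx mA) _.
by rewrite kernel_iterE// ltry.
Qed.

Lemma nuf_ge0 A : 0 <= nuf A.
Proof. exact: fine_ge0 (measure_ge0 nu A). Qed.

Lemma small_iter A : measurable A -> forall x, nuf A * \1_C x <= iter t0 Pop \1_A x.
Proof.
move=> mA x; have [Cx|Cx] := pselect (C x); last first.
  by rewrite indicE memNset// mulr0; have /andP[] := iter_indic01 t0 x mA.
rewrite indicE mem_set// mulr1 -lee_fin -nufE// -kernel_iterE//.
exact: small.
Qed.

(** Paths are cut as [t0 + n + t0]: the first stretch dominates [nu] on a set from which [C] is
    reached in exactly [n] steps, and the last one dominates [nu] again. Aperiodicity leaves [n],
    hence the total time, free from some point on. *)
Lemma small_eventually : exists s0, forall s, (s0 <= s)%N -> exists2 a, 0 < a &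
  forall A x, measurable A -> a * nuf A * \1_C x <= iter s Pop \1_A x.
Proof.
pose D j := [set y | 0 < iter j Pop \1_C y].
have mD j : measurable (D j) by exact: mgt0 (vbounded_iter_indic j mC).
pose E N := \bigcap_(n in [set n | (N <= n)%N]) D n.
have mE N : measurable (E N) by apply: bigcap_measurable => [|n _]; [exists N => /=|].
have [N EN] : exists N, (0 < nu (E N))%E.
  apply: bigcup_measure_gt0 => //; rewrite (_ : \bigcup_n _ = setT).
    by rewrite lt0e nu0 measure_ge0.
  apply/seteqP; split => // y _; have [N h] := aperiodic_hit y.
  by exists N => // n /h.
exists (t0 + (N + t0))%N => s Ns.
pose n := (s - (t0 + t0))%N.
have Nn : (N <= n)%N by rewrite /n leq_subRL; lia.
have sE : s = (t0 + (n + t0))%N by rewrite /n; lia.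
(* Points of [E N] return to [C] with positive probability only; one of the [F i] bounds this
   probability below and still has positive [nu] measure. *)
pose F i := [set y | i.+1%:R^-1 <= iter n Pop \1_C y].
have mF i : measurable (F i).
  rewrite -[X in measurable X]setTI.
  have -> : F i = iter n Pop \1_C @^-1` `[i.+1%:R^-1, +oo[%classic.
    by apply/seteqP; split=> y /=; rewrite in_itv/= andbT.
  by have [m _] := vbounded_iter_indic n mC; exact: m.
have [i Fi] : exists i, (0 < nu (F i))%E.
  apply: bigcup_measure_gt0 => //; apply: lt_le_trans EN _.
  apply: le_measure; rewrite ?inE//; first exact: bigcupT_measurable.
  move=> y /(_ n Nn); rewrite /D/= => hy.
  have [k hk] : exists k, k.+1%:R^-1 <= iter n Pop \1_C y.
    by have [k /ltW hk] := ltr_add_invr hy; exists k; rewrite add0r in hk.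
  by exists k.
pose del : R := i.+1%:R^-1.
have del0 : 0 < del by rewrite invr_gt0.
have Fi' : 0 < nuf (F i) by rewrite -lte_fin -nufE.
exists (del * nuf (F i)); first exact: mulr_gt0.
move=> A x mA; rewrite sE iterD iterD.
have vC := vbounded_indic V1 mC; have vF := vbounded_indic V1 (mF i).
have vA := vbounded_iter_indic t0 mA.
have l1 z : nuf A * iter n Pop \1_C z <= iter n Pop (iter t0 Pop \1_A) z.
  by have := le_iter n (vboundedZ (nuf A) vC) vA (small_iter mA) z; rewrite (iter_PopZ _ _ vC).
have l2 z : nuf A * del * \1_(F i) z <= iter n Pop (iter t0 Pop \1_A) z.
  apply: le_trans (l1 z); rewrite -mulrA ler_wpM2l ?nuf_ge0//.
  have [Fz|Fz] := pselect (F i z); first by rewrite indicE mem_set// mulr1.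
  rewrite indicE memNset// mulr0; apply: iter_ge0 => w.
  by have /andP[] := indic01 C w.
have [c1 h1] := iter_bound n vA.
have := le_iter t0 (vboundedZ (nuf A * del) vF) h1 l2 x.
rewrite (iter_PopZ _ _ vF) => h2; apply: le_trans h2.
have := small_iter (mF i) x => /(ler_wpM2l (mulr_ge0 (nuf_ge0 A) (ltW del0))).
by move=> h; apply: le_trans h; rewrite le_eqVlt; apply/orP; left; apply/eqP; ring.
Qed.

(** One constant for a whole window of times, so that different visit times of [C] can be completed
    to the same total time. *)
Lemma small_uniform n : exists s0 a, 0 < a /\ forall i, (i <= n)%N ->
  forall A x, measurable A -> a * nuf A * \1_C x <= iter (s0 + i) Pop \1_A x.
Proof.
have [s0 hs] := small_eventually; exists s0; elim: n => [|n [a [a0 IHn]]].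
  have [|a a0 ha] := hs (s0 + 0)%N; first exact: leq_addr.
  by exists a; split => // i; rewrite leqn0 => /eqP->.
have [|a' a'0 ha] := hs (s0 + n.+1)%N; first exact: leq_addr.
exists (Num.min a a'); split; first by rewrite lt_min a0.
move=> i; rewrite leq_eqVlt => /predU1P[->|/IHn h] A x mA.
  apply: le_trans (ha A x mA); have /andP[i0 _] := indic01 C x.
  by rewrite !ler_wpM2r ?nuf_ge0// ge_min lexx orbT.
apply: le_trans (h A x mA); have /andP[i0 _] := indic01 C x.
by rewrite !ler_wpM2r ?nuf_ge0// ge_min lexx.
Qed.

(** [C] is visited by time [n] with probability at least one half; after a visit at time [j] the
    window supplies the remaining time. The union bound costs the factor [n.+1]. *)
Lemma sublevel_minorization (r : R) : exists s a, [/\ (0 < s)%N, 0 < a &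
  forall A x, measurable A -> V x <= r -> a * nuf A <= iter s Pop \1_A x].
Proof.
have [n hn] := V_hit r; have [s0 [a [a0 ha]]] := small_uniform n.+1.
have n1 : 0 < (2 * n.+1%:R : R) by rewrite mulr_gt0.
exists (s0 + n.+1)%N, (a / (2 * n.+1%:R)); split.
- by rewrite addnS.
- by rewrite divr_gt0.
move=> A x mA Vr; have vC := vbounded_indic V1 mC.
have vA := vbounded_indic V1 mA.
have aA : 0 <= a * nuf A by rewrite mulr_ge0 ?nuf_ge0 ?(ltW a0).
have term j : (j < n.+1)%N -> a * nuf A * iter j Pop \1_C x <= iter (s0 + n.+1) Pop \1_A x.
  move=> jn; have -> : (s0 + n.+1 = j + (s0 + (n.+1 - j)))%N by lia.
  rewrite iterD; have [c1 h1] := iter_bound (s0 + (n.+1 - j)) vA.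
  have := le_iter j (vboundedZ (a * nuf A) vC) h1 _ x; rewrite (iter_PopZ _ _ vC); apply.
  by move=> z; apply: ha => //; exact: leq_subr.
have : a * nuf A * \sum_(j < n.+1) iter j Pop \1_C x <=
    \sum_(j < n.+1) iter (s0 + n.+1) Pop \1_A x.
  by rewrite mulr_sumr; apply: ler_sum => j _; exact: term.
rewrite sumr_const card_ord -mulr_natr.
move/(le_trans (ler_wpM2l aA (hn x Vr))) => h.
by rewrite mulrAC ler_pdivrMr//; move: h; lra.
Qed.

(* As in Hairer and Mattingly's proof of Harris' theorem: where V x + V y is
   large the drift contracts, elsewhere the minorization does. *)
Lemma oscillation_contraction : exists s bet kap, [/\ (0 < s)%N, 0 < bet, 0 <= kap < 1 &
  forall f c M, vbounded f c -> 0 <= M ->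
    (forall x y, `|f x - f y| <= M * (2 + bet * (V x + V y))) ->
    forall x y, `|iter s Pop f x - iter s Pop f y| <= kap * M * (2 + bet * (V x + V y))].
Proof.
have [gam0 gam1] := andP gam01; have g1 : 0 < 1 - gam by rewrite subr_gt0.
pose B := b / (1 - gam); have B0 : 0 <= B by rewrite divr_ge0// ltW.
(* If one of [V x] and [V y] exceeds [r], then [4 * B] is at most [(1 - gam) * (V x + V y)], and the
   drift alone gains. *)
pose r := 4 * B / (1 - gam) + 1.
have [s [a [s_gt0 a0 minor]]] := sublevel_minorization r.
have nuT : 0 < nuf setT.
  by rewrite -lte_fin -nufE// lt0e nu0 measure_ge0.
pose ep := a * nuf setT; have ep0 : 0 < ep by rewrite mulr_gt0.
(* [bet] is so small that inside the sublevel set the additive drift term [2 * bet * B] uses at most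
   half of the gain [ep] from the minorization. *)
have B1 : 0 < 4 * (B + 1) by rewrite mulr_gt0// ltr_wpDl.
pose bet := ep / (4 * (B + 1)); have bet0 : 0 < bet by rewrite divr_gt0.
have betB : 4 * bet * B <= ep.
  have : bet * (4 * (B + 1)) = ep by rewrite /bet divfK// gt_eqF.
  by move: bet0; lra.
(* The constant part 2 of the weight has to shrink too: inside by a share of [ep], outside by a
   share of the gain in [V], using [V x + V y >= 2]. *)
pose del := Num.min (ep / 4) (Num.min ((1 - gam) / 4) (bet * (1 - gam) / 8)).
have del0 : 0 < del by rewrite !lt_min !divr_gt0//= mulr_gt0.
have del1 : del <= ep / 4 by rewrite ge_min lexx.
have del2 : del <= (1 - gam) / 4 by rewrite !ge_min lexx orbT.
have del3 : del <= bet * (1 - gam) / 8 by rewrite !ge_min lexx !orbT.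
exists s, bet, (1 - del); split => //.
  by apply/andP; split; lra.
move=> f c M fc M0 fM.
suff one x y : iter s Pop f x - iter s Pop f y <= (1 - del) * M * (2 + bet * (V x + V y)).
  move=> x y; rewrite ler_norml one andbT lerNl opprB; have := one y x.
  by rewrite [V y + V x]addrC.
pose W z := 1 + bet * V z.
pose S := [set f z - M * W z | z in setT].
have ubS w : ubound S (f w + M * W w).
  move=> _ [z _ <-]; rewrite lerBlDr; have := fM z w.
  by rewrite ler_norml => /andP[_]; rewrite /W; lra.
have S0 : S !=set0 by exists (f point - M * W point); exists point.
have hS : has_sup S by split => //; exists (f point + M * W point); exact: ubS.
(* Centring at [c0] turns the bound on oscillations into [|f - c0| <= M * W], which says that both
   [g] and [g'] below are nonnegative. *)
pose c0 := sup S.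
have c0_le w : c0 <= f w + M * W w by apply: ge_sup => //; exact: ubS.
have le_c0 z : f z - M * W z <= c0 by apply: ub_le_sup; [exact: hS.2|exists z].
have vV := vboundedV mV V1.
have vMV := vboundedZ (M * bet) vV.
pose g z := (M + c0) + (M * bet * V z - f z).
pose g' z := (M - c0) + (M * bet * V z + f z).
have vg := vboundedD (vbounded_cst V1 (M + c0)) (vboundedB vMV fc).
have vg' := vboundedD (vbounded_cst V1 (M - c0)) (vboundedD vMV fc).
have Qg z : iter s Pop g z = (M + c0) + (M * bet * iter s Pop V z - iter s Pop f z).
  rewrite /g (iter_PopD _ (vbounded_cst V1 (M + c0)) (vboundedB vMV fc)).
  by rewrite iter_cst (iter_PopB _ vMV fc) (iter_PopZ _ _ vV).
have Qg' z : iter s Pop g' z = (M - c0) + (M * bet * iter s Pop V z + iter s Pop f z).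
  rewrite /g' (iter_PopD _ (vbounded_cst V1 (M - c0)) (vboundedD vMV fc)).
  by rewrite iter_cst (iter_PopD _ vMV fc) (iter_PopZ _ _ vV).
have g0 z : 0 <= g z by rewrite /g; have := le_c0 z; rewrite /W; lra.
have g'0 z : 0 <= g' z by rewrite /g'; have := c0_le z; rewrite /W; lra.
have QV z : iter s Pop V z <= gam * V z + B.
  apply: le_trans (iter_V s z) _; rewrite lerD2r ler_wpM2r ?V_ge0//.
  by rewrite -(prednK s_gt0) exprS ler_piMr// exprn_ile1// ltW.
have MB0 : 0 <= M * bet by rewrite mulr_ge0// ltW.
have diff : iter s Pop f x - iter s Pop f y =
  2 * M + M * bet * (iter s Pop V x + iter s Pop V y) -
  (iter s Pop g x + iter s Pop g' y) by rewrite Qg Qg'; ring.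
have QVs : M * bet * (iter s Pop V x + iter s Pop V y) <= M * bet * (gam * (V x + V y) + 2 * B).
  by rewrite ler_wpM2l//; have := QV x; have := QV y; lra.
have Vx0 := V1 x; have Vy0 := V1 y.
rewrite diff.
have [/andP[xr yr]|] := boolP ((V x <= r) && (V y <= r)).
  pose G := [set z | M <= g z]; pose G' := [set z | M <= g' z].
  have mge h c1 : vbounded h c1 -> measurable [set z | M <= h z].
    move=> [mh _]; rewrite -[X in measurable X]setTI.
    have -> : [set z | M <= h z] = h @^-1` `[M, +oo[%classic.
      by apply/seteqP; split=> z /=; rewrite in_itv/= andbT.
    exact: mh.
  have mG : measurable G by exact: mge vg.
  have mG' : measurable G' by exact: mge vg'.
  (* Pointwise [g + g' = 2 * M * W >= 2 * M], so one of the two is at least [M]: the sets [G] and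
     [G'] cover the space, and together receive the full mass of [nu]. *)
  have GG : nuf setT <= nuf G + nuf G'.
    rewrite -lee_fin EFinD -!nufE//; apply: le_trans (measureU2 _ mG mG').
    apply: le_measure; rewrite ?inE//; first exact: measurableU.
    move=> z _; rewrite /G /G' /=; have [|h] := leP M (g z); first by left.
    right; have := V1 z; have : 0 <= M * bet * V z by rewrite mulr_ge0// V_ge0.
    by move: h; rewrite /g /g'; lra.
  have low h c1 z : vbounded h c1 -> (forall w, 0 <= h w) -> V z <= r ->
      M * (a * nuf [set w | M <= h w]) <= iter s Pop h z.
    move=> hc h0 zr; have mH := mge _ _ hc.
    have vH := vbounded_indic V1 mH.
    apply: le_trans (_ : M * iter s Pop \1_[set w | M <= h w] z <= _).
      by rewrite ler_wpM2l//; exact: minor.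
    have := le_iter s (vboundedZ M vH) hc _ z; rewrite (iter_PopZ _ _ vH); apply => w.
    have [hw|hw] := pselect ([set w | M <= h w] w).
      by rewrite indicE mem_set// mulr1.
    by rewrite indicE memNset// mulr0.
  have := low g _ x vg g0 xr; have := low g' _ y vg' g'0 yr.
  have : M * (a * nuf setT) <= M * (a * (nuf G + nuf G')) by rewrite !ler_wpM2l// ltW.
  rewrite -/G -/G' -/ep mulrDr mulrDr => e1 e2 e3.
  have m1 : M * (4 * bet * B) <= M * ep by rewrite ler_wpM2l.
  have m2 : M * del <= M * (ep / 4) by rewrite ler_wpM2l.
  have m3 : M * bet * (V x + V y) * del <= M * bet * (V x + V y) * ((1 - gam) / 4).
    by rewrite ler_wpM2l// mulr_ge0//; lra.
  have m4 : 0 <= M * bet * (V x + V y) * (1 - gam).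
    by rewrite mulr_ge0 ?(ltW g1)// mulr_ge0//; lra.
  by move: QVs e1 e2 e3 m1 m2 m3 m4; lra.
rewrite negb_and -!ltNge => xyr.
have Sr : r <= V x + V y by case/orP: xyr => /ltW h; lra.
have h1 : 0 <= iter s Pop g x by exact: iter_ge0.
have h2 : 0 <= iter s Pop g' y by exact: iter_ge0.
have rB : 4 * B <= (V x + V y) * (1 - gam).
  by rewrite -ler_pdivrMr//; apply: le_trans Sr; rewrite /r lerDl.
have m1 : M * bet * (4 * B) <= M * bet * ((V x + V y) * (1 - gam)) by rewrite ler_wpM2l.
have m2 : M * bet * (V x + V y) * del <= M * bet * (V x + V y) * ((1 - gam) / 4).
  by rewrite ler_wpM2l// mulr_ge0//; lra.
have m3 : M * del <= M * (bet * (1 - gam) / 8) by rewrite ler_wpM2l.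
have m4 : M * bet * (1 - gam) * 2 <= M * bet * (1 - gam) * (V x + V y).
  by apply: ler_wpM2l; [exact: mulr_ge0 MB0 (ltW g1)|lra].
have m5 : 0 <= M * bet * (1 - gam) by exact: mulr_ge0 MB0 (ltW g1).
by move: QVs h1 h2 m1 m2 m3 m4 m5; lra.
Qed.

Section Invariant.
Variable pi : probability X R.
Hypotheses (inv : invariant P pi) (piV : (\int[pi]_x (V x)%:E < +oo)%E).

Lemma Rintegral_probability_cst (a : R) : \int[pi]_x a = a.
Proof.
transitivity (a * fine (pi [set: X])); first exact: Rintegral_cst.
by rewrite probability_setT mulr1.
Qed.

Lemma invariant_Pop f c : vbounded f c -> \int[pi]_x Pop f x = \int[pi]_x f x.
Proof.
have pos g c' : vbounded g c' -> (forall x, 0 <= g x) -> \int[pi]_x Pop g x = \int[pi]_x g x.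
  move=> gc g0; rewrite /Rintegral; congr fine; have [mg _] := gc.
  rewrite [RHS](@ge0_integral_mixture _ _ _ _ _ _ _ pi pi id P _ _ _ (EFin \o g)).
  - by apply: eq_integral => x _; rewrite (EFin_Pop x gc).
  - exact: measurable_id.
  - by move=> U mU; exact: measurable_kernel.
  - by move=> A mA; rewrite inv.
  - by move=> z; rewrite lee_fin.
  - exact/measurable_EFinP.
move=> fc; have cV := vboundedZ c (vboundedV mV V1).
have fcV := vboundedD fc cV.
have h1 : \int[pi]_x Pop (fun y => f y + c * V y) x = \int[pi]_x (f x + c * V x).
  apply: (pos _ _ fcV) => x; have := fc.2 x.
  by rewrite ler_norml -subr_ge0 opprK => /andP[].
have h2 : \int[pi]_x Pop V x = \int[pi]_x V x.
  by apply: (pos _ _ (vboundedV mV V1)) => x; exact: V_ge0.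
move: h1; rewrite (PopD fc cV) (PopZ _ (vboundedV mV V1)) (vintD mV V1 piV fc cV).
have vPV := Pop_bound (vboundedV mV V1).
rewrite (vintD mV V1 piV (Pop_bound fc) (vboundedZ c vPV)).
rewrite (vintZ mV V1 piV _ vPV) (vintZ mV V1 piV _ (vboundedV mV V1)) h2.
exact: addIr.
Qed.

Lemma invariant_iter n f c : vbounded f c -> \int[pi]_x iter n Pop f x = \int[pi]_x f x.
Proof.
move=> fc; elim: n => //= n IHn; have [c' h] := iter_bound n fc.
by rewrite (invariant_Pop h).
Qed.

Lemma iter_growth n f c : 0 <= c -> vbounded f c ->
  vbounded (iter n Pop f) (c * (gam + b + 1) ^+ n).
Proof.
move=> c0 fc; have [gam0 _] := andP gam01; elim: n => [|n IHn]; first by rewrite expr0 mulr1.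
have G0 : 0 <= gam + b + 1 by rewrite !addr_ge0.
apply: (vbounded_le V1 (Pop_bound IHn)).
rewrite ger0_norm; last by rewrite mulr_ge0// exprn_ge0.
by rewrite exprSr mulrA ler_wpM2l ?lerDl// mulr_ge0// exprn_ge0.
Qed.

Lemma vbounded_ge0 f c : vbounded f c -> 0 <= c.
Proof.
move=> [_ /(_ point)]; have := V1 point; have := normr_ge0 (f point) => h0 h1 h2.
have : 0 <= c * V point by exact: le_trans h0 h2.
by rewrite pmulr_lge0// (lt_le_trans ltr01).
Qed.

Lemma bernoulli_le (x : R) n : 0 <= x <= 1 -> 1 - n%:R * x <= (1 - x) ^+ n.
Proof.
move=> /andP[x0 x1]; elim: n => [|n IHn]; first by rewrite mul0r subr0 expr0.
rewrite exprS; have := ler_wpM2l (_ : 0 <= 1 - x) IHn; rewrite subr_ge0 => /(_ x1).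
apply: le_trans; rewrite -natr1.
have : 0 <= n%:R * (x * x) by rewrite !mulr_ge0.
by lra.
Qed.

(** Integrating the contracted oscillation over the second point against [pi] gives the distance to
    the mean at multiples of [s]; the remaining fewer than [s] steps are bounded crudely by
    [iter_growth]. *)
Theorem geometric_ergodicity : exists K rho, [/\ 0 <= K, 0 <= rho < 1 &
  forall n f c x, vbounded f c ->
    `|iter n Pop f x - \int[pi]_y f y| <= K * rho ^+ n * (c * V x)].
Proof.
have [gam0 gam1] := andP gam01.
have [s [bet [kap [s0 bet0 /andP[kap0 kap1] osc]]]] := oscillation_contraction.
pose pV : R := \int[pi]_x V x.
have pV0 : 0 <= pV by apply: Rintegral_ge0 => x _; exact: V_ge0.
have sR : 0 < (s%:R : R) by rewrite ltr0n.
(* Bernoulli's inequality gives [(1 - y) ^+ s >= 1 - s * y = (1 + kap) / 2 >= kap], so [1 - y] can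
   serve as the rate in place of an [s]-th root of [kap]. *)
pose y : R := (1 - kap) / (2 * s%:R).
have y0 : 0 < y by rewrite divr_gt0 ?subr_gt0// mulr_gt0.
have sy : s%:R * y = (1 - kap) / 2 by rewrite /y; field; rewrite gt_eqF.
have y1 : y <= 2^-1.
  have : y <= s%:R * y by rewrite ler_peMl ?ler1n// ltW.
  by rewrite sy; lra.
pose rho := 1 - y.
have rho0 : 0 < rho by rewrite /rho; lra.
have rho1 : rho < 1 by rewrite /rho; lra.
have kaprho : kap <= rho ^+ s.
  by apply: le_trans (bernoulli_le s _); rewrite ?sy; last apply/andP; lra.
pose D := (2 + bet + bet * pV) / bet.
have D0 : 0 <= D by rewrite divr_ge0 ?(ltW bet0)// !addr_ge0// ?mulr_ge0// ltW.
pose G := gam + b + 1.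
have G1 : 1 <= G by rewrite lerDr addr_ge0.
have G0 : 0 <= G by exact: le_trans ler01 G1.
have mult j f c x : vbounded f c ->
    `|iter (j * s) Pop f x - \int[pi]_y f y| <= kap ^+ j * D * (c * V x).
  move=> fc; have c0 := vbounded_ge0 fc.
  (* The starting oscillation constant is [c / bet], because [c * (V x + V y)] is [c / bet] times
     the [V] part of the weight. *)
  have oscj : forall x y, `|iter (j * s) Pop f x - iter (j * s) Pop f y| <=
      kap ^+ j * (c / bet) * (2 + bet * (V x + V y)).
    elim: j => [|j IHj] x' y'.
      rewrite mul0n expr0 mul1r/=; apply: le_trans (ler_normB _ _) _.
      apply: le_trans (lerD (fc.2 x') (fc.2 y')) _.
      have q0 : 0 <= c / bet by rewrite divr_ge0// ltW.
      have cE : c = c / bet * bet by rewrite divfK// gt_eqF.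
      by rewrite {1 2}cE; lra.
    rewrite mulSn iterD exprS -!mulrA; have [c' h] := iter_bound (j * s) fc.
    rewrite !mulrA -[kap * _ * c]mulrA -[kap * _ / bet]mulrA; apply: (osc _ _ _ h).
      by rewrite divr_ge0 ?(ltW bet0)// mulr_ge0// exprn_ge0.
    by move=> x1 y1'; have := IHj x1 y1'; rewrite mulrA.
  have [c' h] := iter_bound (j * s) fc.
  rewrite -(invariant_iter (j * s) fc).
  have vx := vbounded_cst V1 (iter (j * s) Pop f x).
  have -> : iter (j * s) Pop f x - \int[pi]_y iter (j * s) Pop f y =
      \int[pi]_y (iter (j * s) Pop f x - iter (j * s) Pop f y).
    by rewrite (vintB mV V1 piV vx h) Rintegral_probability_cst.
  pose A := kap ^+ j * (c / bet).
  have A0 : 0 <= A by rewrite /A mulr_ge0 ?exprn_ge0// divr_ge0// ltW.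
  have vB := vboundedD (vbounded_cst V1 (A * (2 + bet * V x))) (vboundedZ (A * bet) (vboundedV mV V1)).
  have intB : \int[pi]_y (A * (2 + bet * V x) + A * bet * V y) = A * (2 + bet * V x) + A * bet * pV.
    rewrite (vintD mV V1 piV (vbounded_cst V1 (A * (2 + bet * V x))) (vboundedZ (A * bet) (vboundedV mV V1))).
    by rewrite Rintegral_probability_cst (vintZ mV V1 piV _ (vboundedV mV V1)).
  have vd := vboundedB vx h.
  have vd' := vboundedZ (-1) vd.
  have pw z : `|iter (j * s) Pop f x - iter (j * s) Pop f z| <= A * (2 + bet * V x) + A * bet * V z.
    by apply: le_trans (oscj x z) _; rewrite -/A; lra.
  have up : \int[pi]_y (iter (j * s) Pop f x - iter (j * s) Pop f y) <= A * (2 + bet * V x) + A * bet * pV.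
    rewrite -intB; apply: (le_vint mV V1 piV vd vB) => z.
    exact: le_trans (ler_norm _) (pw z).
  have dn : - (\int[pi]_y (iter (j * s) Pop f x - iter (j * s) Pop f y)) <= A * (2 + bet * V x) + A * bet * pV.
    rewrite -intB -mulN1r -(vintZ mV V1 piV _ vd); apply: (le_vint mV V1 piV vd' vB) => z.
    by rewrite mulN1r; apply: le_trans (pw z); rewrite -normrN ler_norm.
  have fin : A * (2 + bet * V x) + A * bet * pV <= kap ^+ j * D * (c * V x).
    have -> : kap ^+ j * D * (c * V x) = A * (2 + bet + bet * pV) * V x.
      by rewrite /A /D; field; rewrite gt_eqF.
    have h1 : 0 <= A * 2 * (V x - 1) by rewrite mulr_ge0 ?subr_ge0// mulr_ge0.
    have h2 : 0 <= A * bet * pV * (V x - 1).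
      by rewrite mulr_ge0 ?subr_ge0// mulr_ge0// mulr_ge0// ltW.
    have h3 : 0 <= A * bet by rewrite mulr_ge0// ltW.
    by move: h1 h2 h3; lra.
  rewrite ler_norml; apply/andP; split; last exact: le_trans up fin.
  by rewrite lerNl; exact: le_trans dn fin.
(* [G ^+ s] bounds the growth over the incomplete block, and [rho ^+ s] accounts for the decay not
   gained during it. *)
exists (D * G ^+ s / rho ^+ s), rho; split.
- by rewrite divr_ge0 ?exprn_ge0 ?(ltW rho0)// mulr_ge0// exprn_ge0.
- by rewrite rho1 ltW.
move=> n f c x fc; have c0 := vbounded_ge0 fc.
have rs : (n %% s <= s)%N by rewrite ltnW// ltn_mod.
rewrite {1}(divn_eq n s) iterD -(invariant_iter (n %% s) fc).
apply: le_trans (mult _ _ _ _ (iter_growth (n %% s) c0 fc)) _.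
have cV0 : 0 <= c * V x by rewrite mulr_ge0// V_ge0.
have rhos0 : 0 < rho ^+ s by exact: exprn_gt0.
have k1 : kap ^+ (n %/ s) * rho ^+ s <= rho ^+ n.
  rewrite {2}(divn_eq n s) exprD mulnC exprM ler_pM ?exprn_ge0 ?(ltW rho0)//.
    by rewrite lerXn2r ?nnegrE ?(ltW rhos0).
  by rewrite ler_wiXn2l// ltW.
have k2 : kap ^+ (n %/ s) <= rho ^+ n / rho ^+ s by rewrite ler_pdivlMr.
have g1 : G ^+ (n %% s) <= G ^+ s by rewrite ler_weXn2l.
have k3 : kap ^+ (n %/ s) * G ^+ (n %% s) <= rho ^+ n / rho ^+ s * G ^+ s.
  by apply: ler_pM => //; exact: exprn_ge0.
have := ler_wpM2l D0 (ler_wpM2r cV0 k3); rewrite -/G.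
by move=> h; apply: le_trans (le_trans _ h) _; rewrite le_eqVlt; apply/orP; left; apply/eqP; ring.
Qed.

End Invariant.
End Minorization.

End MarkovOperator.

(** * Bounded functions relative to a weight *)

Section Weight.
Context (R : realType) (d : measure_display) (X : measurableType d).

(** Bundling the two properties with the function lets the type [bfun V k] below carry its normed
    structure unconditionally. *)
Record weight := Weight {
  weight_fun :> X -> R;
  measurable_weight : measurable_fun setT weight_fun;
  weight_ge1 : forall x, 1 <= weight_fun x }.

Context (V : weight) (k : nat).
Local Notation V1 := (weight_ge1 V).

Definition vfun : {pred X -> 'cV[R]_k} := mem [set f : X -> 'cV[R]_k |
  (forall i, measurable_fun setT (fun x => f x i ord0)) /\
  exists c, forall x i, `|f x i ord0| <= c * V x].

Lemma vfunP (f : X -> 'cV[R]_k) : reflect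
  ((forall i, measurable_fun setT (fun x => f x i ord0)) /\
   exists c, forall x i, `|f x i ord0| <= c * V x) (f \in vfun).
Proof. by apply: (iffP idP) => [/set_mem|/mem_set]. Qed.

Lemma vfun_submod_closed : submod_closed vfun.
Proof.
split.
  have e0 x i : (0 : X -> 'cV[R]_k) x i ord0 = 0 by rewrite mxE.
  apply/vfunP; split=> [i|].
    rewrite (_ : (fun x => _) = cst 0); first exact: measurable_cst.
    by apply/funext => x; exact: e0.
  by exists 0 => x i; rewrite e0 normr0 mul0r.
move=> a f g /vfunP[mf [c fc]] /vfunP[mg [c' gc]]; apply/vfunP; split=> [i|].
  under eq_fun do rewrite !mxE.
  by apply: measurable_funD => //; apply: measurable_funM.
exists (`|a| * c + c') => x i; rewrite !mxE mulrDl; apply: (normD_le (V := R^o)) => //.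
by rewrite -mulrA normrM ler_wpM2l.
Qed.

HB.instance Definition _ := GRing.isSubmodClosed.Build R (X -> 'cV[R]_k) vfun vfun_submod_closed.

Record bfun := BFun { bfun_val :> X -> 'cV[R]_k; bfunP : bfun_val \in vfun }.

HB.instance Definition _ := [isSub for bfun_val].
HB.instance Definition _ := [Choice of bfun by <:].
HB.instance Definition _ := [SubChoice_isSubLmodule of bfun by <:].

(** This norm suits entrywise estimates. It is equivalent to the Euclidean one for fixed [k], and
    constant factors do not affect growth rates. *)
Definition l1norm (z : 'cV[R]_k) : R := \sum_i `|z i ord0|.

Lemma l1norm_ge0 z : 0 <= l1norm z.
Proof. exact: sumr_ge0. Qed.

Lemma l1normD y z : l1norm (y + z) <= l1norm y + l1norm z.
Proof.
by rewrite /l1norm -big_split/=; apply: ler_sum => i _; rewrite mxE ler_normD.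
Qed.

Lemma l1normZ a z : l1norm (a *: z) = `|a| * l1norm z.
Proof. by rewrite /l1norm mulr_sumr; apply: eq_bigr => i _; rewrite mxE normrM. Qed.

Lemma le_l1norm (z : 'cV[R]_k) i : `|z i ord0| <= l1norm z.
Proof. by rewrite /l1norm (bigD1 i)//= lerDl sumr_ge0. Qed.

Definition bnorm (f : bfun) : R := sup (range (fun x => l1norm (f x) / V x)).

Lemma V_gt0 x : 0 < V x.
Proof. exact: lt_le_trans ltr01 (V1 x). Qed.

Lemma bnorm_has_sup (f : bfun) : has_sup (range (fun x => l1norm (f x) / V x)).
Proof.
split; first by exists (l1norm (f point) / V point); exists point.
have /vfunP[_ [c fc]] := bfunP f; exists (k%:R * c) => _ [x _ <-].
rewrite ler_pdivrMr ?V_gt0//; apply: (@le_trans _ _ (\sum_(i < k) c * V x)).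
  by apply: ler_sum => i _; exact: fc.
by rewrite sumr_const card_ord -mulrA mulr_natl.
Qed.

Lemma l1norm_le_bnorm (f : bfun) x : l1norm (f x) <= bnorm f * V x.
Proof.
rewrite -ler_pdivrMr ?V_gt0//; apply: ub_le_sup; last by exists x.
exact: (bnorm_has_sup f).2.
Qed.

Lemma bnorm_le (f : bfun) c : (forall x, l1norm (f x) <= c * V x) -> bnorm f <= c.
Proof.
move=> fc; apply: ge_sup; first exact: (bnorm_has_sup f).1.
by move=> _ [x _ <-]; rewrite ler_pdivrMr ?V_gt0.
Qed.

Lemma bnorm_ge0 f : 0 <= bnorm f.
Proof.
have := le_trans (l1norm_ge0 _) (l1norm_le_bnorm f point).
by rewrite pmulr_lge0// V_gt0.
Qed.

Lemma bfun_eq (f g : bfun) : (forall x, f x = g x) -> f = g.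
Proof. by move=> fg; apply: val_inj; apply/funext. Qed.

Lemma bnormD f g : bnorm (f + g) <= bnorm f + bnorm g.
Proof.
apply: bnorm_le => x; rewrite mulrDl (le_trans (l1normD _ _))// lerD//;
  exact: l1norm_le_bnorm.
Qed.

Lemma bnormZ a f : bnorm (a *: f) = `|a| * bnorm f.
Proof.
have le b g : bnorm (b *: g) <= `|b| * bnorm g.
  apply: bnorm_le => x; rewrite l1normZ -mulrA ler_wpM2l//; exact: l1norm_le_bnorm.
apply/eqP; rewrite eq_le le/=; have [->|a0] := eqVneq a 0.
  by rewrite normr0 mul0r bnorm_ge0.
rewrite -ler_pdivlMl ?normr_gt0// -normfV.
by apply: le_trans (le a^-1 _); rewrite scalerA mulVf// scale1r.
Qed.

Lemma bnorm0_eq0 f : bnorm f = 0 -> f = 0.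
Proof.
move=> f0; apply: bfun_eq => x; apply/matrixP => i j; rewrite !mxE ord1.
apply/eqP; rewrite -normr_le0.
by apply: le_trans (le_l1norm _ _) _; have := l1norm_le_bnorm f x; rewrite f0 mul0r.
Qed.

HB.instance Definition _ := @Lmodule_isNormed.Build R bfun bnorm bnormD bnormZ bnorm0_eq0.

Lemma bfun_normE (f : bfun) : `|f| = bnorm f.
Proof. by []. Qed.

(** A sequence picked from balls of radius [n.+1%:R^-1] in the filter converges entrywise, uniformly
    relative to [V]. Taking a sequence keeps the limit measurable. *)
Lemma bfun_complete (F : set_system bfun) : ProperFilter F -> cauchy F -> cvg F.
Proof.
move=> PF /cauchyP cF.
have invS_gt0 (n : nat) : 0 < n.+1%:R^-1 :> R by rewrite invr_gt0.
have /choice[u uP] (n : nat) : exists f : bfun, F (ball f n.+1%:R^-1) by exact: cF.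
have uu n m : `|u n - u m| <= n.+1%:R^-1 + m.+1%:R^-1.
  have [g []] := filter_ex (filterI (uP n) (uP m)).
  rewrite -!ball_normE/= => ng mg; rewrite -(subrK g (u n)) -addrA.
  by apply: normD_le; [exact: ltW|rewrite distrC ltW].
have comp_le (f g : bfun) x i : `|f x i ord0 - g x i ord0| <= `|f - g| * V x.
  rewrite bfun_normE; apply: le_trans (l1norm_le_bnorm (f - g) x).
  by have := le_l1norm ((f - g) x) i; rewrite !mxE.
have cvgu x i : cvgn (fun n => u n x i ord0).
  apply/cauchy_cvgP/cauchyP => e e0.
  have eV : 0 < e / V x / 2 by rewrite !divr_gt0// V_gt0.
  have [N _ HN] : \forall n \near \oo, n.+1%:R^-1 < e / V x / 2.
    by have /cvgr_lt := @cvg_harmonic R; apply.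
  exists (u N x i ord0); exists N => // n Nn; rewrite -ball_normE/=.
  apply: le_lt_trans (comp_le _ _ _ _) _; rewrite -ltr_pdivlMr ?V_gt0//.
  apply: le_lt_trans (uu N n) _; rewrite [e / V x]splitr.
  by apply: ltrD; apply: HN => /=.
pose l x : 'cV[R]_k := \col_i (limn (fun n => u n x i ord0)).
have lu n x i : `|l x i ord0 - u n x i ord0| <= n.+1%:R^-1 * V x.
  rewrite mxE.
  have c1 : (fun m => `|u m x i ord0 - u n x i ord0|) @ \oo -->
      `|limn (fun n => u n x i ord0) - u n x i ord0|.
    by apply: cvg_norm; apply: cvgB; [exact: cvgu|exact: cvg_cst].
  have c2 : (fun m => (m.+1%:R^-1 + n.+1%:R^-1) * V x) @ \oo --> (0 + n.+1%:R^-1) * V x.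
    by apply: cvgMr_tmp; apply: cvgD; [exact: cvg_harmonic|exact: cvg_cst].
  rewrite add0r in c2; apply: ler_cvg_to c1 c2 _; near=> m.
  by apply: le_trans (comp_le _ _ _ _) _; rewrite ler_wpM2r ?uu// ltW// V_gt0.
have lV : l \in vfun.
  apply/vfunP; split=> [i|].
    apply: (@measurable_fun_cvg _ _ _ setT (fun n x => u n x i ord0)).
      by move=> n; have /vfunP[] := bfunP (u n).
    by move=> x _; rewrite mxE; exact: cvgu.
  have /vfunP[_ [c uc]] := bfunP (u 0); exists (1 + c) => x i.
  rewrite -(subrK (u 0 x i ord0) (l x i ord0)) mulrDl; apply: (normD_le (V := R^o)) => //.
  by have := lu 0 x i; rewrite invr1.
apply/cvg_ex; exists (BFun lV); apply/cvgrPdist_le => e e0.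
have k1 : 0 < k%:R + 1 :> R by rewrite ltr_wpDl.
have [N _ HN] : \forall n \near \oo, n.+1%:R^-1 < e / (k%:R + 1).
  by have /cvgr_lt := @cvg_harmonic R; apply; rewrite divr_gt0.
have {}HN : k%:R * N.+1%:R^-1 + N.+1%:R^-1 <= e.
  by have := ltW (HN N (leqnn N)); rewrite ler_pdivlMr// mulrDr mulr1 mulrC.
apply: filterS (uP N) => g; rewrite -ball_normE/= => /ltW uNg.
apply: le_trans HN; rewrite -(subrK (u N) (BFun lV)) -addrA.
apply: normD_le => //; rewrite bfun_normE; apply: bnorm_le => x.
apply: (@le_trans _ _ (\sum_(i < k) N.+1%:R^-1 * V x)).
  by apply: ler_sum => i _; have := lu N x i; rewrite !mxE.
by rewrite sumr_const card_ord -mulrA mulr_natl.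
Unshelve. all: by end_near. Qed.

HB.instance Definition _ := Uniform_isComplete.Build bfun bfun_complete.

End Weight.

(** * Diagonalization of a matrix with real distinct eigenvalues *)

Lemma row_mul_diag_mx (R : realType) k (D : 'rV[R]_k) (W : 'M[R]_k) j :
  row j (diag_mx D *m W) = D 0 j *: row j W.
Proof. by apply/rowP => a; rewrite mul_diag_mx !mxE. Qed.

Section Diagonalization.
Context {R : realType} {k : nat} (A : 'M[R]_k).

(** The rows of [W] are left eigenvectors, so that the columns of its inverse are right ones and the
    two families are dual. Independence is the directness of the sum of eigenspaces. *)
Lemma real_distinct_diagonalization : real_distinct_eigenvalues A ->
  exists (W : 'M[R]_k) (D : 'rV[R]_k),
    [/\ W \in unitmx, W *m A = diag_mx D *m W & injective (D ord0)].
Proof.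
move=> [s us sE].
have ss : size s = k by have := size_char_poly A; rewrite sE size_prod_XsubC => -[].
pose D : 'rV[R]_k := \row_j s`_j.
have Dinj : injective (D ord0).
  move=> i j; rewrite !mxE => /eqP; rewrite nth_uniq ?ss// => /eqP ij.
  exact: val_inj.
have /choice[v vP] (j : 'I_k) : exists v : 'rV[R]_k, v *m A = D 0 j *: v /\ v != 0.
  have /eigenvalueP[v vA v0] : eigenvalue A (D 0 j).
    by rewrite eigenvalue_root_char sE root_prod_XsubC mxE mem_nth// ss.
  by exists v.
pose W : 'M[R]_k := \matrix_j v j.
have WA : W *m A = diag_mx D *m W.
  apply/row_matrixP => j; rewrite row_mul rowK (vP j).1.
  by rewrite row_mul_diag_mx rowK.
exists W, D; split => //.
rewrite -row_free_unit -kermx_eq0; apply/eqP/row_matrixP => l; rewrite row0.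
set u := row l _; have uW : u *m W = 0 by apply/sub_kermxP; exact: row_sub.
have /mxdirect_sumsP dir := @mxdirect_sum_eigenspace _ _ _ A predT (D 0) (fun i j _ _ => @Dinj i j).
apply/rowP => i; rewrite [RHS]mxE.
have veig j : (v j <= eigenspace A (D 0 j))%MS by apply/eigenspaceP; exact: (vP j).1.
have uW' : \sum_j u 0 j *: v j = 0.
  by rewrite -[RHS]uW mulmx_sum_row; apply: eq_bigr => j _; rewrite rowK.
have uv : u 0 i *: v i = - \sum_(j | j != i) u 0 j *: v j.
  by move: uW'; rewrite (bigD1 i)//= => /eqP; rewrite addr_eq0 => /eqP.
have : (u 0 i *: v i <= eigenspace A (D 0 i) :&:
    (\sum_(j | predT j && (j != i)) eigenspace A (D 0 j)))%MS.
  rewrite sub_capmx scalemx_sub//=; rewrite uv.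
  rewrite eqmx_opp; apply: summx_sub => j ji.
  by rewrite scalemx_sub// (submx_trans (veig j))// (sumsmx_sup j).
rewrite dir// submx0 scaler_eq0 => /orP[/eqP//|]; by rewrite (negbTE (vP i).2).
Qed.

Variables (W : 'M[R]_k) (D : 'rV[R]_k).
Hypotheses (Wu : W \in unitmx) (WA : W *m A = diag_mx D *m W) (Dinj : injective (D ord0)).

Lemma diag_eigenvalue j : eigenvalue A (D 0 j).
Proof.
apply/eigenvalueP; exists (row j W).
  by rewrite -row_mul WA row_mul_diag_mx.
apply/negP => /eqP r0; have : row_free W by rewrite row_free_unit.
move=> /row_freeP[B WB]; have : row j (W *m B) = 0 by rewrite row_mul r0 mul0mx.
rewrite WB => /rowP/(_ j); rewrite !mxE eqxx => /eqP; by rewrite oner_eq0.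
Qed.

Lemma AW : A *m invmx W = invmx W *m diag_mx D.
Proof. by rewrite -[A](mulKmx Wu) WA mulmxA mulmxK. Qed.

Lemma eigenvalue_diag a : eigenvalue A a -> exists j, D 0 j = a.
Proof.
move=> /eigenvalueP[v vA v0].
have vW : (v *m invmx W) *m diag_mx D = a *: (v *m invmx W).
  by rewrite -mulmxA -AW mulmxA vA scalemxAl.
have w0 : v *m invmx W != 0.
  apply: contra v0 => /eqP h; rewrite -[v](mulmxKV Wu) h mul0mx; exact: eqxx.
have [j wj] : exists j, (v *m invmx W) 0 j != 0.
  apply: contrapT => /forallNP h; move/negP: w0; apply; apply/eqP/rowP => j.
  by rewrite [RHS]mxE; apply/eqP; have /negP := h j; rewrite negbK.
exists j; have /rowP/(_ j) := vW; rewrite mul_mx_diag !mxE => h.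
move: wj; rewrite mxE => wj; move: h; rewrite mulrC; exact: mulIf.
Qed.

(** Simplicity of the eigenvalue: in the coordinates of [W] all other entries vanish. This brings
    arbitrary eigenvectors [r0] and [v0] back to the chosen dual bases. *)
Lemma right_eigenvector_diag (r : 'cV[R]_k) i : A *m r = D 0 i *: r ->
  exists a, r = a *: col i (invmx W).
Proof.
move=> Ar; exists ((W *m r) i 0).
have Wr : diag_mx D *m (W *m r) = D 0 i *: (W *m r).
  by rewrite mulmxA -WA -mulmxA Ar scalemxAr.
have Wr0 j : j != i -> (W *m r) j 0 = 0.
  move=> ji; have /matrixP/(_ j 0) := Wr; rewrite mul_diag_mx !mxE => /eqP.
  rewrite -subr_eq0 -mulrBl mulf_eq0 subr_eq0 => /orP[/eqP/Dinj ij|/eqP//].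
  by rewrite ij eqxx in ji.
rewrite -[LHS](mulKmx Wu) -[_ *m (W *m r)]trmxK.
apply/colP => a; rewrite !mxE (bigD1 i)//= big1 ?addr0; first by rewrite mulrC !mxE.
by move=> j ji; have := Wr0 j ji; rewrite !mxE => ->; rewrite mulr0.
Qed.

Lemma left_eigenvector_diag (v : 'cV[R]_k) i : v^T *m A = D 0 i *: v^T ->
  exists a, v = a *: (row i W)^T.
Proof.
move=> vA; exists ((v^T *m invmx W) 0 i).
have vW : (v^T *m invmx W) *m diag_mx D = D 0 i *: (v^T *m invmx W).
  by rewrite -mulmxA -AW mulmxA vA scalemxAl.
have vW0 j : j != i -> (v^T *m invmx W) 0 j = 0.
  move=> ji; have /matrixP/(_ 0 j) := vW; rewrite mul_mx_diag !mxE => /eqP.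
  rewrite mulrC -subr_eq0 -mulrBl mulf_eq0 subr_eq0 => /orP[/eqP/Dinj ij|/eqP//].
  by rewrite ij eqxx in ji.
apply: trmx_inj; rewrite -[LHS](mulmxKV Wu).
apply/rowP => a; rewrite !mxE (bigD1 i)//= big1 ?addr0; first by rewrite !mxE.
by move=> j ji; have := vW0 j ji; rewrite !mxE => ->; rewrite mul0r.
Qed.

End Diagonalization.

(** * The transition operator and multiplication on the weighted space *)

Section BoundedFunctions.
Context {R : realType} {d : measure_display} {X : measurableType d}.
Variables (V : weight R X) (k : nat).
Local Notation mV := (measurable_weight V).
Local Notation V1 := (weight_ge1 V).
Local Notation E := (bfun V k).

Definition entry (f : X -> 'cV[R]_k) (i : 'I_k) (x : X) : R := f x i ord0.

Lemma vbounded_entry (f : E) i : vbounded V (entry f i) `|f|.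
Proof.
split; first by have /vfunP[+ _] := bfunP f; apply.
by move=> x; apply: le_trans (le_l1norm _ _) (l1norm_le_bnorm f x).
Qed.

Lemma vfun_col (g : 'I_k -> X -> R) : (forall i, exists c, vbounded V (g i) c) ->
  (fun x => \col_i g i x) \in @vfun R d X V k.
Proof.
move=> /choice[c gc]; apply/vfunP; split=> [i|].
  by under eq_fun do rewrite mxE; exact: (gc i).1.
exists (\sum_i c i) => x i; rewrite mxE; apply: le_trans ((gc i).2 x) _.
rewrite ler_wpM2r ?(le_trans ler01 (V1 x))//.
rewrite (bigD1 i)//= lerDl; apply: sumr_ge0 => j _.
have := (gc j).2 x => /(le_trans (normr_ge0 _)); rewrite pmulr_lge0//.
exact: lt_le_trans ltr01 (V1 x).
Qed.

Lemma bfun_norm_le (f : E) c : (forall i, vbounded V (entry f i) c) -> `|f| <= k%:R * c.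
Proof.
move=> fc; rewrite bfun_normE; apply: bnorm_le => x.
apply: (@le_trans _ _ (\sum_(i < k) c * V x)).
  by apply: ler_sum => i _; exact: (fc i).2.
by rewrite sumr_const card_ord -mulrA mulr_natl.
Qed.

Lemma bfun_const_in (w : 'cV[R]_k) : (fun=> w) \in @vfun R d X V k.
Proof.
have -> : (fun=> w) = (fun x : X => \col_i cst (w i ord0) x).
  by apply/funext => x; apply/colP => i; rewrite mxE.
by apply: vfun_col => i; eexists; exact: (vbounded_cst V1).
Qed.

Definition bconst (w : 'cV[R]_k) : E := BFun (bfun_const_in w).

Lemma bconst_linear : linear bconst.
Proof. by move=> a v w; apply: bfun_eq => x. Qed.
HB.instance Definition _ := GRing.isLinear.Build R 'cV[R]_k E _ bconst bconst_linear.

Section Multiplication.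
Variable m : X -> 'M[R]_k.
Hypothesis mb : bounded_measurable_mx m.

Definition mulT (f : X -> 'cV[R]_k) (x : X) : 'cV[R]_k := (m x)^T *m f x.

Lemma vbounded_entry_mul : exists2 B, 0 <= B & forall (f : E) i j,
  vbounded V (fun x => m x j i * f x j ord0) (B * `|f|).
Proof.
have [mm [B mB]] := mb; exists `|B| => // f i j.
apply: vboundedM => //; last exact: vbounded_entry.
by move=> x; exact: le_trans (mB x j i) (ler_norm B).
Qed.

Lemma entry_mulT (f : X -> 'cV[R]_k) i :
  entry (mulT f) i = (fun x => \sum_j m x j i * f x j ord0).
Proof.
by apply/funext => x; rewrite /entry /mulT mxE; apply: eq_bigr => j _; rewrite mxE.
Qed.

Lemma vbounded_mulT : exists2 B, 0 <= B & forall (f : E) i,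
  vbounded V (entry (mulT f) i) (B * `|f|).
Proof.
have [B B0 hB] := vbounded_entry_mul; exists (k%:R * B); first by rewrite mulr_ge0.
move=> f i; rewrite entry_mulT.
have := vbounded_sum V1 (index_enum 'I_k) (fun j => hB f i j).
by rewrite sumr_const card_ord -mulrA mulr_natl.
Qed.

Lemma mulT_in (f : E) : mulT f \in @vfun R d X V k.
Proof.
have [B B0 hB] := vbounded_mulT.
have -> : mulT f = (fun x => \col_i entry (mulT f) i x).
  by apply/funext => x; apply/colP => i; rewrite mxE.
by apply: vfun_col => i; eexists; exact: hB.
Qed.

Definition bmulT (f : E) : E := BFun (mulT_in f).

Lemma bmulT_linear : linear bmulT.
Proof. by move=> a f g; apply: bfun_eq => x; rewrite /= /mulT mulmxDr -scalemxAr. Qed.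
HB.instance Definition _ := GRing.isLinear.Build R E E _ bmulT bmulT_linear.

Lemma bmulT_bounded : exists2 B, 0 <= B & forall f, `|bmulT f| <= B * `|f|.
Proof.
have [B B0 hB] := vbounded_mulT; exists (k%:R * B); first by rewrite mulr_ge0.
by move=> f; rewrite -mulrA; apply: bfun_norm_le => i; exact: hB.
Qed.

End Multiplication.

Section Kernel.
Variables (P : R.-pker X ~> X) (gam b : R) (C : set X).
Hypotheses (gam0 : 0 <= gam) (b0 : 0 <= b).
Hypothesis drift : forall x, (\int[P x]_y (V y)%:E <= (gam * V x + b * \1_C x)%:E)%E.

Definition Pcol (f : X -> 'cV[R]_k) (x : X) : 'cV[R]_k := \col_i Pop P (entry f i) x.

Lemma entry_Pcol f i : entry (Pcol f) i = Pop P (entry f i).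
Proof. by apply/funext => x; rewrite /entry mxE. Qed.

Lemma Pcol_in (f : E) : Pcol f \in @vfun R d X V k.
Proof.
apply: vfun_col => i; eexists; exact: (Pop_bound mV V1 b0 drift (vbounded_entry f i)).
Qed.

Definition bP (f : E) : E := BFun (Pcol_in f).

Lemma bP_linear : linear bP.
Proof.
move=> a f g; apply: bfun_eq => x; apply/colP => i; rewrite !mxE.
have fi := vbounded_entry f i; have gi := vbounded_entry g i.
have := congr1 (@^~ x) (PopD mV V1 drift (vboundedZ a fi) gi).
rewrite /= (PopZ mV V1 drift _ fi) => <-; congr (Pop P _ x).
by apply/funext => y; rewrite /entry !mxE.
Qed.
HB.instance Definition _ := GRing.isLinear.Build R E E _ bP bP_linear.

Lemma bP_bounded f : `|bP f| <= k%:R * (gam + b) * `|f|.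
Proof.
rewrite -mulrA; apply: bfun_norm_le => i; rewrite /= entry_Pcol [_ * `|f|]mulrC.
by have := Pop_bound mV V1 b0 drift (vbounded_entry f i); rewrite normr_id.
Qed.

Lemma entry_iter_bP n f i : entry (iter n bP f) i = iter n (Pop P) (entry f i).
Proof. by elim: n => //= n IHn; rewrite entry_Pcol IHn. Qed.

Lemma bP_const w : bP (bconst w) = bconst w.
Proof.
apply: bfun_eq => x; apply/colP => i; rewrite mxE.
by rewrite (_ : entry _ i = fun=> w i ord0)// Pop_cst.
Qed.

Section Mean.
Variable pi : probability X R.

(* [piV] is a parameter so that the canonical linear structure below, whose
   proof needs it, can be inferred from the term. *)
Definition pmean (piV : (\int[pi]_x (V x)%:E < +oo)%E) (f : E) : 'cV[R]_k :=
  \col_i \int[pi]_x entry f i x.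

Hypotheses (inv : invariant P pi) (piV : (\int[pi]_x (V x)%:E < +oo)%E).

Lemma pmean_linear : linear (pmean piV).
Proof.
move=> a f g; apply/colP => i; rewrite !mxE.
have fi := vbounded_entry f i; have gi := vbounded_entry g i.
rewrite -(vintZ mV V1 piV _ fi) -(vintD mV V1 piV (vboundedZ a fi) gi).
by apply: eq_Rintegral => x _; rewrite /entry !mxE.
Qed.
HB.instance Definition _ := GRing.isLinear.Build R E 'cV[R]_k _ (pmean piV) pmean_linear.

Lemma pmean_const w : pmean piV (bconst w) = w.
Proof. by apply/colP => i; rewrite mxE Rintegral_probability_cst. Qed.

Lemma pmean_P f : pmean piV (bP f) = pmean piV f.
Proof.
apply/colP => i; rewrite !mxE -(invariant_Pop mV V1 b0 drift inv piV (vbounded_entry f i)).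
by apply: eq_Rintegral => x _; rewrite /= entry_Pcol.
Qed.

Lemma pmean_bounded f i : `|pmean piV f i ord0| <= `|f| * \int[pi]_x V x.
Proof. by rewrite mxE; exact: (norm_vint_le mV V1 piV (vbounded_entry f i)). Qed.

Definition mfunctional (a : 'cV[R]_k) (f : E) : R^o := (a^T *m pmean piV f) ord0 ord0.

Lemma mfunctional_linear a : linear (mfunctional a).
Proof.
by move=> s f g; rewrite /mfunctional linearP mulmxDr -scalemxAr mxE [in LHS]mxE.
Qed.
HB.instance Definition _ a :=
  GRing.isLinear.Build R E R^o _ (mfunctional a) (mfunctional_linear a).

Lemma mfunctionalE a f : mfunctional a f = \sum_i a i ord0 * pmean piV f i ord0.
Proof. by rewrite /mfunctional mxE; apply: eq_bigr => i _; rewrite mxE. Qed.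

Lemma mfunctional_bounded a f :
  `|mfunctional a f| <= (l1norm a * \int[pi]_x V x) * `|f|.
Proof.
rewrite mfunctionalE (le_trans (ler_norm_sum _ _ _))// -mulrA mulr_suml.
apply: ler_sum => i _; rewrite normrM ler_wpM2l// mulrC.
exact: pmean_bounded.
Qed.

Variable m : X -> 'M[R]_k.
Hypothesis mb : bounded_measurable_mx m.

Lemma pmean_mulT_const w : pmean piV (bmulT mb (bconst w)) = (mean_mx pi m)^T *m w.
Proof.
have [mm [B mB]] := mb.
apply/colP => i; rewrite !mxE.
have e j : vbounded V (fun x => m x j i) `|B|.
  split => // x; apply: le_trans (mB x j i) _.
  by apply: le_trans (ler_norm B) _; rewrite ler_peMr// V1.
transitivity (\int[pi]_x \sum_j w j ord0 * m x j i).
  by apply: eq_Rintegral => x _; rewrite /= entry_mulT; apply: eq_bigr => j _; rewrite mulrC.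
rewrite (vint_sum mV V1 piV _ (fun j => vboundedZ (w j ord0) (e j))).
by apply: eq_bigr => j _; rewrite (vintZ mV V1 piV _ (e j)) !mxE mulrC.
Qed.

(** On constants, removing the mean of the image amounts to centring the matrix; this is how
    [M - Mbar] enters the second derivative. *)
Lemma bmulT_centered mb' w : bmulT (m := fun x => m x - mean_mx pi m) mb' (bconst w) =
  bmulT mb (bconst w) - bconst (pmean piV (bmulT mb (bconst w))).
Proof.
by apply: bfun_eq => x; rewrite pmean_mulT_const /= /mulT linearB/= mulmxBl.
Qed.

End Mean.
End Kernel.
End BoundedFunctions.

(** * The perturbation theorem for the chain *)

Section Correlation.
Context {R : realType} {d : measure_display} {X : measurableType d} {k : nat}.
Variables (P : R.-pker X ~> X) (pi : probability X R) (m : X -> 'M[R]_k).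

(** For the stationary chain this is the mean of [v^T (M_(n+1) - Mbar) (M_0 - Mbar) r], with [j] the
    inner index of the product. The later factor stands on the left, as in the iterates of [Lop]. *)
Definition correlation (n : nat) (v r : 'cV[R]_k) : R :=
  \sum_j \int[pi]_x (((m x - mean_mx pi m) *m r) j ord0 *
    iter n.+1 (Pop P) (fun y => ((m y - mean_mx pi m)^T *m v) j ord0) x).

End Correlation.

Section ChainPerturbation.
Context {R : realType} {d : measure_display} {X : measurableType d} {k : nat}.
Variables (V : weight R X) (P : R.-pker X ~> X) (gam b : R) (C : set X).
Local Notation mV := (measurable_weight V).
Local Notation V1 := (weight_ge1 V).
Local Notation E := (bfun V k).
Hypotheses (gam01 : 0 <= gam < 1) (b0 : 0 <= b) (mC : measurable C).
Hypothesis drift : forall x, (\int[P x]_y (V y)%:E <= (gam * V x + b * \1_C x)%:E)%E.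
Variables (t0 : nat) (nu : {measure set X -> \bar R}).
Hypotheses (t0_gt0 : (0 < t0)%N) (nu0 : nu setT != 0%E).
Hypothesis irr : irreducible_aperiodic P.
Hypothesis small : forall x A, C x -> measurable A -> (nu A <= kernel_iter P t0 x A)%E.
Variable pi : probability X R.
Hypotheses (inv : invariant P pi) (piV : (\int[pi]_x (V x)%:E < +oo)%E).
Variable m : X -> 'M[R]_k.
Hypothesis mb : bounded_measurable_mx m.
Local Notation Mbar := (mean_mx pi m).

Let gam0 : 0 <= gam. Proof. by case/andP: gam01. Qed.

Local Notation bPop := (bP (V := V) (k := k) b0 drift).

Definition bN : {linear E -> E} := bPop \o bmulT mb.

Lemma bNE f : bN f = bPop (bmulT mb f). Proof. by []. Qed.

Lemma centered_bounded : bounded_measurable_mx (fun x => m x - Mbar).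
Proof.
have [mm [B mB]] := mb; split=> [i j|].
  by under eq_fun do rewrite !mxE; exact: measurable_funB.
exists (B + \sum_i \sum_j `|Mbar i j|) => x i j; rewrite !mxE.
apply: (normB_le (V := R^o)); first exact: mB.
rewrite [leRHS](bigD1 i)//= [X in _ <= X + _](bigD1 j)//= -addrA mxE lerDl addr_ge0//.
  exact: sumr_ge0.
by apply: sumr_ge0 => l _; exact: sumr_ge0.
Qed.

Section Dual.
Variables (W : 'M[R]_k) (D : 'rV[R]_k) (i0 : 'I_k).
Hypotheses (Wu : W \in unitmx) (WA : W *m Mbar = diag_mx D *m W).

(** The compression of [bN] to constants is the transpose of [Mbar]: its eigenvectors are the left
    eigenvectors of [Mbar], and the dual functionals come from the right ones. *)
Definition dual_fun (i : 'I_k) : {linear E -> R^o} :=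
  mfunctional piV (col i (invmx W)).
Definition dual_vec (i : 'I_k) : E := bconst V (row i W)^T.

Lemma dual_fun_const i w : dual_fun i (bconst V w) = ((col i (invmx W))^T *m w) ord0 ord0.
Proof. by rewrite /dual_fun/= /mfunctional pmean_const. Qed.

Lemma dual_fun_vec i j : dual_fun i (dual_vec j) = (i == j)%:R.
Proof.
rewrite dual_fun_const -trmx_mul mxE.
have -> : row j W *m col i (invmx W) = \matrix_(_, _) (W *m invmx W) j i.
  by apply/matrixP => a c; rewrite !ord1 !mxE; apply: eq_bigr => l _; rewrite !mxE.
by rewrite mulmxV// !mxE eq_sym.
Qed.

Lemma proj_dual f : proj dual_fun dual_vec f = bconst V (pmean piV f).
Proof.
have -> : proj dual_fun dual_vec f =
    bconst V (\sum_i dual_fun i f *: (row i W)^T).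
  by rewrite linear_sum; apply: eq_bigr => i _; rewrite linearZ.
congr (bconst V _).
have -> : \sum_i dual_fun i f *: (row i W)^T = W^T *m ((invmx W)^T *m pmean piV f).
  apply/colP => a; rewrite summxE mxE; apply: eq_bigr => i _.
  rewrite !mxE mulrC; congr (_ * _); rewrite /dual_fun/= /mfunctional !mxE.
  by apply: eq_bigr => l _; rewrite !mxE.
by rewrite mulmxA -trmx_mul mulVmx// trmx1 mul1mx.
Qed.

Lemma dual_fun_P i f : dual_fun i (bPop f) = dual_fun i f.
Proof. by rewrite /dual_fun/= /mfunctional pmean_P. Qed.

Lemma dual_fun_N i j : dual_fun i (bN (dual_vec j)) = (i == j)%:R * D ord0 j.
Proof.
rewrite bNE dual_fun_P /dual_fun/= /mfunctional pmean_mulT_const// -trmx_mul -row_mul WA.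
rewrite row_mul_diag_mx linearZ/= -scalemxAr mxE mulrC; congr (_ * _).
by rewrite -dual_fun_const dual_fun_vec.
Qed.

Lemma mfunctional_mul (r : 'cV[R]_k) (u : E) :
  mfunctional piV r (bmulT mb u) = \sum_j \int[pi]_x ((m x *m r) j ord0 * entry u j x).
Proof.
rewrite mfunctionalE; have [B B0 hB] := vbounded_entry_mul V mb.
transitivity (\sum_i \sum_j \int[pi]_x (r i ord0 * (m x j i * u x j ord0))).
  apply: eq_bigr => i _; rewrite mxE.
  rewrite (_ : entry _ i = fun x => \sum_j m x j i * u x j ord0); last exact: entry_mulT.
  rewrite (vint_sum mV V1 piV _ (hB u i)) mulr_sumr; apply: eq_bigr => j _.
  by rewrite (vintZ mV V1 piV _ (hB u i j)).
rewrite exchange_big; apply: eq_bigr => j _ /=.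
rewrite -(vint_sum mV V1 piV _ (fun i => vboundedZ (r i ord0) (hB u i j))).
apply: eq_Rintegral => x _; rewrite mxE mulr_suml; apply: eq_bigr => i _.
by rewrite /entry; ring.
Qed.

(** [coproj] centres the inner factor, and the [P] inside that [bN] raises the exponent to [n.+1].
    The [P] of the outer [bN] disappears under the invariant measure. *)
Lemma dual_resolvent_term n :
  dual_fun i0 (bN (resolvent_term bPop dual_fun dual_vec (bN (dual_vec i0)) n)) =
  correlation P pi m n (row i0 W)^T (col i0 (invmx W)).
Proof.
rewrite /resolvent_term.
have -> : coproj dual_fun dual_vec (bN (dual_vec i0)) =
    bPop (bmulT centered_bounded (dual_vec i0)).
  rewrite /coproj proj_dual bNE pmean_P// bmulT_centered linearB/= bP_const//.
rewrite -iterSr; set g := bmulT _ _; set u := iter n.+1 _ _.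
rewrite bNE dual_fun_P.
transitivity (\sum_j \int[pi]_x ((m x *m col i0 (invmx W)) j ord0 * entry u j x)).
  exact: mfunctional_mul.
apply: eq_bigr => j _.
have uE : entry u j = iter n.+1 (Pop P) (fun y => ((m y - Mbar)^T *m (row i0 W)^T) j ord0).
  exact: entry_iter_bP.
rewrite -uE.
(* [u] has mean zero, so the outer factor [m] may be centred as well at no cost. *)
have mean0 : \int[pi]_x entry u j x = 0.
  have := pmean_const piV (0 : 'cV[R]_k).
  have pu : pmean piV u = pmean piV g.
    by rewrite /u; elim: n.+1 => //= n' <-; rewrite pmean_P.
  move=> _; have /colP/(_ j) := pu; rewrite !mxE => ->.
  have /colP/(_ j) : pmean piV g = 0.
    by rewrite /g bmulT_centered linearB/= pmean_const subrr.
  by rewrite !mxE.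
have uj := vbounded_entry u j.
have [B B0 hB] := vbounded_entry_mul V mb.
set r := col i0 _.
have mr : vbounded V (fun x => (m x *m r) j ord0 * entry u j x)
    (\sum_i (`|r i ord0| * (B * `|u|))).
  have := vbounded_sum V1 (index_enum 'I_k) (fun i => vboundedZ (r i ord0) (hB u i j)).
  congr (vbounded V _ _); apply/funext => x; rewrite [in RHS]mxE mulr_suml.
  by apply: eq_bigr => i _; rewrite /entry; ring.
have cu := vboundedZ ((Mbar *m r) j ord0) uj.
rewrite -[LHS]subr0 -[X in _ - X](mulr0 ((Mbar *m r) j ord0)) -mean0.
rewrite -(vintZ mV V1 piV _ uj) -(vintB mV V1 piV mr cu).
by apply: eq_Rintegral => x _; rewrite mulmxBl -mulrBl !mxE.
Qed.

End Dual.

Lemma correlationZ n v r a a' :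
  correlation P pi m n (a *: v) (a' *: r) = a * a' * correlation P pi m n v r.
Proof.
have [B B0 hB] := vbounded_mulT V centered_bounded.
have [B' B'0 hB'] := vbounded_mulT V centered_bounded.
rewrite /correlation mulr_sumr; apply: eq_bigr => j _.
have vj : vbounded V (fun y => ((m y - Mbar)^T *m v) j ord0) (B * `|bconst V v|).
  exact: hB (bconst V v) j.
have -> : (fun y => ((m y - Mbar)^T *m (a *: v)) j ord0) =
    (fun y => a * ((m y - Mbar)^T *m v) j ord0).
  by apply/funext => y; rewrite -scalemxAr mxE.
rewrite (iter_PopZ mV V1 b0 drift n.+1 a vj).
have [c' h] := iter_bound mV V1 b0 drift n.+1 vj.
have [mcm [Bm mB]] := centered_bounded.
have mr : vbounded V (fun x => ((m x - Mbar) *m r) j ord0 *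
    iter n.+1 (Pop P) (fun y => ((m y - Mbar)^T *m v) j ord0) x)
    (\sum_i (`|r i ord0| * (`|Bm| * c'))).
  have hi i : vbounded V (fun x => (m x - Mbar) j i *
      iter n.+1 (Pop P) (fun y => ((m y - Mbar)^T *m v) j ord0) x) (`|Bm| * c').
    apply: vboundedM => // x; exact: le_trans (mB x j i) (ler_norm _).
  have := vbounded_sum V1 (index_enum 'I_k) (fun i => vboundedZ (r i ord0) (hi i)).
  congr (vbounded V _ _); apply/funext => x; rewrite mxE mulr_suml.
  by apply: eq_bigr => i _; ring.
rewrite -(vintZ mV V1 piV _ mr); apply: eq_Rintegral => x _.
by rewrite -scalemxAr mxE; ring.
Qed.

Variable lmin : R.
Hypotheses (Mdist : real_distinct_eigenvalues Mbar) (lmin_min : is_min_eigenvalue Mbar lmin).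

(** The bound on the iterates of [bPop] treats [alpha = 0], where the spectral radius is also wanted
    but the branch is not considered. *)
Theorem chain_perturbation : exists (s2 a0 Cc : R) (h : R -> E) (lam dlam : R -> R),
  [/\ 0 < a0, 0 <= Cc,
    exists D, forall n f, `|iter n bPop f| <= D * `|f|,
    forall r0 v0 : 'cV[R]_k, Mbar *m r0 = lmin *: r0 -> v0^T *m Mbar = lmin *: v0^T ->
      v0^T *m r0 = 1%:M -> series (fun n => correlation P pi m n v0 r0) @ \oo --> - s2
  & forall al, 0 < al < a0 ->
    [/\ 0 < lam al /\ perturbed bPop bN al (h al) = lam al *: h al, h al != 0,
      exists D, forall n f, `|iter n (perturbed bPop bN al) f| <= D * lam al ^+ n * `|f|,
      is_derive al (1 : R) lam (dlam al)
    & `|lam al - (1 - al * lmin - al ^+ 2 * s2)| <= Cc * al ^+ 3 /\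
      `|dlam al + lmin + 2 * al * s2| <= Cc * al ^+ 2]].
Proof.
have [W [D [Wu WA Dinj]]] := real_distinct_diagonalization Mdist.
have [eig_lmin lmin_le] := lmin_min.
have [i0 Di0] := eigenvalue_diag Wu WA eig_lmin.
have mu_min j : j != i0 -> D ord0 i0 < D ord0 j.
  move=> ji0; rewrite lt_neqAle Di0 lmin_le ?(diag_eigenvalue Wu WA)// andbT -Di0.
  by apply/eqP => /Dinj ij; rewrite ij eqxx in ji0.
have [K1 [rho [K10 rho01 ergP]]] :=
  geometric_ergodicity mV V1 gam01 b0 mC drift t0_gt0 nu0 irr small inv piV.
have [B B0 hB] := bmulT_bounded V mb.
have pV0 : 0 <= \int[pi]_x V x.
  by apply: Rintegral_ge0 => x _; exact: le_trans ler01 (V1 x).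
pose Kc := \sum_i (l1norm (col i (invmx W)) * \int[pi]_x V x).
have Kc0 : 0 <= Kc by apply: sumr_ge0 => i _; rewrite mulr_ge0// l1norm_ge0.
pose Ke := \sum_i `|dual_vec W i|.
have Ke0 : 0 <= Ke by exact: sumr_ge0.
have gb0 : 0 <= k%:R * (gam + b) by rewrite mulr_ge0// addr_ge0.
(* The sum of all the constants, so that a single [K] fits every hypothesis of
   [spectral_perturbation]. *)
pose K := 1 + k%:R * (gam + b) + Kc + k%:R * K1 + k%:R * (gam + b) * B + Ke.
have kK1 : 0 <= k%:R * K1 by rewrite mulr_ge0.
have gbB : 0 <= k%:R * (gam + b) * B by rewrite mulr_ge0.
have le_K x f : x <= K -> x * `|f : E| <= K * `|f| by move=> xK; rewrite ler_wpM2r.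
have PK f : `|bPop f| <= K * `|f|.
  by apply: le_trans (bP_bounded _ _ _) (le_K _ _ _) => //; rewrite /K; lra.
have cK i f : `|dual_fun W i f| <= K * `|f|.
  apply: le_trans (mfunctional_bounded _ _ _) (le_K _ _ _).
  apply: le_trans (_ : Kc <= K); last by rewrite /K; lra.
  by rewrite /Kc (bigD1 i)//= lerDl sumr_ge0// => j _; rewrite mulr_ge0// l1norm_ge0.
have NK f : `|bN f| <= K * `|f|.
  rewrite bNE; apply: le_trans (bP_bounded _ _ _) _.
  apply: le_trans (ler_wpM2l gb0 (hB f)) _; rewrite mulrA; apply: le_K.
  by rewrite /K; lra.
have eK i : `|dual_vec W i| <= K.
  apply: le_trans (_ : Ke <= K); last by rewrite /K; lra.
  by rewrite /Ke (bigD1 i)//= lerDl sumr_ge0.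
have erg n f : `|iter n bPop (coproj (dual_fun W) (dual_vec W) f)| <= K * rho ^+ n * `|f|.
  have [rho0 _] := andP rho01.
  apply: le_trans (_ : k%:R * (K1 * rho ^+ n * `|f|) <= _); last first.
    rewrite !mulrA ler_wpM2r// ler_wpM2r ?exprn_ge0//; rewrite /K; lra.
  apply: bfun_norm_le => i; have fi := vbounded_entry f i.
  have -> : entry (iter n bPop (coproj (dual_fun W) (dual_vec W) f)) i =
      (fun x => iter n (Pop P) (entry f i) x - \int[pi]_y entry f i y).
    rewrite entry_iter_bP /coproj proj_dual//.
    have -> : entry (f - bconst V (pmean piV f)) i =
        (fun x => entry f i x - cst (\int[pi]_y entry f i y) x).
      by apply/funext => x; rewrite /entry !mxE.
    rewrite (iter_PopB mV V1 b0 drift n fi (vbounded_cst V1 (\int[pi]_y entry f i y))).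
    by rewrite iter_cst.
  have [c' h'] := iter_bound mV V1 b0 drift n fi.
  split; first exact: (vboundedB h' (vbounded_cst V1 (\int[pi]_y entry f i y))).1.
  by move=> x; apply: le_trans (ergP n _ _ x fi) _; rewrite mulrA.
have K_ge1 : 1 <= K by rewrite /K; lra.
have Pe i : bPop (dual_vec W i) = dual_vec W i by exact: bP_const.
have := spectral_perturbation PK cK Pe (dual_fun_P W) (dual_fun_vec Wu) rho01 erg
  K_ge1 NK eK (dual_fun_N Wu WA) mu_min.
move=> [a0 [Cc [h [lam [dlam [a00 Cc0 main]]]]]].
exists (second_coef bPop (dual_fun W) (dual_vec W) bN i0), a0, Cc, h, lam, dlam.
split => //.
- exists (K + k%:R * \int[pi]_x V x) => n f.
  have fE : f = 1 *: coproj (dual_fun W) (dual_vec W) f + proj (dual_fun W) (dual_vec W) f.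
    by rewrite scale1r /coproj subrK.
  rewrite {1}fE iter_linear scale1r mulrDl; apply: normD_le.
    have [rho0 rho1] := andP rho01.
    apply: le_trans (erg n f) _; rewrite ler_wpM2r// ler_piMr ?exprn_ile1// ?(ltW rho1)//.
    exact: le_trans ler01 K_ge1.
  have -> : iter n bPop (proj (dual_fun W) (dual_vec W) f) = bconst V (pmean piV f).
    by rewrite proj_dual//; elim: n => //= n ->; rewrite bP_const.
  rewrite -mulrA; apply: bfun_norm_le => i; split; first exact: measurable_cst.
  move=> x; apply: le_trans (pmean_bounded piV f i) _; rewrite mulrC ler_peMr//; last exact: V1.
  by rewrite mulr_ge0.
- move=> r0 v0; rewrite -Di0 => rE vE vr.
  have [a rE'] := right_eigenvector_diag Wu WA Dinj rE.
  have [a' vE'] := left_eigenvector_diag Wu WA Dinj vE.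
  (* The correlations depend on the two scalings only through their product, which the normalization
     of [v0] against [r0] fixes. *)
  have aa : a' * a = 1.
    have := dual_fun_vec Wu i0 i0; rewrite dual_fun_const eqxx -trmx_mul mxE mulr1n => rv1.
    move: vr; rewrite rE' vE' => /matrixP/(_ ord0 ord0).
    have -> : (a' *: (row i0 W)^T)^T = a' *: row i0 W by rewrite linearZ/= trmxK.
    by rewrite -scalemxAl -scalemxAr scalerA mxE rv1 mulr1 mxE.
  rewrite /second_coef opprK.
  have TM g : `|(dual_fun W i0 \o bN) g| <= K * K * `|g|.
    rewrite -mulrA; apply: le_trans (cK _ _) _; rewrite ler_wpM2l//.
    exact: le_trans ler01 K_ge1.
  have := resolvent_functional rho01 erg TM (f := bN (dual_vec W i0)).
  rewrite (_ : (fun n : nat => correlation P pi m n v0 r0) = fun n =>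
    (dual_fun W i0 \o bN)
      (resolvent_term bPop (dual_fun W) (dual_vec W) (bN (dual_vec W i0)) n))//.
  apply/funext => n.
  rewrite rE' vE' correlationZ aa mul1r; apply: esym.
  exact: (dual_resolvent_term i0 Wu n).
move=> al alb; have [h1 h2 h3 h4 h5] := main al alb; rewrite -Di0; split => //.
apply/eqP => h0; move: h2; rewrite h0 linear0 => /eqP; by rewrite eq_sym oner_eq0.
Qed.

End ChainPerturbation.

(** * Spectral radius of complexified operators *)

Section EuclideanNorm.
Context {R : realType} {k : nat}.
Implicit Types z : 'cV[R[i]]_k.

Lemma enorm_ge0 z : 0 <= enorm z.
Proof. exact: sqrtr_ge0. Qed.

Lemma normc_entry_le z i :
  complex.Re (z i ord0) ^+ 2 + complex.Im (z i ord0) ^+ 2 <= enorm z ^+ 2.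
Proof.
rewrite sqr_sqrtr; last by apply: sumr_ge0 => j _; rewrite addr_ge0// sqr_ge0.
by rewrite [leRHS](bigD1 i)//= lerDl sumr_ge0// => j _; rewrite addr_ge0// sqr_ge0.
Qed.

Lemma Re_le_enorm z i : `|complex.Re (z i ord0)| <= enorm z.
Proof.
rewrite -ler_sqr ?nnegrE ?enorm_ge0// real_normK ?num_real//.
by apply: le_trans (normc_entry_le z i); rewrite lerDl sqr_ge0.
Qed.

Lemma Im_le_enorm z i : `|complex.Im (z i ord0)| <= enorm z.
Proof.
rewrite -ler_sqr ?nnegrE ?enorm_ge0// real_normK ?num_real//.
by apply: le_trans (normc_entry_le z i); rewrite lerDr sqr_ge0.
Qed.

Lemma enorm_le z : enorm z <=
  \sum_i `|complex.Re (z i ord0)| + \sum_i `|complex.Im (z i ord0)|.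
Proof.
set a := \sum_i _; set b := \sum_i _.
have a0 : 0 <= a by exact: sumr_ge0.
have b0 : 0 <= b by exact: sumr_ge0.
rewrite -ler_sqr ?nnegrE ?enorm_ge0 ?addr_ge0// sqr_sqrtr; last first.
  by apply: sumr_ge0 => j _; rewrite addr_ge0// sqr_ge0.
rewrite big_split/=; apply: (@le_trans _ _ (a * a + b * b)); last first.
  by rewrite expr2; nra.
rewrite {1}/a {1}/b !mulr_suml; apply: lerD; apply: ler_sum => i _;
  rewrite -real_normK ?num_real// expr2 ler_wpM2l// [leRHS](bigD1 i)//= lerDl; exact: sumr_ge0.
Qed.

Lemma enormZ mu z : enorm (mu *: z) = Normc.normc mu * enorm z.
Proof.
rewrite /enorm; case: mu => a b /=; rewrite -sqrtrM ?addr_ge0 ?sqr_ge0// mulr_sumr.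
congr Num.sqrt; apply: eq_bigr => i _; rewrite !mxE.
by case: (z i ord0) => x y /=; ring.
Qed.

Lemma enorm_eq0 z : enorm z = 0 -> z = 0.
Proof.
move=> z0; apply/colP => i; rewrite mxE.
have := Re_le_enorm z i; have := Im_le_enorm z i; rewrite z0 !normr_le0.
by case: (z i ord0) => x y /= /eqP -> /eqP ->.
Qed.

End EuclideanNorm.

Section Complexification.
Context {R : realType} {d : measure_display} {X : measurableType d}.
Variables (V : weight R X) (k : nat).
Local Notation E := (bfun V k).
Implicit Types f : X -> 'cV[R[i]]_k.

Lemma Vnorm_le f (c : R) : (Vnorm V f <= c%:E)%E <-> forall x, enorm (f x) <= c * V x.
Proof.
split=> [fc x|fc].
  rewrite -ler_pdivrMr ?V_gt0// -lee_fin; apply: le_trans fc.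
  by apply: ereal_sup_ubound; exists x.
by apply: ge_ereal_sup => _ [x _ <-]; rewrite lee_fin ler_pdivrMr ?V_gt0.
Qed.

Lemma Vnorm_ge0 f : (0 <= Vnorm V f)%E.
Proof.
apply: le_trans (ereal_sup_ubound _); last by exists point.
by rewrite lee_fin divr_ge0 ?enorm_ge0// ltW// V_gt0.
Qed.

Lemma Vnorm_fin f : LinfV V f -> Vnorm V f = (fine (Vnorm V f))%:E.
Proof. by move=> [_ foo]; rewrite fineK// ge0_fin_numE// Vnorm_ge0. Qed.

Lemma enorm_le_Vnorm f x : LinfV V f -> enorm (f x) <= fine (Vnorm V f) * V x.
Proof. by move=> fV; apply: (Vnorm_le f _).1; rewrite -Vnorm_fin. Qed.

Lemma Vnorm_gt0 f : LinfV V f -> f <> (fun=> 0) -> 0 < fine (Vnorm V f).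
Proof.
move=> fV f0; rewrite lt0r fine_ge0 ?Vnorm_ge0// andbT; apply/eqP => n0.
apply: f0; apply/funext => x; apply: enorm_eq0; apply/eqP.
by rewrite eq_le enorm_ge0 andbT -(mul0r (V x)) -n0 enorm_le_Vnorm.
Qed.

Definition cplx (u v : X -> 'cV[R]_k) (x : X) : 'cV[R[i]]_k :=
  \col_i Complex (u x i ord0) (v x i ord0).

Lemma map_mx_cplx (A : 'M[R]_k) (u v : X -> 'cV[R]_k) x :
  map_mx (real_complex R) A *m cplx u v x =
  cplx (fun y => A *m u y) (fun y => A *m v y) x.
Proof.
apply/colP => i; rewrite !mxE; apply: (big_rec3 (fun s a b => s = Complex a b)) => //.
by move=> j s a b _ ->; rewrite !mxE /=; congr Complex; ring.
Qed.

Lemma Vnorm_cplx (u v : E) : (Vnorm V (cplx u v) <= (`|u| + `|v|)%:E)%E.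
Proof.
apply/Vnorm_le => x; apply: le_trans (enorm_le _) _.
rewrite mulrDl; apply: lerD.
  by under eq_bigr do rewrite mxE /=; exact: l1norm_le_bnorm.
by under eq_bigr do rewrite mxE /=; exact: l1norm_le_bnorm.
Qed.

Lemma cplx_LinfV (u v : E) : LinfV V (cplx u v).
Proof.
split=> [i|]; last by apply: le_lt_trans (Vnorm_cplx u v) _; rewrite ltry.
split; under eq_fun do rewrite mxE /=.
  exact: (vbounded_entry u i).1.
exact: (vbounded_entry v i).1.
Qed.

Lemma LinfV_cplx f : LinfV V f -> exists u v : E,
  [/\ f = cplx u v, `|u| <= k%:R * fine (Vnorm V f) & `|v| <= k%:R * fine (Vnorm V f)].
Proof.
move=> fV; have [mf _] := fV.
have bRe i : vbounded V (fun x => complex.Re (f x i ord0)) (fine (Vnorm V f)).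
  split=> [|x]; first exact: (mf i).1.
  exact: le_trans (Re_le_enorm _ _) (enorm_le_Vnorm _ _).
have bIm i : vbounded V (fun x => complex.Im (f x i ord0)) (fine (Vnorm V f)).
  split=> [|x]; first exact: (mf i).2.
  exact: le_trans (Im_le_enorm _ _) (enorm_le_Vnorm _ _).
have uV := vfun_col (fun i => ex_intro _ _ (bRe i)).
have vV := vfun_col (fun i => ex_intro _ _ (bIm i)).
exists (BFun uV), (BFun vV); split.
- by apply/funext => x; apply/colP => i; rewrite !mxE; case: (f x i ord0).
- by apply: bfun_norm_le => i; rewrite /entry; under eq_fun do rewrite /= mxE; exact: bRe.
- by apply: bfun_norm_le => i; rewrite /entry; under eq_fun do rewrite /= mxE; exact: bIm.
Qed.

Section SpectralRadius.
Variables (T : {linear E -> E}) (L : (X -> 'cV[R[i]]_k) -> X -> 'cV[R[i]]_k).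
Variables (D lam : R) (h : E).
Hypothesis LT : forall u v : E, L (cplx u v) = cplx (T u) (T v).
Hypotheses (lam0 : 0 < lam) (h0 : h != 0) (Th : T h = lam *: h).
Hypothesis growth : forall n u, `|iter n T u| <= D * lam ^+ n * `|u|.

Lemma iter_cplx n (u v : E) : iter n L (cplx u v) = cplx (iter n T u) (iter n T v).
Proof. by elim: n => //= n ->; rewrite LT. Qed.

(** [L] is only known through its action on real and imaginary parts; acting on both by the same
    real linear [T] makes it commute with complex scalars. *)
Lemma complexified_homogeneous mu f : LinfV V f ->
  L (fun x => mu *: f x) = (fun x => mu *: L f x).
Proof.
move=> /LinfV_cplx[u [v [-> _ _]]]; case: mu => a b.
have mulc (u' v' : E) : (fun x => Complex a b *: cplx u' v' x) =
    cplx (a *: u' - b *: v') (b *: u' + a *: v').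
  by apply/funext => x; apply/colP => i; rewrite !mxE /=; congr Complex; ring.
rewrite mulc !LT mulc; congr cplx; by rewrite ?linearB ?linearD !linearZ.
Qed.

Lemma opnorm_le n : (opnorm V (iter n L) <= (2 * k%:R * D * lam ^+ n)%:E)%E.
Proof.
have D0 : 0 <= D.
  by have := growth 0 h; rewrite expr0 mulr1/= ler_pMl ?normr_gt0// => /(le_trans ler01).
apply: ge_ereal_sup => _ [f [fV f0] <-].
have f_gt0 := Vnorm_gt0 fV f0.
have [u [v [fE uf vf]]] := LinfV_cplx fV.
have Lf : (Vnorm V (iter n L f) <= (2 * k%:R * D * lam ^+ n * fine (Vnorm V f))%:E)%E.
  rewrite {1}fE iter_cplx; apply: le_trans (Vnorm_cplx _ _) _; rewrite lee_fin.
  have := growth n u; have := growth n v.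
  have Dl : 0 <= D * lam ^+ n by rewrite mulr_ge0// exprn_ge0// ltW.
  have := ler_wpM2l Dl uf; have := ler_wpM2l Dl vf; lra.
apply: le_trans (lee_wpmul2r _ Lf) _; first by rewrite lee_fin invr_ge0 ltW.
by rewrite -EFinM lee_fin mulfK// gt_eqF.
Qed.

Lemma eigenvalue_le_opnorm mu n : is_eigenvalue V L mu ->
  ((Normc.normc mu ^+ n)%:E <= opnorm V (iter n L))%E.
Proof.
move=> [f [fV f0] Lf]; have f_gt0 := Vnorm_gt0 fV f0.
have LfE j : iter j L f = (fun x => mu ^+ j *: f x).
  elim: j => [|j IHj]; first by apply/funext => x; rewrite expr0 scale1r.
  rewrite iterS IHj complexified_homogeneous//; apply/funext => x.
  by rewrite Lf scalerA exprSr.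
apply: le_trans (ereal_sup_ubound _); last by exists f.
rewrite LfE.
have VZ : (Vnorm V (fun x => mu ^+ n *: f x) = (Normc.normc mu ^+ n * fine (Vnorm V f))%:E)%E.
  have n0 : 0 <= Normc.normc mu ^+ n.
    by rewrite exprn_ge0//; case: (mu) => ? ?; exact: sqrtr_ge0.
  have nE : Normc.normc (mu ^+ n) = Normc.normc mu ^+ n.
    by elim: (n) => [|j IHj]; rewrite ?expr0 ?Normc.normc1// !exprS Normc.normcM IHj.
  rewrite EFinM -(Vnorm_fin fV) -ereal_supZl//; last first.
    by apply/set0P; exists (enorm (f point) / V point)%:E; exists point.
  rewrite image_comp; congr ereal_sup; apply: eq_imagel => x _ /=.
  by rewrite enormZ nE -EFinM mulrA.
by rewrite VZ -EFinM lee_fin -mulrA divff ?mulr1// gt_eqF.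
Qed.

Let C := 2 * k%:R * D.

Let eigen_lam : is_eigenvalue V L (lam%:C)%C.
Proof.
exists (cplx h (0 : E)).
  split; first exact: cplx_LinfV.
  move=> h00; move/eqP: h0; apply; apply: bfun_eq => x.
  apply/colP => i; have := congr1 (fun g : X -> 'cV[R[i]]_k => complex.Re (g x i ord0)) h00.
  by rewrite !mxE.
move=> x; rewrite LT Th linear0; apply/colP => i; rewrite !mxE /=.
by congr Complex; ring.
Qed.

Let normc_lam : Normc.normc (lam%:C)%C = lam.
Proof. by rewrite /= expr0n/= addr0 sqrtr_sqr ger0_norm// ltW. Qed.

Let C1 : 1 <= C.
Proof.
have := le_trans (eigenvalue_le_opnorm 0 eigen_lam) (opnorm_le 0).
by rewrite lee_fin !expr0 mulr1.
Qed.

Let root_cvg : (fun n => C `^ n%:R^-1 * lam) @ \oo --> lam.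
Proof.
have C_gt0 : 0 < C by exact: lt_le_trans ltr01 C1.
suff : (fun n => C `^ n%:R^-1 * lam) @ \oo --> expR (0 * ln C) * lam.
  by rewrite mul0r expR0 mul1r.
apply: cvgMr_tmp; rewrite /powR gt_eqF//.
apply: (cvg_comp _ expR); last exact: continuous_expR.
apply: cvgMr_tmp; rewrite -cvg_shiftS; exact: cvg_harmonic.
Qed.

Let powr_root (a : R) n : 0 <= a -> ((a ^+ n.+1) `^ n.+1%:R^-1) = a.
Proof. by move=> a0; rewrite -powR_mulrn// -powRrM mulfV ?powRr1// pnatr_eq0. Qed.

Let opnorm_root n : (opnorm V (iter n.+1 L) `^ n.+1%:R^-1 <= (C `^ n.+1%:R^-1 * lam)%:E)%E.
Proof.
apply: (@le_trans _ _ ((C * lam ^+ n.+1)%:E `^ n.+1%:R^-1)%E).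
  apply: gt0_ler_poweR => //; rewrite ?in_itv/= ?leey ?andbT.
  - apply: le_trans (eigenvalue_le_opnorm n.+1 eigen_lam).
    by rewrite lee_fin normc_lam exprn_ge0// ltW.
  - by rewrite lee_fin mulr_ge0 ?exprn_ge0// ?(le_trans ler01 C1)// ltW.
  - exact: opnorm_le.
rewrite poweR_EFin lee_fin powRM ?powr_root ?exprn_ge0 ?(ltW lam0)//.
exact: le_trans ler01 C1.
Qed.

Let le_root mu n : is_eigenvalue V L mu ->
  ((Normc.normc mu)%:E <= opnorm V (iter n.+1 L) `^ n.+1%:R^-1)%E.
Proof.
move=> emu; have n0 : 0 <= Normc.normc mu by case: mu {emu} => ? ?; exact: sqrtr_ge0.
rewrite -[X in (X%:E <= _)%E](powr_root n)// -poweR_EFin.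
have h1 := eigenvalue_le_opnorm n.+1 emu.
apply: gt0_ler_poweR => //; rewrite ?in_itv/= ?leey ?andbT ?lee_fin ?exprn_ge0//.
by apply: le_trans h1; rewrite lee_fin exprn_ge0.
Qed.

Lemma spectral_radius_eq : spectral_radius V L = lam.
Proof.
rewrite /spectral_radius (_ : limn _ = lam%:E)//; apply/cvg_lim => //.
(* The shift avoids [n = 0], where the exponent [0^-1] is 0 by convention and no root is taken. *)
rewrite -cvg_shiftS.
suff : (fun n => opnorm V (iter n.+1 L) `^ n.+1%:R^-1)%E @ \oo --> lam%:E by [].
apply: (@squeeze_cvge _ _ _ _ (cst lam%:E) _ (fun n => (C `^ n.+1%:R^-1 * lam)%:E)).
- near=> n; rewrite opnorm_root andbT.
  by have := le_root n eigen_lam; rewrite normc_lam.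
- exact: cvg_cst.
- by apply: cvg_EFin; [exact: nearW|have := root_cvg; rewrite -cvg_shiftS].
Unshelve. all: by end_near. Qed.

Lemma maximal_eigenvalue : is_maximal_eigenvalue V L lam.
Proof.
split; first exact: eigen_lam.
move=> mu emu.
have : Normc.normc mu <= lam.
  have := root_cvg; rewrite -cvg_shiftS => rc.
  apply: (ler_cvg_to (cvg_cst (Normc.normc mu)) rc); near=> n.
  by rewrite -lee_fin; apply: le_trans (le_root n emu) (opnorm_root n).
by rewrite -lecR; case: mu {emu}.
Unshelve. all: by end_near. Qed.

End SpectralRadius.
End Complexification.

Section ChainOperator.
Context {R : realType} {d : measure_display} {X : measurableType d} {k : nat}.
Variables (V : weight R X) (P : R.-pker X ~> X) (b gam : R) (C : set X).
Hypotheses (b0 : 0 <= b).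
Hypothesis drift : forall x, (\int[P x]_y (V y)%:E <= (gam * V x + b * \1_C x)%:E)%E.
Variable m : X -> 'M[R]_k.
Hypothesis mb : bounded_measurable_mx m.

Local Notation bPop := (bP (V := V) (k := k) b0 drift).
Local Notation T al := (perturbed bPop (bN b0 drift mb) al).

Lemma Lop_cplx al (u v : bfun V k) :
  Lop P m al (cplx u v) = cplx (T al u) (T al v).
Proof.
have E w : T al w = bPop (w - al *: bmulT mb w).
  by rewrite linearB linearZ.
have mE (w : bfun V k) y i : (((1%:M - al *: m y)^T *m w y) i ord0) =
    entry (w - al *: bmulT mb w) i y.
  by rewrite linearB/= trmx1 linearZ/= mulmxBl mul1mx -scalemxAl.
rewrite !E; apply/funext => x; apply/colP => i; rewrite !mxE.
congr Complex; apply: eq_Rintegral => y _.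
  by rewrite -mE map_mx_cplx mxE.
by rewrite -mE map_mx_cplx mxE.
Qed.

End ChainOperator.

(** * Right derivatives *)

Section RightExpansion.
Context {R : realType}.

Lemma right_limit (g : R -> R) l K a0 : 0 < a0 ->
  (forall h, 0 < h < a0 -> `|g h - l| <= K * h) -> g h @[h --> 0^'+] --> l.
Proof.
move=> a00 gK; apply/cvgrPdist_le => e e0; near=> h.
have h0 : 0 < h by near: h; exact: nbhs_right_gt.
have hb : 0 < h < a0 by rewrite h0/=; near: h; exact: nbhs_right_lt.
have K1 : 0 < `|K| + 1 by rewrite ltr_wpDl.
rewrite distrC; apply: le_trans (gK h hb) _.
apply: (@le_trans _ _ ((`|K| + 1) * h)).
  by rewrite ler_wpM2r ?(ltW h0)//; have := ler_norm K; lra.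
rewrite mulrC -ler_pdivlMr//; near: h; apply: nbhs_right_le.
by rewrite divr_gt0.
Unshelve. all: by end_near. Qed.

Lemma right_expansion (f lam dlam : R -> R) l s a0 C : 0 < a0 -> 0 <= C -> f 0 = 1 ->
  (forall a, 0 < a < a0 -> [/\ f a = lam a, is_derive a (1 : R) lam (dlam a),
    `|lam a - (1 - a * l - a ^+ 2 * s)| <= C * a ^+ 3
    & `|dlam a + l + 2 * a * s| <= C * a ^+ 2]) ->
  right_derivative f 0 (- l) /\ right_derivative2 f 0 (2 * - s).
Proof.
move=> a00 C0 f0 H.
have first : right_derivative f 0 (- l).
  apply: (@right_limit _ _ (`|s| + C * a0) a0) => // h hb; have [h0 ha] := andP hb.
  have [fE _ e1 _] := H h hb; rewrite add0r fE f0.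
  rewrite -(ler_pM2l h0) -[X in X * _ <= _](gtr0_norm h0) -normrM.
  have -> : h * (h^-1 * (lam h - 1) - - l) =
      lam h - (1 - h * l - h ^+ 2 * s) - h ^+ 2 * s.
    by rewrite mulrBr mulVKf ?gt_eqF//; ring.
  apply: le_trans (ler_normB _ _) _; rewrite normrM normrX (gtr0_norm h0).
  have h3 : C * h ^+ 3 <= C * a0 * h ^+ 2.
    by rewrite exprS mulrA ler_wpM2r ?sqr_ge0// ler_wpM2l// ltW.
  by move: e1 h3; rewrite !expr2; nra.
(* A single function must hold the right derivative at 0 and the ordinary derivatives at positive
   points, so the value at 0 is prescribed separately. *)
split => //; exists (fun y => if y == 0 then - l else dlam y); split.
- by rewrite eqxx.
- near=> y.
  have y0 : 0 < y by near: y; exact: nbhs_right_gt.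
  have yb : 0 < y < a0 by rewrite y0/=; near: y; exact: nbhs_right_lt.
  rewrite gt_eqF//; have [_ dl _ _] := H y yb.
  apply: (near_eq_is_derive _ dl).
  have := @near_in_itvoo R 0 a0 y; rewrite in_itv/= => /(_ yb).
  by apply: filterS => z; rewrite in_itv/= => zb; have [->] := H z zb.
- apply: (@right_limit _ _ C a0) => // h hb; have [h0 ha] := andP hb.
  have [_ _ _ e2] := H h hb; rewrite add0r eqxx gt_eqF//.
  rewrite -(ler_pM2l h0) -[X in X * _ <= _](gtr0_norm h0) -normrM.
  have -> : h * (h^-1 * (dlam h - - l) - 2 * - s) = dlam h + l + 2 * h * s.
    by rewrite mulrBr mulVKf ?gt_eqF//; ring.
  by rewrite mulrCA -expr2.
Unshelve. all: by end_near. Qed.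

End RightExpansion.

(** * Correlations of the stationary chain *)

Section Process.
Context {R : realType} {d d' : measure_display} {X : measurableType d}
  {Omega : measurableType d'}.
Variables (P : R.-pker X ~> X) (pi : probability X R) (Pr : probability Omega R).
Variable Phi : nat -> Omega -> X.
Hypothesis MC : markov_chain Pr pi P Phi.
Implicit Types (g h : X -> R).

Let mPhi t : measurable_fun setT (Phi t). Proof. by have [] := MC. Qed.

Lemma measurable_dirac_fun U : measurable U -> measurable_fun [set: X] (fun x => \d_x U : \bar R).
Proof. by move=> mU; apply/measurable_EFinP; exact: measurable_indic. Qed.

Lemma integral_indicT d1 (Y : measurableType d1) (mu : {measure set Y -> \bar R}) A :
  measurable A -> (\int[mu]_x (\1_A x)%:E = mu A)%E.
Proof. by move=> mA; rewrite integral_indic// setIT. Qed.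

Lemma expect_Phi0 (f : X -> \bar R) : (forall x, 0 <= f x)%E -> measurable_fun setT f ->
  (\int[Pr]_w f (Phi 0%N w) = \int[pi]_x f x)%E.
Proof.
move=> f0 mf; have [_ law _] := MC.
rewrite (@ge0_integral_mixture _ _ _ _ _ _ _ Pr pi (Phi 0%N) (fun x => \d_x))//.
- by apply: eq_integral => w _; rewrite integral_dirac// diracT mul1e.
- exact: measurable_dirac_fun.
- by move=> A mA; apply: etrans (law A mA) _; rewrite -(integral_indicT pi).
Qed.

(** The only past event needed is [Phi 0 \in A], which belongs to the history at every time [t]. The
    indicator plays the part of the weight in [ge0_integral_transfer]. *)
Lemma markov_step t A (f : X -> \bar R) : measurable A ->
  (forall x, 0 <= f x)%E -> measurable_fun setT f ->
  (\int[Pr]_w ((\1_A (Phi 0%N w))%:E * f (Phi t.+1 w)) =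
   \int[Pr]_w ((\1_A (Phi 0%N w))%:E * \int[P (Phi t w)]_y f y))%E.
Proof.
move=> mA f0 mf; have [_ _ step] := MC.
have mE s B : measurable B -> measurable (Phi s @^-1` B).
  by move=> mB; rewrite -[X in measurable X]setTI; exact: mPhi.
have i0 w : 0 <= \1_A (Phi 0%N w) :> R by rewrite indicE.
have mi : measurable_fun setT (fun w => \1_A (Phi 0%N w) : R).
  by apply: measurableT_comp => //; exact: measurable_indic.
apply: (ge0_integral_transfer i0 i0 mi mi (mPhi t.+1) (k := fun w => P (Phi t w))) => //.
  by move=> U mU; exact: (measurableT_comp (measurable_kernel P U mU) (mPhi t)).
move=> B mB.
have hE : history Phi t (Phi 0%N @^-1` A).
  by apply: sub_sigma_algebra; exists 0%N, A.
have sE := step t _ B hE mB; rewrite integral_mkcond in sE.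
transitivity (Pr (Phi 0%N @^-1` A `&` Phi t.+1 @^-1` B)).
  rewrite -(integral_indicT Pr); last by apply: measurableI; exact: mE.
  by apply: eq_integral => w _; rewrite indicI.
rewrite sE; apply: eq_integral => w _; rewrite patchE indicE.
have -> : (w \in Phi 0%N @^-1` A) = (Phi 0%N w \in A).
  by apply/idP/idP => /set_mem h; apply/mem_set.
by case: ifP => _; rewrite ?mul1e ?mul0e.
Qed.

Local Notation bounded f c := (vbounded (cst 1) f c).

(** The constant weight 1 satisfies a drift condition with rate 0 and the whole space as [C], so the
    results on [Pop] under a drift condition also serve for bounded functions. *)
Let cst1_drift x :
  (\int[P x]_y (cst 1 y)%:E <= (0 * cst 1 x + 1 * \1_setT x : R)%:E)%E.
Proof.
have -> : (\int[P x]_y (cst 1 y)%:E = \int[P x]_y cst 1%E y)%E by [].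
by rewrite integral_cst// prob_kernel mul1e mul0r add0r mul1r indicT. Qed.

Let mcst1 : measurable_fun [set: X] (cst (1 : R)). Proof. exact: measurable_cst. Qed.
Let cst1_ge1 (x : X) : 1 <= cst (1 : R) x. Proof. exact: lexx. Qed.

Lemma bounded_iter n h c : bounded h c -> exists c', bounded (iter n (Pop P) h) c'.
Proof. exact: (iter_bound mcst1 cst1_ge1 ler01 cst1_drift n). Qed.

Lemma markov_iter t A h c : measurable A -> bounded h c -> (forall x, 0 <= h x) ->
  (\int[Pr]_w ((\1_A (Phi 0%N w))%:E * (h (Phi t w))%:E) =
   \int[Pr]_w ((\1_A (Phi 0%N w))%:E * (iter t (Pop P) h (Phi 0%N w))%:E))%E.
Proof.
move=> mA; elim: t h c => // t IHt h c hc h0.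
rewrite (markov_step t mA (f := EFin \o h)); last 2 first.
  by move=> x; rewrite lee_fin.
  exact/measurable_EFinP/hc.1.
have Eh x : (\int[P x]_y (h y)%:E)%E = (Pop P h x)%:E.
  by rewrite (EFin_Pop mcst1 cst1_ge1 cst1_drift x hc).
under eq_integral do rewrite Eh.
have [c' hc'] := bounded_iter 1 hc.
rewrite (IHt _ c')//; last by move=> x; exact: Pop_ge0.
by under eq_integral do rewrite -iterSr.
Qed.

(** [markov_iter] is the case where [g] is an indicator. Now [h (Phi t w)] becomes the weight, and
    [ge0_integral_transfer] with Dirac kernels extends the identity to all [g]. *)
Lemma markov_joint_ge0 t g h c c' : bounded g c -> bounded h c' ->
  (forall x, 0 <= g x) -> (forall x, 0 <= h x) ->
  \int[Pr]_w (g (Phi 0%N w) * h (Phi t w)) = \int[pi]_x (g x * iter t (Pop P) h x).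
Proof.
move=> gc hc g0 h0.
have H0 := iter_ge0 P t h0.
have [c2 [mH _]] := bounded_iter t hc.
have Eg x : (\int[\d_x]_z (g z)%:E = (g x)%:E)%E.
  by rewrite integral_dirac ?diracT ?mul1e//; exact/measurable_EFinP/gc.1.
have mh : measurable_fun setT (fun w => h (Phi t w)).
  by apply: measurableT_comp => //; exact: hc.1.
have := ge0_integral_transfer (mu1 := Pr) (mu2 := pi) (fun w => h0 (Phi t w)) H0 mh mH (mPhi 0)
  measurable_dirac_fun _ (f := EFin \o g).
move=> H; rewrite /Rintegral; congr fine.
under eq_integral do rewrite mulrC EFinM.
under [RHS]eq_integral do rewrite mulrC EFinM -Eg.
apply: H => [A mA|x|]; last exact/measurable_EFinP/gc.1.
  under eq_integral do rewrite muleC.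
  rewrite (markov_iter t mA hc h0).
  under [RHS]eq_integral do rewrite muleC.
  apply: (expect_Phi0 (f := fun x => (\1_A x)%:E * (iter t (Pop P) h x)%:E)%E).
    by move=> x; rewrite mule_ge0// lee_fin.
  by apply: emeasurable_funM; apply/measurable_EFinP.
by rewrite lee_fin.
Qed.

Lemma cst1_lty d1 (Y : measurableType d1) (mu : probability Y R) :
  (\int[mu]_y (cst (1 : R) y)%:E < +oo)%E.
Proof.
have -> : (\int[mu]_y (cst (1 : R) y)%:E = \int[mu]_y (cst 1 : Y -> \bar R) y)%E by [].
by rewrite integral_cst// mul1e (le_lt_trans (probability_le1 mu measurableT))// ltry.
Qed.

Lemma boundedM d1 (Y : measurableType d1) (g h : Y -> R) c c' : bounded g c -> bounded h c' ->
  bounded (fun y => g y * h y) (`|c| * c').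
Proof.
move=> [mg gc] hc; apply: vboundedM => // y.
by apply: le_trans (gc y) _; rewrite mulr1 ler_norm.
Qed.

Lemma bounded_comp (s : nat) h c : bounded h c -> bounded (fun w => h (Phi s w)) c.
Proof. by move=> [mh hc]; split => //; exact: measurableT_comp. Qed.

Let vint_subr d1 (Y : measurableType d1) (mu : probability Y R) (g h : Y -> R) c c' :
  bounded g c -> bounded h c' ->
  \int[mu]_y (g y - h y) = \int[mu]_y g y - \int[mu]_y h y.
Proof.
exact: (vintB (measurable_cst _) (fun=> lexx _) (cst1_lty mu)).
Qed.

Lemma markov_joint t g h c c' : bounded g c -> bounded h c' ->
  \int[Pr]_w (g (Phi 0%N w) * h (Phi t w)) = \int[pi]_x (g x * iter t (Pop P) h x).
Proof.
(* Adding a bound makes a function nonnegative; this is done for [h] first and then for [g], and the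
   added constants cancel by linearity. *)
have shift (f : X -> R) (a : R) : bounded f a -> bounded (fun x => f x + `|a|) (a + `|a|) /\
    forall x, 0 <= f x + `|a|.
  move=> fa; split.
    by have := vboundedD fa (vbounded_cst cst1_ge1 `|a|); rewrite normr_id.
  by move=> x; have := fa.2 x; rewrite mulr1 ler_norml; have := ler_norm a; lra.
have cstB (a : R) : bounded (fun _ : X => a) `|a| by exact: vbounded_cst.
have pos g' h' a a' : bounded g' a -> bounded h' a' -> (forall x, 0 <= g' x) ->
    \int[Pr]_w (g' (Phi 0%N w) * h' (Phi t w)) = \int[pi]_x (g' x * iter t (Pop P) h' x).
  move=> ga ha g0; have [hs hs0] := shift _ _ ha.
  have [a2 Ha] := bounded_iter t ha.
  have [a3 Hs] := bounded_iter t hs.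
  have := markov_joint_ge0 t ga (cstB `|a'|) g0 (fun=> normr_ge0 _).
  have := markov_joint_ge0 t ga hs g0 hs0.
  have -> : \int[Pr]_w (g' (Phi 0%N w) * h' (Phi t w)) =
    \int[Pr]_w (g' (Phi 0%N w) * (h' (Phi t w) + `|a'|)) - \int[Pr]_w (g' (Phi 0%N w) * `|a'|).
    rewrite -(vint_subr Pr (boundedM (bounded_comp 0 ga) (bounded_comp t hs))
      (boundedM (bounded_comp 0 ga) (vbounded_cst (fun=> lexx _) `|a'|))).
    by apply: eq_Rintegral => w _ /=; ring.
  move=> -> ->; rewrite iter_cst.
  rewrite -(vint_subr pi (boundedM ga Hs) (boundedM ga (cstB `|a'|))).
  apply: eq_Rintegral => x _.
  have := iter_PopB mcst1 cst1_ge1 ler01 cst1_drift t hs (cstB `|a'|).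
  rewrite iter_cst => /(congr1 (@^~ x)) /=.
  under [X in iter t _ X]eq_fun do rewrite addrK.
  by move=> ->; ring.
move=> gc hc; have [gs gs0] := shift _ _ gc; have [c2 Hc] := bounded_iter t hc.
have := pos _ _ _ _ (cstB `|c|) hc (fun=> normr_ge0 _).
have := pos _ _ _ _ gs hc gs0.
have -> : \int[Pr]_w (g (Phi 0%N w) * h (Phi t w)) =
    \int[Pr]_w ((g (Phi 0%N w) + `|c|) * h (Phi t w)) - \int[Pr]_w (`|c| * h (Phi t w)).
  rewrite -(vint_subr Pr (boundedM (bounded_comp 0 gs) (bounded_comp t hc))
    (boundedM (vbounded_cst (fun=> lexx _) `|c|) (bounded_comp t hc))).
  by apply: eq_Rintegral => w _ /=; ring.
move=> -> ->; rewrite -(vint_subr pi (boundedM gs Hc) (boundedM (cstB `|c|) Hc)).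
by apply: eq_Rintegral => x _ /=; ring.
Qed.

End Process.

Section Expectations.
Context {R : realType} {d d' : measure_display} {X : measurableType d}
  {Omega : measurableType d'} {k : nat}.
Variables (P : R.-pker X ~> X) (pi : probability X R) (Pr : probability Omega R).
Variables (Phi : nat -> Omega -> X) (m : X -> 'M[R]_k).
Hypotheses (MC : markov_chain Pr pi P Phi) (mb : bounded_measurable_mx m).
Local Notation N := (fun x => m x - mean_mx pi m).
Local Notation bounded f c := (vbounded (cst 1) f c).

Let cst1_ge1 (Y : Type) (y : Y) : 1 <= cst (1 : R) y. Proof. exact: lexx. Qed.

Lemma expectation_mxE p q (Y : Omega -> 'M[R]_(p, q)) i j :
  expectation_mx Pr Y i j = \int[Pr]_w Y w i j.
Proof. by rewrite mxE unlock. Qed.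

Lemma bounded_mulmx (n : X -> 'M[R]_k) (r : 'cV[R]_k) j : bounded_measurable_mx n ->
  exists c, bounded (fun x => (n x *m r) j ord0) c.
Proof.
move=> [mn [B nB]]; exists (\sum_i `|r i ord0| * B).
have nb i : bounded (fun x => n x j i) B by split=> // x; rewrite mulr1.
have := vbounded_sum (@cst1_ge1 X) (index_enum 'I_k) (fun i => vboundedZ (r i ord0) (nb i)).
congr (vbounded _ _ _); apply/funext => x; rewrite [in RHS]mxE.
by apply: eq_bigr => i _; rewrite mulrC.
Qed.

Lemma bounded_trmx (n : X -> 'M[R]_k) : bounded_measurable_mx n ->
  bounded_measurable_mx (fun x => (n x)^T).
Proof.
move=> [mn [B nB]]; split=> [i j|]; first by under eq_fun do rewrite mxE; exact: mn.
by exists B => x i j; rewrite mxE.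
Qed.

Let Nb : bounded_measurable_mx N. Proof. exact: centered_bounded. Qed.

Lemma expectation_form (s t : nat) (v r : 'cV[R]_k) :
  (v^T *m expectation_mx Pr (fun w => N (Phi s w) *m N (Phi t w)) *m r) ord0 ord0 =
  \sum_j \int[Pr]_w (((N (Phi t w)) *m r) j ord0 * ((N (Phi s w))^T *m v) j ord0).
Proof.
have [mN [B NB]] := Nb.
have eN i j : bounded (fun x => N x i j) B by split=> // x; rewrite mulr1.
have eNN i l j : bounded (fun w => N (Phi s w) i l * N (Phi t w) l j) (`|B| * B).
  exact: boundedM (bounded_comp MC s (eN i l)) (bounded_comp MC t (eN l j)).
pose vint1 := vint_sum (measurable_cst (1 : R)) (@cst1_ge1 Omega) (cst1_lty Pr).
transitivity (\sum_i \sum_j \sum_l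
    (v i ord0 * r j ord0) * \int[Pr]_w (N (Phi s w) i l * N (Phi t w) l j)).
  rewrite mxE exchange_big; apply: eq_bigr => j _ /=.
  rewrite mxE mulr_suml; apply: eq_bigr => i _; rewrite mxE -mulr_sumr mulrAC; congr (_ * _).
  rewrite expectation_mxE -(vint1 _ _ _ _ (eNN i ^~ j)).
  by apply: eq_Rintegral => w _; rewrite mxE.
under eq_bigr do rewrite exchange_big; rewrite exchange_big; apply: eq_bigr => l _ /=.
have eNNZ i j := vboundedZ (v i ord0 * r j ord0) (eNN i l j).
have eS i := vbounded_sum (@cst1_ge1 Omega) (index_enum 'I_k) (eNNZ i).
transitivity (\int[Pr]_w \sum_i \sum_j
    (v i ord0 * r j ord0) * (N (Phi s w) i l * N (Phi t w) l j)).
  rewrite (vint1 _ _ _ _ eS); apply: eq_bigr => i _.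
  rewrite (vint1 _ _ _ _ (eNNZ i)); apply: eq_bigr => j _.
  by rewrite (vintZ (measurable_cst _) (@cst1_ge1 Omega) (cst1_lty Pr) _ (eNN i l j)).
apply: eq_Rintegral => w _; rewrite mxE mulr_suml exchange_big; apply: eq_bigr => j _ /=.
rewrite [X in _ = _ * X]mxE mulr_sumr; apply: eq_bigr => i _.
by rewrite [(_^T) l i]mxE; ring.
Qed.

(** With the later factor on the left, [r] meets the time 0 and [v] the time [t.+1], which is the
    pairing that the Markov property turns into iterates of [Pop]. *)
Lemma expectation_correlation (t : nat) (v r : 'cV[R]_k) :
  (v^T *m expectation_mx Pr (fun w => N (Phi t.+1 w) *m N (Phi 0%N w)) *m r) ord0 ord0 =
  correlation P pi m t v r.
Proof.
rewrite expectation_form; apply: eq_bigr => j _.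
have [c gc] := bounded_mulmx r j Nb.
have [c' hc] := bounded_mulmx v j (bounded_trmx Nb).
exact: (markov_joint MC t.+1 gc hc).
Qed.

Definition noise (r : 'cV[R]_k) (i : 'I_k) (x : X) : R := (N x *m r) i ord0.

Lemma autocov_noise r (i j : 'I_k) l :
  autocov Pr (fun t w => N (Phi t w) *m r) (Posz l) i j =
  \int[pi]_x (noise r i x * iter l (Pop P) (noise r j) x).
Proof.
have [c gc] := bounded_mulmx r i Nb; have [c' hc] := bounded_mulmx r j Nb.
rewrite /= expectation_mxE -(markov_joint MC l gc hc); apply: eq_Rintegral => w _.
by rewrite mxE big_ord1 [X in _ * X]mxE.
Qed.

Lemma autocov_noiseN r (i j : 'I_k) l :
  autocov Pr (fun t w => N (Phi t w) *m r) (Negz l) i j =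
  \int[pi]_x (noise r j x * iter l.+1 (Pop P) (noise r i) x).
Proof.
have [c gc] := bounded_mulmx r i Nb; have [c' hc] := bounded_mulmx r j Nb.
rewrite [LHS]expectation_mxE -(markov_joint MC l.+1 hc gc); apply: eq_Rintegral => w _.
by rewrite mxE big_ord1 [X in _ * X]mxE mulrC.
Qed.

End Expectations.

(** * Correlations for symmetric matrices *)

Section Symmetric.
Context {R : realType} {d : measure_display} {X : measurableType d} {k : nat}.
Variables (P : R.-pker X ~> X) (pi : probability X R) (m : X -> 'M[R]_k).
Hypothesis msym : forall x, m x = (m x)^T.

Lemma mean_mx_sym : mean_mx pi m = (mean_mx pi m)^T.
Proof.
by apply/matrixP => i j; rewrite !mxE; apply: eq_Rintegral => x _; rewrite {1}msym mxE.
Qed.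

Lemma centered_sym x : (m x - mean_mx pi m)^T = m x - mean_mx pi m.
Proof. by rewrite linearB/= -msym -mean_mx_sym. Qed.

Lemma correlation_sym l r : correlation P pi m l r r =
  \sum_i \int[pi]_x (noise pi m r i x * iter l.+1 (Pop P) (noise pi m r i) x).
Proof.
apply: eq_bigr => j _; rewrite (_ : (fun y => ((m y - mean_mx pi m)^T *m r) j ord0) = noise pi m r j)//.
by apply/funext => y; rewrite centered_sym.
Qed.

(** The factors are here in the opposite order. For symmetric matrices and equal outer vectors,
    transposing the scalar quadratic form exchanges them. *)
Lemma expectation_correlation_sym d' (Omega : measurableType d') (Pr : probability Omega R)
    (Phi : nat -> Omega -> X) l r : markov_chain Pr pi P Phi -> bounded_measurable_mx m ->
  (r^T *m expectation_mx Pr (fun w => (m (Phi 0%N w) - mean_mx pi m) *m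
      (m (Phi l.+1 w) - mean_mx pi m)) *m r) ord0 ord0 = correlation P pi m l r r.
Proof.
move=> MC mb; rewrite (expectation_form MC mb) correlation_sym; apply: eq_bigr => j _.
have [c nc] := bounded_mulmx r j (centered_bounded pi mb).
rewrite -(markov_joint MC l.+1 nc nc); apply: eq_Rintegral => w _.
by rewrite centered_sym mulrC.
Qed.

End Symmetric.

Lemma limn_series_S {R : realType} (a : nat -> R) : cvgn (series (fun l => a l.+1)) ->
  series a @ \oo --> a 0%N + limn (series (fun l => a l.+1)).
Proof.
move=> cv; rewrite -cvg_shiftS.
rewrite (_ : (fun n => series a n.+1) = fun n => a 0%N + series (fun l => a l.+1) n).
  by apply: cvgD; [exact: cvg_cst|exact: cv].
by apply/funext => n; rewrite /series/= big_nat_recl.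
Qed.

Lemma geometric_series_cvg {R : realType} (a : nat -> R) (c rho : R) : 0 <= rho < 1 ->
  (forall n, `|a n| <= c * rho ^+ n) -> cvgn (series a).
Proof.
move=> /andP[rho0 rho1] ab; apply: normed_cvg.
apply: (series_le_cvg _ _ ab) => [n|n|].
- exact: normr_ge0.
- exact: le_trans (normr_ge0 _) (ab n).
- by apply: is_cvg_geometric_series; rewrite ger0_norm.
Qed.

(** * Assembly for a geometrically ergodic chain *)

Section SpectralExpansion.
Context {R : realType} {d : measure_display} {X : measurableType d} {k : nat}.
Variables (P : R.-pker X ~> X) (V : X -> R) (pi : probability X R) (m : X -> 'M[R]_k) (lmin : R).
Hypotheses (ge : geometrically_ergodic P V) (inv : invariant P pi).
Hypothesis piV2 : (\int[pi]_x ((V x) ^+ 2)%:E < +oo)%E.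
Local Notation N := (fun x => m x - mean_mx pi m).
Local Notation xi := (fun al => spectral_radius V (Lop P m al)).

Let V1 x : 1 <= V x. Proof. by have [_ []] := ge. Qed.
Let mV : measurable_fun setT V. Proof. by have [_ []] := ge. Qed.

Let piV : (\int[pi]_x (V x)%:E < +oo)%E.
Proof.
apply: le_lt_trans piV2; apply: ge0_le_integral => //.
- by move=> x _; rewrite lee_fin (le_trans ler01).
- exact/measurable_EFinP.
- by apply/measurable_EFinP; exact: measurable_funX.
- by move=> x _; rewrite lee_fin expr2 ler_peMl// (le_trans ler01).
Qed.

Let drift_data : exists (gam b : R) (t0 : nat) (C : set X) (nu : {measure set X -> \bar R}),
  [/\ 0 <= gam < 1, 0 <= b, (0 < t0)%N, measurable C & nu setT != 0%E] /\
  (forall x, (\int[P x]_y (V y)%:E <= (gam * V x + b * \1_C x)%:E)%E) /\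
  (forall x A, C x -> measurable A -> (nu A <= kernel_iter P t0 x A)%E).
Proof.
have [_ [_ _ [gam [b [t0 [C [nu [gam1 t0_1 mC nu0 [dr sm]]]]]]]]] := ge.
(* Passing to the positive parts only weakens the drift inequality, since [V] and the indicator are
   nonnegative. *)
exists (Num.max gam 0), (Num.max b 0), t0, C, nu; split; first split=> //.
- by rewrite le_max lexx orbT gt_max gam1 ltr01.
- by rewrite le_max lexx orbT.
split=> // x; apply: le_trans (dr x) _; rewrite lee_fin lerD//.
  by rewrite ler_wpM2r ?(le_trans ler01)// le_max lexx.
by rewrite ler_wpM2r ?le_max ?lexx// indicE.
Qed.

Lemma chain_ergodic : exists K rho : R, [/\ 0 <= K, 0 <= rho < 1 &
  forall n f c x, vbounded V f c ->
    `|iter n (Pop P) f x - \int[pi]_y f y| <= K * rho ^+ n * (c * V x)].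
Proof.
have [irr _] := ge.
have [gam [b [t0 [C [nu [[gam01 b0 t00 mC nu0] [dr sm]]]]]]] := drift_data.
exact: (geometric_ergodicity mV V1 gam01 b0 mC dr t00 nu0 irr sm inv piV).
Qed.

Lemma correlation_cvg (g h : X -> R) c c' : vbounded (cst 1) g c -> vbounded (cst 1) h c' ->
  \int[pi]_x h x = 0 ->
  cvgn (series (fun l => \int[pi]_x (g x * iter l (Pop P) h x))) /\
  cvgn (series (fun l => \int[pi]_x (g x * iter l.+1 (Pop P) h x))).
Proof.
move=> gc hc h0; have [K [rho [K0 rho01 erg]]] := chain_ergodic.
have [rho0 rho1] := andP rho01.
have hV : vbounded V h `|c'|.
  split; [exact: hc.1|move=> x; apply: le_trans (hc.2 x) _].
  by rewrite mulr1 (le_trans (ler_norm _))// ler_peMr.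
have bnd l : `|\int[pi]_x (g x * iter l (Pop P) h x)| <=
    (`|c| * (K * `|c'|) * \int[pi]_x V x) * rho ^+ l.
  have itV : vbounded V (iter l (Pop P) h) (K * rho ^+ l * `|c'|).
    split; first by have [c2 []] := bounded_iter P l hc.
    by move=> x; have := erg l h _ x hV; rewrite h0 subr0 mulrA.
  have gh : vbounded V (fun x => g x * iter l (Pop P) h x) (`|c| * (K * rho ^+ l * `|c'|)).
    apply: vboundedM => //; first exact: gc.1.
    by move=> x; apply: le_trans (gc.2 x) _; rewrite mulr1 ler_norm.
  apply: le_trans (norm_vint_le mV V1 piV gh) _.
  by rewrite le_eqVlt; apply/orP; left; apply/eqP; ring.
split; first exact: geometric_series_cvg rho01 bnd.
apply: (@geometric_series_cvg _ _ (`|c| * (K * `|c'|) * \int[pi]_x V x) rho) => // l.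
apply: le_trans (bnd l.+1) _; rewrite exprS ler_wpM2l//; last first.
  by rewrite ler_piMl// ?exprn_ge0// ltW.
rewrite !mulr_ge0//; apply: Rintegral_ge0 => x _; exact: le_trans ler01 (V1 x).
Qed.

Hypotheses (mb : bounded_measurable_mx m) (Mdist : real_distinct_eigenvalues (mean_mx pi m)).
Hypothesis lmin_min : is_min_eigenvalue (mean_mx pi m) lmin.

Lemma noise_mean r j : \int[pi]_x noise pi m r j x = 0.
Proof.
have [mm [B mB]] := mb; have V1' (x : X) : 1 <= cst (1 : R) x by [].
have e a c : vbounded (cst (1 : R)) (fun x => m x a c) B by split=> // x; rewrite mulr1.
have eN i := vboundedZ (r i ord0) (vboundedB (e j i) (vbounded_cst V1' (mean_mx pi m j i))).
have mc : measurable_fun setT (cst (1 : R) : X -> R) by exact: measurable_cst.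
transitivity (\int[pi]_x \sum_i r i ord0 * (m x j i - cst (mean_mx pi m j i) x)).
  apply: eq_Rintegral => x _; rewrite /noise mxE; apply: eq_bigr => i _.
  by rewrite mulrC; congr (_ * _); rewrite mxE [X in _ + X]mxE.
rewrite (vint_sum mc V1' (cst1_lty pi) _ eN) big1// => i _.
rewrite (vintZ mc V1' (cst1_lty pi) _
  (vboundedB (e j i) (vbounded_cst V1' (mean_mx pi m j i)))).
rewrite (vintB mc V1' (cst1_lty pi) (e j i) (vbounded_cst V1' (mean_mx pi m j i))).
by rewrite Rintegral_probability_cst mxE subrr mulr0.
Qed.

Theorem spectral_expansion : exists s2 : R,
  [/\ xi 0 = 1,
    \forall alpha \near 0^'+, is_maximal_eigenvalue V (Lop P m alpha) (xi alpha),
    right_derivative xi 0 (- lmin), right_derivative2 xi 0 (2 * - s2)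
  & forall r0 v0 : 'cV[R]_k, mean_mx pi m *m r0 = lmin *: r0 ->
      v0^T *m mean_mx pi m = lmin *: v0^T -> v0^T *m r0 = 1%:M ->
      series (fun l => correlation P pi m l v0 r0) @ \oo --> - s2].
Proof.
have [irr _] := ge.
have [gam [b [t0 [C [nu [[gam01 b0 t00 mC nu0] [dr sm]]]]]]] := drift_data.
pose W := Weight mV V1.
have := @chain_perturbation _ _ _ k W P gam b C gam01 b0 mC dr t0 nu t00 nu0 irr sm pi inv piV
  m mb lmin Mdist lmin_min.
move=> [s2 [a0 [Cc [h [lam [dlam [a00 Cc0 [D PD] ser main]]]]]]].
have LT := Lop_cplx (V := W) b0 dr mb.
have xiE al : 0 < al < a0 -> xi al = lam al.
  move=> /main[[lam0 Lh] h0 [D' gr] _ _].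
  exact: (spectral_radius_eq (V := W) (LT al) lam0 h0 Lh gr).
have ximax al : 0 < al < a0 -> is_maximal_eigenvalue V (Lop P m al) (xi al).
  move=> alb; rewrite xiE//; have [[lam0 Lh] h0 [D' gr] _ _] := main al alb.
  exact: (maximal_eigenvalue (V := W) (LT al) lam0 h0 Lh gr).
have xi0 : xi 0 = 1.
  (* Every nonzero constant is an eigenvector of [P] for 1; an eigenvector of the mean matrix
     supplies such a vector. *)
  have [/eigenvalueP[v vE v0] _] := lmin_min.
  have T0 f : perturbed (bP (V := W) (k := k) b0 dr) (bN (V := W) b0 dr mb) 0 f = bP (V := W) (k := k) b0 dr f.
    by rewrite /perturbed scale0r subr0.
  apply: (@spectral_radius_eq _ _ _ W k
    (perturbed (bP (V := W) (k := k) b0 dr) (bN (V := W) b0 dr mb) 0) _ D 1 (bconst W v^T) (LT 0)) => //.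
  - apply: contra v0 => /eqP/(congr1 (fun f : bfun W k => (f point)^T)) /=.
    by rewrite trmxK => ->; rewrite trmx0.
  - by apply: etrans (T0 _) _; rewrite bP_const scale1r.
  - move=> n u; rewrite expr1n mulr1; apply: le_trans (PD n u).
    by rewrite [iter n _ u in leLHS](eq_iter T0).
have [xid xid2] : right_derivative xi 0 (- lmin) /\ right_derivative2 xi 0 (2 * - s2).
  apply: (@right_expansion _ xi lam dlam lmin s2 a0 Cc) => // al alb.
  have [_ _ _ dl [e1 e2]] := main al alb.
  by split => //; exact: xiE.
exists s2; split => //.
near=> al; apply: ximax; apply/andP; split; near: al.
  exact: nbhs_right_gt.
exact: nbhs_right_lt.
Unshelve. all: by end_near. Qed.

End SpectralExpansion.

Unset Implicit Arguments.

Theorem theorem2p4 (R : realType) (d d' : measure_display)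
    (X : measurableType d) (Omega : measurableType d')
    (P : R.-pker X ~> X) (V : X -> R) (pi : probability X R)
    (Pr : probability Omega R) (Phi : nat -> Omega -> X)
    (k : nat) (m : X -> 'M[R]_k) (lmin : R)
    (Mbar := mean_mx pi m)
    (Mc := centered m Mbar Phi)
    (xi := fun alpha : R => spectral_radius V (Lop P m alpha)) :
  geometrically_ergodic P V ->
  invariant P pi ->
  (\int[pi]_x ((V x) ^+ 2)%:E < +oo)%E ->
  markov_chain Pr pi P Phi ->
  bounded_measurable_mx m ->
  real_distinct_eigenvalues Mbar ->
  is_min_eigenvalue Mbar lmin ->
  [/\ xi 0 = 1 /\
      (\forall alpha \near 0^'+,
         is_maximal_eigenvalue V (Lop P m alpha) (xi alpha)),
      right_derivative xi 0 (- lmin),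
      (forall r0 v0 : 'cV[R]_k,
         Mbar *m r0 = lmin *: r0 ->
         v0^T *m Mbar = lmin *: v0^T ->
         v0^T *m r0 = 1%:M ->
         let c := fun l : nat =>
           (v0^T *m expectation_mx Pr (fun w => Mc l.+1 w *m Mc 0%N w) *m r0)
             ord0 ord0 in
         cvgn (series c) /\ right_derivative2 xi 0 (2 * limn (series c)))
    & (forall x, m x = (m x)^T) ->
      forall r0 : 'cV[R]_k,
        Mbar *m r0 = lmin *: r0 ->
        r0^T *m r0 = 1%:M ->
        let c := fun l : nat =>
          (r0^T *m expectation_mx Pr (fun w => Mc 0%N w *m Mc l.+1 w) *m r0)
            ord0 ord0 in
        let F := fun (t : nat) (w : Omega) => Mc t w *m r0 in
        let Gamma := clt_covariance Pr F in
        let Sigma := expectation_mx Pr (fun w => F 0%N w *m (F 0%N w)^T) in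
        [/\ r0^T *m Mbar = lmin *: r0^T,
            cvgn (series c) /\ right_derivative2 xi 0 (2 * limn (series c)),
            forall i j, is_cvg_sumZ (fun n => autocov Pr F n i j)
          & right_derivative2 xi 0 (\tr (Gamma - Sigma))]].
Proof.
move=> ge inv piV2 MC mb Mdist lminM.
have [s2 [xi0 ximax xid xid2 ser]] := spectral_expansion ge inv piV2 mb Mdist lminM.
have conv r0 v0 (c : nat -> R) : Mbar *m r0 = lmin *: r0 -> v0^T *m Mbar = lmin *: v0^T ->
    v0^T *m r0 = 1%:M -> (forall l, c l = correlation P pi m l v0 r0) ->
    cvgn (series c) /\ right_derivative2 xi 0 (2 * limn (series c)).
  move=> rE vE vr cE; have cc : series c @ \oo --> - s2.
    by have := ser _ _ rE vE vr; rewrite (_ : correlation P pi m ^~ v0 ^~ r0 = c)//; apply/funext.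
  by split; [apply/cvg_ex; exists (- s2)|rewrite (cvg_lim _ cc)].
split => // [r0 v0 rE vE vr c|msym r0 rE rr c F Gamma Sigma].
  by apply: conv rE vE vr _ => l; exact: expectation_correlation.
have vE : r0^T *m Mbar = lmin *: r0^T.
  by rewrite /Mbar (mean_mx_sym pi msym) -trmx_mul rE linearZ.
pose f := noise pi m r0.
have fb i : exists c', vbounded (cst 1) (f i) c'.
  exact: bounded_mulmx (centered_bounded _ mb).
have fcvg i j : cvgn (series (fun l => \int[pi]_x (f i x * iter l (Pop P) (f j) x))) /\
    cvgn (series (fun l => \int[pi]_x (f i x * iter l.+1 (Pop P) (f j) x))).
  have [ci fi] := fb i; have [cj fj] := fb j.
  by apply: (correlation_cvg ge inv piV2 fi fj); exact: noise_mean.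
have posz i j : (fun l : nat => autocov Pr F (Posz l) i j) =
    (fun l => \int[pi]_x (f i x * iter l (Pop P) (f j) x)).
  by apply/funext => l; exact: autocov_noise.
have negz i j : (fun l : nat => autocov Pr F (Negz l) i j) =
    (fun l => \int[pi]_x (f j x * iter l.+1 (Pop P) (f i) x)).
  by apply/funext => l; exact: autocov_noiseN.
split => //.
- by apply: conv rE vE rr _ => l; exact: expectation_correlation_sym.
- move=> i j; rewrite /is_cvg_sumZ posz negz; split; [exact: (fcvg i j).1|exact: (fcvg j i).2].
- suff -> : \tr (Gamma - Sigma) = 2 * - s2 by [].
  pose u i l := \int[pi]_x (f i x * iter l.+1 (Pop P) (f i) x).
  (* On the diagonal the positive and negative lags give the same series, and subtracting [Sigma]
     removes the lag 0. *)
  have -> : \tr (Gamma - Sigma) = \sum_i 2 * limn (series (u i)).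
    apply: eq_bigr => i _; rewrite mxE [in X in _ + X]mxE [Gamma _ _]mxE /sumZ posz negz.
    have cvS := @limn_series_S R (fun l => \int[pi]_x (f i x * iter l (Pop P) (f i) x))
      (fcvg i i).2.
    rewrite (cvg_lim _ cvS)//.
    have -> : Sigma i i = \int[pi]_x (f i x * iter 0 (Pop P) (f i) x).
      exact: (autocov_noise (Phi := Phi) MC mb r0 i i 0).
    by rewrite /u; ring.
  rewrite -mulr_sumr; congr (2 * _).
  have cu : series (fun l => correlation P pi m l r0 r0) @ \oo --> \sum_i limn (series (u i)).
    rewrite (_ : series _ = fun n => \sum_i series (u i) n); last first.
      apply/funext => n; rewrite /series/= [RHS]exchange_big; apply: eq_bigr => l _.
      exact: correlation_sym.
    apply: cvg_big => [|i _]; [exact: add_continuous|exact: (fcvg i i).2].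
  exact: cvg_unique cu (ser _ _ rE vE rr).
Qed.
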